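(* Let $(A,R,S)$ satisfy the rank condition stated in the context, let $x,y\in\mathbb{R}^r$, let $P,Q$ be positive semi-definite $r\times r$ matrices, and let $\eta_0=\mathcal{N}(x,P)$, $\mu_0=\mathcal{N}(y,Q)$. There exist $\delta=\delta(P,Q)>0$, depending on the distance between $P$ and $Q$, and a finite constant $c_\delta$ such that for every $t\ge\delta$ $$\mathbb{W}_2(\Phi_t(\eta_0),\Phi_t(\mu_0))\le c_\delta\,e^{-\beta t}\left(\|x-y\|+(\|x\|\vee1)\|P-Q\|\right),$$ and for all sufficiently large $t$ $$\mathrm{Ent}(\Phi_t(\eta_0)\mid\Phi_t(\mu_0))\le c_\delta\left(\|P-Q\|+\left(\|x\|^2\|P-Q\|^2+\|x-y\|^2\right)\right)e^{-2\beta t}.$$ In addition, when $P=Q$, for every $n\ge1$ and $t\ge\delta$, $$\mathbb{W}_n(\Phi_t(\eta_0),\Phi_t(\mu_0))\le c_\delta\,e^{-\beta t}\|x-y\|\quad\text{and}\quad \mathrm{Ent}(\Phi_t(\eta_0)\mid\Phi_t(\mu_0))\le c_\delta\,e^{-2\beta t}\|x-y\|^2.$$ Here $c_\delta$ depends only on $\delta$ and the model parameters.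
   Context: Setting: $r\ge1$; $A,R,S$ are real $r\times r$ matrices, $R,S$ symmetric positive semi-definite; $'$ denotes transposition. Rank condition: the matrices $[R^{1/2},AR^{1/2},\ldots,A^{r-1}R^{1/2}]$ and $[S^{1/2},A'S^{1/2},\ldots,(A')^{r-1}S^{1/2}]$ both have rank $r$. Under this condition let $P_\infty$ be the unique positive definite solution of $AP+PA'+R-PSP=0$. The matrix $A-P_\infty S$ is Hurwitz, and $\alpha,\beta>0$ are fixed parameters with $\|e^{t(A-P_\infty S)}\|\le\alpha e^{-\beta t}$ for all $t\ge0$. Matrix norms are spectral norms. With $V(x)=\frac12x'Sx$, $BB'=R$, $W_t$ a Brownian motion and $dX_t=AX_t\,dt+B\,dW_t$, put $\mathcal{K}_t(f)(x)=\mathbb{E}\big(f(X_t)\exp(-\int_0^tV(X_u)du)\mid X_0=x\big)$ and, for a probability measure $\eta$ on $\mathbb{R}^r$, $\Phi_t(\eta)(f)=\eta\mathcal{K}_t(f)/\eta\mathcal{K}_t(1)$, where $\eta\mathcal{K}_t(f)=\int\eta(dx)\mathcal{K}_t(f)(x)$. $\mathbb{W}_n(\nu_1,\nu_2)=\inf\mathbb{E}(\|Z_1-Z_2\|^n)^{1/n}$, the infimum over couplings with $Z_i\sim\nu_i$. $\mathrm{Ent}(\nu_1\mid\nu_2)=\int\log(d\nu_1/d\nu_2)d\nu_1$ if $\nu_1\ll\nu_2$, $+\infty$ otherwise. $\mathcal{N}(m,P)$ is the Gaussian measure with mean $m$ and covariance $P$ (a Dirac mass if $P=0$). *)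

(* Defs.v *)
(* Mathematical Components and MathComp-Analysis. *)
From HB Require Import structures.
From mathcomp Require Export all_boot all_order all_algebra.
From mathcomp Require Export all_classical all_reals all_analysis.

Set Implicit Arguments.
Unset Strict Implicit.
Unset Printing Implicit Defensive.

Export Order.TTheory GRing.Theory Num.Theory.
Export numFieldNormedType.Exports.

Local Open Scope classical_set_scope.
Local Open Scope ring_scope.

(* Matrices, hence the space R^n of column vectors, carry the Borel
   sigma-algebra. *)
HB.instance Definition _ (K : realType) (m n : nat) :=
  @isMeasurable.Build (sigma_display (@open 'M[K]_(m, n))) 'M[K]_(m, n)
    <<s @open 'M[K]_(m, n) >> (@sigma_algebra0 _ setT _) (@sigma_algebraC _ _)
    (@sigma_algebra_bigcup _ setT _).

Section matrices.
Context {K : realType}.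

Definition quad {n} (M : 'M[K]_n) (z : 'cV[K]_n) : K := (z^T *m M *m z) 0 0.

Definition psdmx {n} (M : 'M[K]_n) : Prop :=
  M^T = M /\ forall z : 'cV[K]_n, 0 <= quad M z.

Definition posdefmx {n} (M : 'M[K]_n) : Prop :=
  M^T = M /\ forall z : 'cV[K]_n, z != 0 -> 0 < quad M z.

(* The unique positive semi-definite square root of a positive semi-definite
   matrix (an arbitrary default value if there is none). *)
Definition sqrtmx {n} (M : 'M[K]_n) : 'M[K]_n :=
  get [set N : 'M[K]_n | psdmx N /\ N *m N = M].

(* The norm `|x| of the library on matrices is the max norm. *)
Definition enorm {n} (x : 'cV[K]_n) : K := Num.sqrt (\sum_i x i 0 ^+ 2).

Definition spnorm {m n} (M : 'M[K]_(m, n)) : K :=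
  sup [set enorm (M *m z) | z in [set z : 'cV[K]_n | enorm z <= 1]].

Definition expmx {n} (M : 'M[K]_n.+1) : 'M[K]_n.+1 :=
  limn (series (fun k => k`!%:R^-1 *: M ^+ k)).

Definition rank_condition {n} (A R S : 'M[K]_n.+1) : Prop :=
  \rank (\mxrow_(k < n.+1) (A ^+ k *m sqrtmx R)) = n.+1 /\
  \rank (\mxrow_(k < n.+1) (A^T ^+ k *m sqrtmx S)) = n.+1.

Definition riccati {n} (A R S P : 'M[K]_n) : 'M[K]_n :=
  A *m P + P *m A^T + R - P *m S *m P.

End matrices.

Section distances.
Context {K : realType}.

(* [normal_prob m s] is the Gaussian law of mean m and standard deviation s
   only when s != 0. *)
Definition gaussian1 (m v : K) (D : set K) : \bar K :=
  if v == 0 then \d_m D else normal_prob m (Num.sqrt v) D.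

(* N(m, P): every linear form u'z has law N(u'm, u'Pu); this covers degenerate
   covariances, and N(m, 0) is the Dirac mass at m. *)
Definition gaussian_law {n} (nu : set 'cV[K]_n -> \bar K) (m : 'cV[K]_n)
    (P : 'M[K]_n) : Prop :=
  forall (u : 'cV[K]_n) (D : set K), measurable D ->
    nu [set z | D ((u^T *m z) 0 0)] = gaussian1 ((u^T *m m) 0 0) (quad P u) D.

Definition coupling {d1 d2} {T1 : measurableType d1} {T2 : measurableType d2}
    (nu1 : probability T1 K) (nu2 : probability T2 K)
    (g : probability (T1 * T2)%type K) : Prop :=
  (forall D, measurable D -> g (fst @^-1` D) = nu1 D) /\
  (forall D, measurable D -> g (snd @^-1` D) = nu2 D).

Definition wasserstein {n} (k : nat) (nu1 nu2 : probability 'cV[K]_n K) :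
    \bar K :=
  ereal_inf [set (poweR (\int[g]_z (enorm (z.1 - z.2) ^+ k)%:E) k%:R^-1)%E
            | g in coupling nu1 nu2].

Definition relative_entropy {d} {T : measurableType d}
    (nu1 nu2 : probability T K) : \bar K :=
  if `[< nu1 `<< nu2 >] then
    (\int[nu1]_z lne (Radon_Nikodym (charge_of_finite_measure nu1) nu2 z))%E
  else +oo%E.

End distances.

Section processes.
Context {K : realType}.

(* Times are nonnegative: processes are indexed by K but only constrained on
   [0, +oo[. *)
Record brownian {d} {Omega : measurableType d} (Pr : probability Omega K) {q}
    (W : K -> Omega -> 'cV[K]_q) : Prop := Brownian {
  brownian_measurable : forall t : K, 0 <= t -> measurable_fun setT (W t) ;
  brownian_continuous :
    forall w, {within `[0, +oo[, continuous (fun t => W t w)} ;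
  brownian0 : {ae Pr, forall w, W 0 w = 0} ;
  brownian_gaussian : forall s t : K, 0 <= s -> s < t ->
    gaussian_law (pushforward Pr (fun w => W t w - W s w)) 0 (t - s)%:M ;
  brownian_independent : forall (k : nat) (s : nat -> K)
      (D : nat -> set 'cV[K]_q),
    0 <= s 0%N -> (forall i, s i <= s i.+1) -> (forall i, measurable (D i)) ->
    Pr (\bigcap_(i < k) [set w | D i (W (s i.+1) w - W (s i) w)]) =
    (\prod_(i < k) Pr [set w | D i (W (s i.+1) w - W (s i) w)%R])%E
}.

(* [X x] is the solution of dX = A X dt + B dW with X_0 = x; as the noise is
   additive, no stochastic integral is needed. *)
Record linear_diffusion {d} {Omega : measurableType d}
    (Pr : probability Omega K) {n q} (A : 'M[K]_n) (B : 'M[K]_(n, q))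
    (W : K -> Omega -> 'cV[K]_q) (X : 'cV[K]_n -> K -> Omega -> 'cV[K]_n) :
    Prop := LinearDiffusion {
  diffusion_measurable :
    forall x (t : K), 0 <= t -> measurable_fun setT (X x t) ;
  diffusion_continuous :
    forall x w, {within `[0, +oo[, continuous (fun t => X x t w)} ;
  diffusion_eq : forall x, {ae Pr, forall w, forall t : K, 0 <= t ->
    X x t w =
      x + \col_i (\int[lebesgue_measure]_(u in `[0, t]) (A *m X x u w) i 0)
        + B *m W t w}
}.

Section feynman_kac.
Context {d} {Omega : measurableType d} (Pr : probability Omega K) {n : nat}.
Variables (S : 'M[K]_n) (X : 'cV[K]_n -> K -> Omega -> 'cV[K]_n).

Definition potential (x : 'cV[K]_n) : K := 2^-1 * quad S x.

Definition fk_semigroup (t : K) (f : 'cV[K]_n -> K) (x : 'cV[K]_n) : K :=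
  \int[Pr]_w (f (X x t w) *
    expR (- \int[lebesgue_measure]_(u in `[0, t]) potential (X x u w))).

(* The probability measure Phi_t(eta) determined by its values on bounded
   measurable functions. *)
Definition fk_flow (t : K) (eta : probability 'cV[K]_n K) :
    probability 'cV[K]_n K :=
  get [set nu : probability 'cV[K]_n K |
    forall f : 'cV[K]_n -> K, measurable_fun setT f ->
      (exists M : K, forall x, `|f x| <= M) ->
      \int[nu]_x f x =
      (\int[eta]_x fk_semigroup t f x) / (\int[eta]_x fk_semigroup t (cst 1) x)].

End feynman_kac.
End processes.

(* Main.v *)
(* The filter flow maps N(x, P) to a Gaussian law, so that everything reduces to
   explicit formulas for the mean and the covariance at time t. With
   M = A - Pinf S and the gramian G_t (the integral of e^{sM'} S e^{sM} over
   [0, t]), the linear system U' = -A'U + SV, V' = RU + AV started at (1, P)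
   gives the covariance V U^-1 and the mean U^-T x. One finds
   U_t^-T = e^{tM} G_t^-1 (G_t^-1 - Pinf + P)^-1, where G_t^-1 - Pinf is bounded
   below uniformly in t >= 1: this yields the decay rate with constants that do
   not depend on P, so that delta = 1 is a valid choice. A common affine map
   couples two Gaussian laws, which bounds the Wasserstein distances, and the
   entropy is bounded by its symmetrisation, which is explicit.

   That the flow preserves Gaussian laws is proved on the Euler scheme: the
   Feynman-Kac weight becomes a product of exp(-(l'X_k)^2/2), each factor acts on
   Gaussian data by the rank-one Kalman update, and the discrete means and
   covariances are linearised exactly by a recursion converging to (U, V). Laws
   are identified through the integrals of cos(u'z + b). *)
From HB Require Import structures.
Require Import Defs.
From mathcomp Require Import ring lra measurable_realfun.
From mathcomp Require complex.

Set Implicit Arguments.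
Unset Strict Implicit.
Unset Printing Implicit Defensive.

Local Open Scope classical_set_scope.
Local Open Scope ring_scope.

(** Three obstacles shape the proof. [linear_diffusion] gives measurability for each starting point
    separately, so [X z] cannot be integrated over the initial law by Fubini; as the noise is
    additive, [X z] agrees almost surely with e^{sA} z + [X 0], which is jointly measurable. The
    initial covariance may be singular, so the discrete filter is tracked through linear relations
    between (U, V) and its covariance and mean that never invert the covariance. Finally the
    constants must not see P. With G the limit of the gramians G_t, the lower bound on G_t^-1 - Pinf
    comes from G_t <= G < Pinf^-1; the last inequality is strict because Pinf^-1 - G is itself a
    gramian, with source Pinf^-1 R Pinf^-1, which the rank condition on (A, R) makes positive
    definite. The rank condition on (A, S) makes G_1 invertible, whence the threshold 1. For t >= 1
    every covariance dominates the one reached at time 1 from P = 0; this controls the inverses in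
    the entropy and transport bounds. Cosines with a free phase keep all integrals real, and their
    products are again sums of cosines. *)

Section euclid.
Context {K : realType}.
Implicit Types n : nat.

(** * Inner products, quadratic forms, operator bounds and the order on symmetric matrices *)

Definition cdot {n} (u v : 'cV[K]_n) : K := (u^T *m v) 0 0.

Lemma cdotE n (u v : 'cV[K]_n) : cdot u v = \sum_i u i 0 * v i 0.
Proof. by rewrite /cdot mxE; apply: eq_bigr => i _; rewrite mxE. Qed.

Lemma cdotC n (u v : 'cV[K]_n) : cdot u v = cdot v u.
Proof. by rewrite !cdotE; apply: eq_bigr => i _; rewrite mulrC. Qed.

Lemma cdotDr n (u v w : 'cV[K]_n) : cdot u (v + w) = cdot u v + cdot u w.
Proof. by rewrite /cdot mulmxDr mxE. Qed.

Lemma cdotDl n (u v w : 'cV[K]_n) : cdot (v + w) u = cdot v u + cdot w u.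
Proof. by rewrite /cdot linearD mulmxDl mxE. Qed.

Lemma cdotZr n (a : K) (u v : 'cV[K]_n) : cdot u (a *: v) = a * cdot u v.
Proof. by rewrite /cdot -scalemxAr mxE. Qed.

Lemma cdotZl n (a : K) (u v : 'cV[K]_n) : cdot (a *: u) v = a * cdot u v.
Proof. by rewrite cdotC cdotZr cdotC. Qed.

Lemma cdotNr n (u v : 'cV[K]_n) : cdot u (- v) = - cdot u v.
Proof. by rewrite -scaleN1r cdotZr mulN1r. Qed.

Lemma cdotNl n (u v : 'cV[K]_n) : cdot (- u) v = - cdot u v.
Proof. by rewrite -scaleN1r cdotZl mulN1r. Qed.

Lemma cdotBr n (u v w : 'cV[K]_n) : cdot u (v - w) = cdot u v - cdot u w.
Proof. by rewrite cdotDr cdotNr. Qed.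

Lemma cdotBl n (u v w : 'cV[K]_n) : cdot (v - w) u = cdot v u - cdot w u.
Proof. by rewrite cdotDl cdotNl. Qed.

Lemma cdot0r n (u : 'cV[K]_n) : cdot u 0 = 0.
Proof. by rewrite /cdot mulmx0 mxE. Qed.

Lemma cdot0l n (u : 'cV[K]_n) : cdot 0 u = 0.
Proof. by rewrite cdotC cdot0r. Qed.

Lemma cdot_mulmxl m n (M : 'M[K]_(m, n)) u v :
  cdot (M *m u) v = cdot u (M^T *m v).
Proof. by rewrite /cdot trmx_mul mulmxA. Qed.

Lemma cdot_mulmxr m n (M : 'M[K]_(m, n)) u v :
  cdot u (M *m v) = cdot (M^T *m u) v.
Proof. by rewrite cdot_mulmxl trmxK. Qed.

Lemma cdot_ge0 n (u : 'cV[K]_n) : 0 <= cdot u u.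
Proof. by rewrite cdotE sumr_ge0// => i _; rewrite -expr2 sqr_ge0. Qed.

Lemma cdot_eq0 n (u : 'cV[K]_n) : cdot u u = 0 -> u = 0.
Proof.
rewrite cdotE => /eqP; rewrite psumr_eq0 => [/allP h|i _]; last first.
  by rewrite -expr2 sqr_ge0.
apply/colP => i; rewrite mxE; have := h i (mem_index_enum _).
by rewrite /= mulf_eq0 orbb => /eqP.
Qed.

Lemma cdot_delta n (u : 'cV[K]_n) i : cdot (delta_mx i 0) u = u i 0.
Proof.
rewrite cdotE (bigD1 i)//= big1 ?addr0 ?mxE ?eqxx ?mul1r// => j ji.
by rewrite mxE (negbTE ji) mul0r.
Qed.

Lemma quadE n (M : 'M[K]_n) z : quad M z = cdot z (M *m z).
Proof. by rewrite /quad /cdot mulmxA. Qed.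

Lemma quadD n (M N : 'M[K]_n) z : quad (M + N) z = quad M z + quad N z.
Proof. by rewrite !quadE mulmxDl cdotDr. Qed.

Lemma quadN n (M : 'M[K]_n) z : quad (- M) z = - quad M z.
Proof. by rewrite !quadE mulNmx cdotNr. Qed.

Lemma quadB n (M N : 'M[K]_n) z : quad (M - N) z = quad M z - quad N z.
Proof. by rewrite quadD quadN. Qed.

Lemma quadZ n a (M : 'M[K]_n) z : quad (a *: M) z = a * quad M z.
Proof. by rewrite !quadE -scalemxAl cdotZr. Qed.

Lemma quadcZ n a (M : 'M[K]_n) z : quad M (a *: z) = a ^+ 2 * quad M z.
Proof. by rewrite !quadE -scalemxAr cdotZr cdotZl; ring. Qed.

Lemma quad1 n (z : 'cV[K]_n) : quad 1%:M z = cdot z z.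
Proof. by rewrite quadE mul1mx. Qed.

Lemma quadc0 n (M : 'M[K]_n) : quad M 0 = 0.
Proof. by rewrite quadE cdot0l. Qed.

Lemma quad_conj m n (M : 'M[K]_n) (N : 'M[K]_(m, n)) z :
  quad (N *m M *m N^T) z = quad M (N^T *m z).
Proof. by rewrite !quadE cdot_mulmxl trmxK !mulmxA. Qed.

Lemma sym_cdot n (M : 'M[K]_n) u v : M^T = M -> cdot (M *m u) v = cdot u (M *m v).
Proof. by move=> h; rewrite cdot_mulmxl h. Qed.

Lemma quadcD n (M : 'M[K]_n) u v : M^T = M ->
  quad M (u + v) = quad M u + 2 * cdot u (M *m v) + quad M v.
Proof.
move=> h; rewrite !quadE mulmxDr !cdotDr !cdotDl -(sym_cdot u v h).
by rewrite [cdot (M *m u) v]cdotC; ring.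
Qed.

(** The polynomial [quad M (u + s *: v)] in [s] is nonnegative, and its value at the minimiser -b/c
    is (ac - b^2)/c. When c = 0 the polynomial is affine, so its slope must vanish. *)
Lemma psd_CS n (M : 'M[K]_n) u v : psdmx M ->
  cdot u (M *m v) ^+ 2 <= quad M u * quad M v.
Proof.
move=> [Ms Mp]; set a := quad M u; set c := quad M v; set b := cdot _ _.
have h s : 0 <= a + 2 * s * b + s ^+ 2 * c.
  have := Mp (u + s *: v); rewrite quadcD// quadcZ -scalemxAr cdotZr -/b -/a -/c.
  by rewrite mulrA.
have a0 : 0 <= a by exact: Mp.
have c0 : 0 <= c by exact: Mp.
have [c00|cn0] := eqVneq c 0.
  have [->|b0] := eqVneq b 0; first by rewrite expr0n mulr_ge0.
  (* At this [s] the affine polynomial takes the value -1. *)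
  exfalso; have := h (- (a + 1) / (2 * b)).
  rewrite c00 (_ : _ + _ = -1); first by rewrite oppr_ge0 ler10.
  by field.
have := h (- b / c).
rewrite (_ : _ + _ = (a * c - b ^+ 2) / c); last by field.
rewrite pmulr_lge0 ?invr_gt0 ?lt0r ?cn0//.
by rewrite subr_ge0.
Qed.

Lemma psdmx1 n : psdmx (1%:M : 'M[K]_n).
Proof. by split=> [|z]; rewrite ?trmx1// quad1 cdot_ge0. Qed.

Lemma cdot_CS n (u v : 'cV[K]_n) : cdot u v ^+ 2 <= cdot u u * cdot v v.
Proof. by have := psd_CS u v (psdmx1 n); rewrite !quad1 mul1mx. Qed.

Lemma enorm_sqr n (u : 'cV[K]_n) : enorm u ^+ 2 = cdot u u.
Proof.
rewrite /enorm sqr_sqrtr ?cdotE//.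
by apply: sumr_ge0 => i _; rewrite sqr_ge0.
Qed.

Lemma enorm_ge0 n (u : 'cV[K]_n) : 0 <= enorm u.
Proof. exact: sqrtr_ge0. Qed.
Hint Resolve enorm_ge0 : core.

Lemma enormE n (u : 'cV[K]_n) : enorm u = Num.sqrt (cdot u u).
Proof. by rewrite -enorm_sqr sqrtr_sqr ger0_norm. Qed.

Lemma enorm0 n : enorm (0 : 'cV[K]_n) = 0.
Proof. by rewrite enormE cdot0r sqrtr0. Qed.

Lemma enorm_eq0 n (u : 'cV[K]_n) : enorm u = 0 -> u = 0.
Proof. by move=> h; apply: cdot_eq0; rewrite -enorm_sqr h expr0n. Qed.

Lemma cdot_le n (u v : 'cV[K]_n) : `|cdot u v| <= enorm u * enorm v.
Proof.
rewrite -ler_sqr ?nnegrE ?mulr_ge0// real_normK ?num_real// exprMn !enorm_sqr.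
exact: cdot_CS.
Qed.

Lemma enormD n (u v : 'cV[K]_n) : enorm (u + v) <= enorm u + enorm v.
Proof.
rewrite -ler_sqr ?nnegrE ?addr_ge0// enorm_sqr cdotDl !cdotDr [cdot v u]cdotC.
rewrite sqrrD !enorm_sqr; have := ler_norm (cdot u v); have := cdot_le u v.
by lra.
Qed.

Lemma enormZ n a (u : 'cV[K]_n) : enorm (a *: u) = `|a| * enorm u.
Proof. by rewrite !enormE cdotZl cdotZr mulrA -expr2 sqrtrM ?sqr_ge0// sqrtr_sqr. Qed.

Lemma enormN n (u : 'cV[K]_n) : enorm (- u) = enorm u.
Proof. by rewrite -scaleN1r enormZ normrN1 mul1r. Qed.

Lemma enormB n (u v : 'cV[K]_n) : enorm (u - v) <= enorm u + enorm v.
Proof. by rewrite -(enormN v) enormD. Qed.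

Lemma coord_le_enorm n (u : 'cV[K]_n) i : `|u i 0| <= enorm u.
Proof.
rewrite -ler_sqr ?nnegrE// real_normK ?num_real// /enorm sqr_sqrtr; last first.
  by apply: sumr_ge0 => j _; rewrite sqr_ge0.
by rewrite (bigD1 i)//= lerDl sumr_ge0// => j _; rewrite sqr_ge0.
Qed.

(** The Hilbert-Schmidt norm. As an explicit operator bound it shows that the supremum defining
    [spnorm] is finite, and it is the default constant for [opb]. *)
Definition frob {m n} (M : 'M[K]_(m, n)) : K :=
  Num.sqrt (\sum_i \sum_j M i j ^+ 2).

Lemma frob_ge0 m n (M : 'M[K]_(m, n)) : 0 <= frob M.
Proof. exact: sqrtr_ge0. Qed.

Lemma enorm_mulmx_frob m n (M : 'M[K]_(m, n)) z :
  enorm (M *m z) <= frob M * enorm z.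
Proof.
rewrite -ler_sqr ?nnegrE ?mulr_ge0 ?frob_ge0// exprMn enorm_sqr /frob.
rewrite sqr_sqrtr; last by do 2!apply: sumr_ge0 => ? _; rewrite sqr_ge0.
rewrite cdotE mulr_suml; apply: ler_sum => i _; rewrite -expr2.
have -> : (M *m z) i 0 = cdot (row i M)^T z.
  by rewrite cdotE mxE; apply: eq_bigr => j _; rewrite !mxE.
apply: le_trans (cdot_CS _ _) _; rewrite enorm_sqr ler_wpM2r ?cdot_ge0//.
by rewrite cdotE; apply: ler_sum => j _; rewrite !mxE expr2.
Qed.

Lemma spnorm_has_sup m n (M : 'M[K]_(m, n)) :
  has_sup [set enorm (M *m z) | z in [set z : 'cV[K]_n | enorm z <= 1]].
Proof.
split; first by exists (enorm (M *m 0)), 0 => //=; rewrite enorm0 ler01.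
exists (frob M) => _ [z /= z1 <-]; apply: le_trans (enorm_mulmx_frob _ _) _.
by rewrite ler_piMr ?frob_ge0.
Qed.

Lemma enorm_spnorm m n (M : 'M[K]_(m, n)) z : enorm (M *m z) <= spnorm M * enorm z.
Proof.
have [z0|zn0] := eqVneq z 0; first by rewrite z0 mulmx0 !enorm0 mulr0.
have ez : enorm z != 0 by apply: contra_neq zn0 => /enorm_eq0.
have ez0 : 0 < enorm z by rewrite lt0r ez /=.
rewrite -ler_pdivrMr//; apply: (ub_le_sup (spnorm_has_sup M).2).
exists ((enorm z)^-1 *: z) => /=.
  by rewrite enormZ gtr0_norm ?invr_gt0// mulVf.
by rewrite -scalemxAr enormZ gtr0_norm ?invr_gt0// mulrC.
Qed.

Lemma spnorm_ge0 m n (M : 'M[K]_(m, n)) : 0 <= spnorm M.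
Proof.
have := ub_le_sup (spnorm_has_sup M).2; apply.
by exists 0 => /=; rewrite ?mulmx0 ?enorm0.
Qed.

(* [opb M c]: the spectral norm of M is at most c. *)
Definition opb {m n} (M : 'M[K]_(m, n)) (c : K) :=
  0 <= c /\ forall z, enorm (M *m z) <= c * enorm z.

Lemma opb_ge0 m n (M : 'M[K]_(m, n)) c : opb M c -> 0 <= c. Proof. by case. Qed.

Lemma opb_spnorm m n (M : 'M[K]_(m, n)) : opb M (spnorm M).
Proof. by split; [exact: spnorm_ge0 | exact: enorm_spnorm]. Qed.

Lemma opb_frob m n (M : 'M[K]_(m, n)) : opb M (frob M).
Proof. by split; [exact: frob_ge0 | exact: enorm_mulmx_frob]. Qed.

Lemma opbM m n p (M : 'M[K]_(m, n)) (N : 'M[K]_(n, p)) a b :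
  opb M a -> opb N b -> opb (M *m N) (a * b).
Proof.
move=> [a0 Ma] [b0 Nb]; split; first exact: mulr_ge0.
move=> z; rewrite -mulmxA; apply: le_trans (Ma _) _.
by rewrite -mulrA ler_wpM2l.
Qed.

Lemma opbD m n (M N : 'M[K]_(m, n)) a b : opb M a -> opb N b -> opb (M + N) (a + b).
Proof.
move=> [a0 Ma] [b0 Nb]; split; first exact: addr_ge0.
move=> z; rewrite mulmxDl; apply: le_trans (enormD _ _) _.
by rewrite mulrDl lerD.
Qed.

Lemma opbN m n (M : 'M[K]_(m, n)) a : opb M a -> opb (- M) a.
Proof. by move=> [a0 Ma]; split=> // z; rewrite mulNmx enormN. Qed.

Lemma opb_tr m n (M : 'M[K]_(m, n)) a : opb M a -> opb M^T a.
Proof.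
move=> [a0 Ma]; split=> // z; set w := M^T *m z.
have [w0|w0] := eqVneq (enorm w) 0; first by rewrite w0 mulr_ge0.
have wp : 0 < enorm w by rewrite lt0r w0 /=.
rewrite -(ler_pM2r wp) -expr2 enorm_sqr {2}/w cdot_mulmxr trmxK.
apply: le_trans (ler_norm _) _; apply: le_trans (cdot_le _ _) _.
apply: le_trans (ler_wpM2r _ (Ma _)) _ => //.
by rewrite mulrAC.
Qed.

Lemma opb_coord m n (M : 'M[K]_(m, n)) a i j : opb M a -> `|M i j| <= a.
Proof.
move=> [a0 Ma]; have := coord_le_enorm (M *m delta_mx j 0) i.
rewrite -(colE j M) mxE => /le_trans; apply; rewrite colE.
apply: le_trans (Ma _) _; rewrite (_ : enorm _ = 1) ?mulr1//.
by rewrite enormE cdot_delta mxE !eqxx sqrtr1.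
Qed.

Lemma quad_opb n (M : 'M[K]_n) a z : opb M a -> `|quad M z| <= a * cdot z z.
Proof.
move=> [a0 Ma]; rewrite quadE; apply: le_trans (cdot_le _ _) _.
by rewrite -enorm_sqr mulrC expr2 mulrA ler_wpM2r.
Qed.

(** Coercivity with constant [e], for matrices that need not be symmetric: it is also applied to the
    Euler step [1%:M + h *: A]. *)
Definition ldb {n} (M : 'M[K]_n) (e : K) :=
  0 < e /\ forall z, e * cdot z z <= quad M z.

Lemma ldb_unit n (M : 'M[K]_n) e : ldb M e -> M \in unitmx.
Proof.
move=> [e0 Me]; rewrite -unitmx_tr -row_free_unit -kermx_eq0.
apply/eqP/row_matrixP => i; rewrite row0.
set v := row i _; have vM : v *m M^T = 0.
  by apply/eqP; rewrite -sub_kermx row_sub.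
have : quad M v^T = 0.
  by rewrite quadE -[M]trmxK -trmx_mul vM trmx0 cdot0r.
move=> q0; have := Me v^T; rewrite q0 pmulr_rle0// => c0.
have : v^T = 0 by apply: cdot_eq0; apply/eqP; rewrite eq_le c0 cdot_ge0.
by move=> /(congr1 trmx); rewrite trmxK trmx0.
Qed.

Lemma ldb_inv n (M : 'M[K]_n) e : ldb M e -> opb (invmx M) e^-1.
Proof.
move=> Me; have Mu := ldb_unit Me; case: Me => [e0 Me]; split=> [|z].
  by rewrite invr_ge0 ltW.
set y := invmx M *m z; have -> : z = M *m y by rewrite mulKVmx.
rewrite mulrC ler_pdivlMr//.
have [y0|y0] := eqVneq (enorm y) 0; first by rewrite y0 mul0r.
have yp : 0 < enorm y by rewrite lt0r y0 /=.
rewrite -(ler_pM2l yp) mulrA -expr2 enorm_sqr mulrC.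
apply: le_trans (Me _) _; rewrite quadE.
by apply: le_trans (ler_norm _) _; exact: cdot_le.
Qed.

Lemma posdef_psd n (M : 'M[K]_n) : posdefmx M -> psdmx M.
Proof.
move=> [Ms Mp]; split=> // z; have [->|/Mp/ltW//] := eqVneq z 0.
by rewrite quadc0.
Qed.

Lemma ldb_posdef n (M : 'M[K]_n) e : M^T = M -> ldb M e -> posdefmx M.
Proof.
move=> Ms [e0 Me]; split=> // z z0; apply: lt_le_trans (Me z).
rewrite mulr_gt0// lt0r cdot_ge0 andbT; apply: contra_neq z0; exact: cdot_eq0.
Qed.

Lemma posdef_unit n (M : 'M[K]_n) : posdefmx M -> M \in unitmx.
Proof.
move=> [Ms Mp]; rewrite -row_free_unit -kermx_eq0.
apply/eqP/row_matrixP => i; rewrite row0.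
set v := row i _; have vM : v *m M = 0 by apply/eqP; rewrite -sub_kermx row_sub.
apply/eqP; apply: contraT => v0.
have /Mp : v^T != 0 by apply: contraNneq v0 => /(congr1 trmx); rewrite trmxK trmx0 => ->.
by rewrite quadE -[X in cdot _ (X *m _)]Ms -trmx_mul vM trmx0 cdot0r ltxx.
Qed.

Lemma invmx_sym n (M : 'M[K]_n) : M^T = M -> (invmx M)^T = invmx M.
Proof. by move=> h; rewrite trmx_inv h. Qed.

Lemma quad_invmx n (M : 'M[K]_n) z : M^T = M -> M \in unitmx ->
  quad (invmx M) z = quad M (invmx M *m z).
Proof. by move=> Ms Mu; rewrite !quadE mulKVmx// cdot_mulmxl invmx_sym. Qed.

Lemma posdef_inv n (M : 'M[K]_n) : posdefmx M -> posdefmx (invmx M).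
Proof.
move=> Mp; have Mu := posdef_unit Mp; case: Mp => [Ms Mp].
split=> [|z z0]; first exact: invmx_sym.
rewrite quad_invmx//; apply: Mp; apply: contraNneq z0 => /(congr1 (mulmx M)).
by rewrite mulKVmx// mulmx0 => ->.
Qed.

(** Cauchy-Schwarz for the form of the inverse, between z and Mz, gives |z|^4 <= (M^-1 z, z)(Mz, z).
    A norm bound c on M^-1 then yields coercivity, without compactness of the sphere; c + 1 replaces
    c to stay positive. *)
Lemma posdef_ldb n (M : 'M[K]_n) : posdefmx M -> exists e, ldb M e.
Proof.
move=> Mp; have Mu := posdef_unit Mp.
have [Vs Vp] := posdef_psd (posdef_inv Mp).
have := opb_frob (invmx M); set c := frob _ => cb; have c0 := opb_ge0 cb.
exists (c + 1)^-1; split=> [|z]; first by rewrite invr_gt0; lra.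
have := psd_CS z (M *m z) (posdef_psd (posdef_inv Mp)).
rewrite mulKmx// (_ : quad (invmx M) (M *m z) = quad M z); last first.
  by rewrite quadE mulKmx// cdotC quadE.
have := quad_opb z cb; rewrite ger0_norm// => qz h.
rewrite mulrC ler_pdivrMr; last by lra.
have [z0|z0] := eqVneq (cdot z z) 0.
  by rewrite z0 mulr_ge0 ?addr_ge0// (posdef_psd Mp).2.
have zp : 0 < cdot z z by rewrite lt0r z0 cdot_ge0.
have qM : 0 <= quad M z by rewrite (posdef_psd Mp).2.
rewrite -(ler_pM2r zp); nra.
Qed.

(** A completed square: expand the nonnegative number [quad M (y - invmx M *m z)] at y = N^-1 z and
    use (My, y) <= (Ny, y) = (y, z). The strict version below differs only by y != 0. *)
Lemma inv_antitone n (M N : 'M[K]_n) : posdefmx M -> posdefmx N ->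
  (forall z, quad M z <= quad N z) -> forall z, quad (invmx N) z <= quad (invmx M) z.
Proof.
move=> Mp Np h z; have Mu := posdef_unit Mp; have Nu := posdef_unit Np.
set y := invmx N *m z.
have := (posdef_psd Mp).2 (y - invmx M *m z).
rewrite quadcD ?Mp.1// mulmxN mulKVmx// cdotNr [quad M (- _)]quadE mulmxN cdotNl cdotNr opprK.
have -> : cdot (invmx M *m z) (M *m (invmx M *m z)) = quad (invmx M) z.
  by rewrite mulKVmx// cdotC quadE.
have := h y; rewrite [quad N y]quadE {2}/y mulKVmx//.
have -> : cdot y z = quad (invmx N) z by rewrite cdotC quadE.
lra.
Qed.

Lemma inv_antitone_strict n (M N : 'M[K]_n) : posdefmx M -> posdefmx N ->
  posdefmx (N - M) -> posdefmx (invmx M - invmx N).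
Proof.
move=> Mp Np h; have Mu := posdef_unit Mp; have Nu := posdef_unit Np.
split=> [|z z0]; first by rewrite linearB /= !invmx_sym ?Mp.1 ?Np.1.
set y := invmx N *m z; have y0 : y != 0.
  apply: contraNneq z0 => /(congr1 (mulmx N)).
  by rewrite mulKVmx// mulmx0 => ->.
have := (posdef_psd Mp).2 (y - invmx M *m z).
rewrite quadcD ?Mp.1// mulmxN mulKVmx// cdotNr [quad M (- _)]quadE mulmxN cdotNl cdotNr opprK.
have -> : cdot (invmx M *m z) (M *m (invmx M *m z)) = quad (invmx M) z.
  by rewrite mulKVmx// cdotC quadE.
have := h.2 _ y0; rewrite !quadB [quad N y]quadE {2}/y mulKVmx//.
have -> : cdot y z = quad (invmx N) z by rewrite cdotC quadE.
lra.
Qed.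

Lemma psdD n (M N : 'M[K]_n) : psdmx M -> psdmx N -> psdmx (M + N).
Proof.
move=> [Ms Mp] [Ns Np]; split; first by rewrite linearD /= Ms Ns.
by move=> z; rewrite quadD addr_ge0.
Qed.

Lemma posdefD n (M N : 'M[K]_n) : posdefmx M -> psdmx N -> posdefmx (M + N).
Proof.
move=> [Ms Mp] [Ns Np]; split; first by rewrite linearD /= Ms Ns.
by move=> z z0; rewrite quadD ltr_wpDr// Mp.
Qed.

Lemma psd_conj m n (M : 'M[K]_n) (N : 'M[K]_(m, n)) :
  psdmx M -> psdmx (N *m M *m N^T).
Proof.
move=> [Ms Mp]; split; first by rewrite !trmx_mul trmxK Ms mulmxA.
by move=> z; rewrite quad_conj.
Qed.

Lemma psd_ker n (M : 'M[K]_n) z : psdmx M -> quad M z = 0 -> M *m z = 0.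
Proof.
move=> Mp h; apply: cdot_eq0.
have := psd_CS (M *m z) z Mp; rewrite h mulr0 => h2.
by apply/eqP; rewrite -sqrf_eq0 eq_le h2 sqr_ge0.
Qed.

End euclid.
#[global] Hint Resolve enorm_ge0 : core.

(** * Bounded measurable functions and the Borel structure on matrices *)

Section bounded_measurable.
Context {K : realType} {d} {T : measurableType d}.
Implicit Types (f g : T -> K) (mu : {finite_measure set T -> \bar K}).

Definition bmf f := measurable_fun setT f /\ exists M, forall x, `|f x| <= M.

Lemma bmf_cst c : bmf (cst c).
Proof. by split; [exact: measurable_cst | exists `|c|]. Qed.

Lemma bmfD f g : bmf f -> bmf g -> bmf (fun x => f x + g x).
Proof.
move=> [mf [M Mf]] [mg [N Ng]]; split; first exact: measurable_funD.
by exists (M + N) => x; rewrite (le_trans (ler_normD _ _))// lerD.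
Qed.

Lemma bmfM f g : bmf f -> bmf g -> bmf (fun x => f x * g x).
Proof.
move=> [mf [M Mf]] [mg [N Ng]]; split; first exact: measurable_funM.
exists (M * N) => x; rewrite normrM ler_pM//.
Qed.

Lemma bmfZ c f : bmf f -> bmf (fun x => c * f x).
Proof. by move=> h; apply: bmfM => //; exact: bmf_cst. Qed.

Lemma bmfB f g : bmf f -> bmf g -> bmf (fun x => f x - g x).
Proof.
move=> mf mg; have := bmfD mf (bmfZ (-1) mg).
by congr bmf; apply/funext => x; rewrite mulN1r.
Qed.

Lemma bmf_cos f : measurable_fun setT f -> bmf (fun x => cos (f x)).
Proof.
move=> mf; split.
  by apply: (measurableT_comp _ mf); apply: continuous_measurable_fun; exact: continuous_cos.
by exists 1 => x; rewrite ler_norml cos_geN1 cos_le1.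
Qed.

Lemma bmf_indic D : measurable D -> bmf (\1_D).
Proof.
move=> mD; split; first exact: measurable_indic.
by exists 1 => x; rewrite indicE; case: (x \in D); rewrite ?normr1 ?normr0.
Qed.

Lemma bmf_int mu f : bmf f -> mu.-integrable setT (EFin \o f).
Proof.
move=> [mf [M Mf]]; apply: measurable_bounded_integrable => //.
  by rewrite -ge0_fin_numE// fin_num_measure.
exists M; split; first exact: num_real.
by move=> N MN x _ /=; rewrite (le_trans (Mf x))// ltW.
Qed.

Lemma int_bmfD mu f g : bmf f -> bmf g ->
  \int[mu]_x (f x + g x) = \int[mu]_x f x + \int[mu]_x g x.
Proof. by move=> mf mg; rewrite RintegralD//; exact: bmf_int. Qed.

Lemma int_bmfB mu f g : bmf f -> bmf g ->
  \int[mu]_x (f x - g x) = \int[mu]_x f x - \int[mu]_x g x.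
Proof. by move=> mf mg; rewrite RintegralB//; exact: bmf_int. Qed.

Lemma int_bmfZ mu c f : bmf f -> \int[mu]_x (c * f x) = c * \int[mu]_x f x.
Proof. by move=> mf; rewrite RintegralZl//; exact: bmf_int. Qed.

Lemma Rint_cvg mu (f_ : nat -> T -> K) f M :
  (forall n, measurable_fun setT (f_ n)) -> measurable_fun setT f ->
  {ae mu, forall x, (fun n => f_ n x) @ \oo --> f x} ->
  (forall n x, `|f_ n x| <= M) ->
  (fun n => \int[mu]_x f_ n x) @ \oo --> \int[mu]_x f x.
Proof.
move=> mf_ mf cf bf.
have bM : mu.-integrable setT (EFin \o cst M) by apply: bmf_int; exact: bmf_cst.
have [] := @dominated_convergence _ T K mu setT measurableT
  (fun n => EFin \o f_ n) (EFin \o f) (EFin \o cst M) _ _ _ bM _.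
- by move=> n; apply/measurable_EFinP.
- exact/measurable_EFinP.
- by apply: filterS cf => x cx _; apply/fine_cvgP; split; first exact: nearW.
- by apply: aeW => x n _; rewrite /= lee_fin.
move=> intf _ cvf; apply: fine_cvg; rewrite fineK//.
exact: (@integrable_fin_num _ T K mu setT _ _ intf).
Qed.

(* Approximation from below by sums of indicators, [k] of which are needed for
   a precision [1 / k]. *)
Lemma count_approx (k : nat) (y : K) : 0 <= y <= k%:R ->
  `|y - \sum_(j < k) (j.+1%:R <= y)%R%:R| <= 1.
Proof.
elim: k y => [|k IH] y /andP[y0 yk]; rewrite ?big_ord_recr ?big_ord0 /=.
  have -> : y = 0 by apply/eqP; rewrite eq_le y0 yk.
  by rewrite subr0 normr0.
have [yk'|ky] := lerP y k%:R.
  rewrite (_ : (k.+1%:R <= y) = false) ?addr0 ?IH ?y0//.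
  by apply/negbTE; rewrite -ltNge (le_lt_trans yk')// ltr_nat.
rewrite (eq_bigr (fun=> 1)) => [|i _]; last first.
  by rewrite (le_trans _ (ltW ky))// ler_nat.
rewrite sumr_const card_ord; rewrite -natr1 in yk *.
by case: (lerP (k%:R + 1) y) => h /=; rewrite ler_norml; lra.
Qed.

(** Measure-theoretic induction for bounded functions. An affine change brings the values into
    [0, 1]; there f is the uniform limit of (k+1)^-1 times the number of levels i+1 <= (k+1) f(x), a
    finite combination of indicators, with error 1/(k+1) by [count_approx]. *)
Lemma bmf_class (H : (T -> K) -> Prop) :
  (forall D, measurable D -> H (\1_D)) ->
  (forall f g, bmf f -> bmf g -> H f -> H g -> H (fun x => f x + g x)) ->
  (forall c f, bmf f -> H f -> H (fun x => c * f x)) ->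
  (forall (f_ : nat -> T -> K) f M, (forall n, bmf (f_ n)) -> bmf f ->
    (forall n x, `|f_ n x| <= M) -> (forall x, (fun n => f_ n x) @ \oo --> f x) ->
    (forall n, H (f_ n)) -> H f) ->
  forall f, bmf f -> H f.
Proof.
move=> Hi HD HZ Hl.
have Hs (s : nat -> T -> K) n : (forall i, bmf (s i) /\ H (s i)) ->
    bmf (fun x => \sum_(i < n) s i x) /\ H (fun x => \sum_(i < n) s i x).
  move=> hs; elim: n => [|n [IH1 IH2]].
    have -> : (fun x => \sum_(i < 0) s i x) = (fun x => 0 * \1_(@set0 T) x).
      by apply/funext => x; rewrite big_ord0 mul0r.
    by split; [apply: bmfZ|apply: HZ; last apply: Hi];
      try (apply: bmf_indic); exact: measurable0.
  have -> : (fun x => \sum_(i < n.+1) s i x) = (fun x => \sum_(i < n) s i x + s n x).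
    by apply/funext => x; rewrite big_ord_recr.
  by have [? ?] := hs n; split; [apply: bmfD|apply: HD].
have Hc c : H (cst c).
  have -> : cst c = (fun x => c * \1_(@setT T) x).
    by apply/funext => x; rewrite indicT mulr1.
  by apply: HZ; [apply: bmf_indic|apply: Hi]; exact: measurableT.
suff H01 f : bmf f -> (forall x, 0 <= f x <= 1) -> H f.
  move=> f bf; have [mf [M Mf]] := bf.
  pose L := `|M| + 1; have L0 : 0 < L by rewrite ltr_wpDl.
  have Lf x : `|f x| <= L by rewrite (le_trans (Mf x))// (le_trans (ler_norm _))// lerDl.
  pose g x := (2 * L)^-1 * (f x + L).
  have bg : bmf g by apply: bmfZ; apply: bmfD => //; exact: bmf_cst.
  have -> : f = (fun x => 2 * L * g x + - L).
    by apply/funext => x; rewrite /g mulrA divff ?mul1r ?addrK// mulf_neq0 ?gt_eqF.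
  apply: HD; [exact: bmfZ|exact: bmf_cst| |exact: Hc].
  apply: HZ => //; apply: H01 => // x; rewrite /g.
  have := Lf x; rewrite ler_norml => /andP[l1 l2].
  have h1 : 0 <= f x + L by lra.
  rewrite mulr_ge0 /=; [|by rewrite invr_ge0 mulr_ge0 // ltW|exact: h1].
  by rewrite mulrC ler_pdivrMr ?mulr_gt0// mul1r; lra.
move=> bf f01; have [mf _] := bf.
pose s (k : nat) i x : K := \1_([set x | i.+1%:R <= k.+1%:R * f x]) x.
have ms k i : measurable [set x | i.+1%:R <= k.+1%:R * f x].
  have mk : measurable_fun setT (fun x => k.+1%:R * f x).
    by apply: measurable_funM => //; exact: measurable_cst.
  have := mk measurableT _ (measurable_itv `[(i.+1%:R : K), +oo[).
  rewrite setTI; congr measurable; apply/seteqP; split => x /=;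
    by rewrite in_itv /= andbT.
have hs k i : bmf (s k i) /\ H (s k i).
  by split; [apply: bmf_indic|apply: Hi]; exact: ms.
pose F k x := k.+1%:R^-1 * \sum_(i < k.+1) s k i x.
have FE k x : `|F k x - f x| <= k.+1%:R^-1.
  have k0 : 0 < k.+1%:R :> K by rewrite ltr0n.
  rewrite /F -(ler_pM2l k0) divff ?gt_eqF// -[X in X * _]gtr0_norm// -normrM.
  rewrite mulrBr mulrA divff ?gt_eqF// mul1r distrC.
  have kf : 0 <= k.+1%:R * f x <= k.+1%:R.
    by have /andP[f0 f1] := f01 x; rewrite mulr_ge0//= ler_piMr.
  have := count_approx kf.
  rewrite (_ : \sum_(j < k.+1) _ = \sum_(i < k.+1) s k i x)//.
  by apply: eq_bigr => i _; rewrite /s indicE; congr ((nat_of_bool _)%:R);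
    apply/idP/idP; rewrite inE.
apply: (Hl F f 2 _ bf).
- by move=> n; apply: bmfZ; exact: (Hs (s n) n.+1 (hs n)).1.
- move=> n x; have -> : F n x = (F n x - f x) + f x by rewrite subrK.
  rewrite (le_trans (ler_normD _ _))//; have := FE n x.
  have /andP[f0 f1] := f01 x; rewrite (ger0_norm f0).
  have i1 : n.+1%:R^-1 <= 1 :> K by rewrite invf_le1 ?ler1n ?ltr0n.
  by move=> /le_trans /(_ i1); lra.
- move=> x; apply/cvgrPdist_le => e e0.
  have := @near_infty_natSinv_lt K (PosNum e0); apply: filterS => n /= ne.
  by rewrite distrC (le_trans (FE n x))// ltW.
- move=> n; have [? ?] := Hs (s n) n.+1 (hs n); exact: HZ.
Qed.

End bounded_measurable.

Lemma bmf_comp (K : realType) d d' (T : measurableType d) (T' : measurableType d')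
  (f : T' -> K) (g : T -> T') : bmf f -> measurable_fun setT g -> bmf (fun x => f (g x)).
Proof.
move=> [mf [M Mf]] mg; split; first exact: measurableT_comp mf mg.
by exists M => x; exact: Mf.
Qed.

Section borel_matrices.
Context {K : realType}.

Lemma continuous_measurable_mx m n (f : 'M[K]_(m, n) -> K) :
  continuous f -> measurable_fun setT f.
Proof.
move=> /continuousP cf; apply: (measurability _ (RGenOpens.measurableE K)).
move=> _ [_ [a [b ->] <-]]; rewrite setTI; apply: sub_gen_smallest.
by apply: cf; exact: interval_open.
Qed.

Lemma measurable_coord m n i j : measurable_fun setT (fun M : 'M[K]_(m, n) => M i j).
Proof. by apply: continuous_measurable_mx; exact: coord_continuous. Qed.

Lemma bigcap_ord T n (F : 'I_n -> set T) z :
  (\big[setI/setT]_(j < n) F j) z <-> forall j, F j z.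
Proof.
elim: n F => [|n IH] F; first by rewrite big_ord0; split=> // _ [].
rewrite big_ord_recl /=; split=> [[F0 /IH h] j|h].
  by have [k ->|->] := unliftP ord0 j; first exact: h.
by split; [exact: h|apply/IH => j; exact: h].
Qed.

(* An open set is the union of the half-open boxes with rational centres that
   it contains. *)
Lemma borel_mx_ind n (H : set 'cV[K]_n -> Prop) :
  H set0 -> (forall D, H D -> H (~` D)) ->
  (forall F : (set 'cV[K]_n)^nat, (forall i, H (F i)) -> H (\bigcup_i F i)) ->
  (forall (j : 'I_n) a, H [set z : 'cV[K]_n | a < z j 0]) ->
  forall D, measurable D -> H D.
Proof.
move=> H0 HC HU Hh.
have HI D1 D2 : H D1 -> H D2 -> H (D1 `&` D2).
  move=> h1 h2; rewrite -[D1 `&` D2]setCK setCI; apply: (HC _).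
  by rewrite -bigcup2E; apply: (HU _) => -[|[|i]] /=; [exact: HC|exact: HC|exact: H0].
pose box (c : 'cV[rat]_n * nat) : set 'cV[K]_n := \big[setI/setT]_(j < n)
  ([set z : 'cV[K]_n | ratr (c.1 j 0) - c.2.+1%:R^-1 < z j 0] `&`
   ~` [set z : 'cV[K]_n | ratr (c.1 j 0) + c.2.+1%:R^-1 < z j 0]).
have Hbox c : H (box c).
  rewrite /box; apply: (big_ind H) => [|D1 D2|j _].
  - by rewrite -setC0; exact: HC H0.
  - exact: HI.
  - by apply: HI; last apply: (HC _); exact: Hh.
have boxP c z : box c z <-> forall j : 'I_n, ratr (c.1 j 0) - c.2.+1%:R^-1 < z j 0
    <= ratr (c.1 j 0) + c.2.+1%:R^-1.
  rewrite /box bigcap_ord; split=> h j; have := h j.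
    by move=> /= [-> /negP]; rewrite -leNgt => ->.
  by move=> /andP[h1 h2] /=; split=> //; apply/negP; rewrite -leNgt.
apply: smallest_sub; first split=> //.
  by move=> D HD; rewrite setTD; exact: HC HD.
move=> U oU; pose F i := if @unpickle ('cV[rat]_n * nat)%type i is Some c then
  if `[< box c `<=` U >] then box c else set0 else set0.
have -> : U = \bigcup_i F i; last first.
  apply: (HU _) => i; rewrite /F; case: unpickle => [c|//].
  by case: asboolP => _ //; exact: Hbox.
apply/seteqP; split=> [z Uz|z [i _]]; last first.
  by rewrite /F; case: unpickle => [c|//]; case: asboolP => // cU; exact: cU.
have : nbhs z U by exact: open_nbhs_nbhs.
move=> /nbhs_ballP[e /= e0 eU].
have [k _ /(_ k (leqnn k)) /= ke] := @near_infty_natSinv_lt K (PosNum (divr_gt0 e0 (ltr0n K 2))).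
have k0 : 0 < k.+1%:R^-1 :> K by rewrite invr_gt0 ltr0n.
have /choice[c cP] : forall j : 'I_n, exists q : rat,
    z j 0 - k.+1%:R^-1 < ratr q < z j 0 + k.+1%:R^-1.
  move=> j; have := @rat_in_itvoo K (z j 0 - k.+1%:R^-1) (z j 0 + k.+1%:R^-1).
  by case=> [|q]; [by rewrite ltrBlDr -addrA ltrDl addr_gt0|rewrite in_itv /= => ?; exists q].
pose cc : 'cV[rat]_n * nat := (\col_j c j, k).
exists (pickle cc) => //; rewrite /F pickleK /=; case: asboolP => [_|].
  by apply/boxP => j; rewrite mxE /=; move: k0 (cP j); set r := _^-1 => k0 /andP[? ?]; apply/andP; split; lra.
case=> w /boxP wb; apply: eU; split=> // i j; rewrite ord1 /ball /=.
move: (cP i) (wb i) ke; rewrite mxE /=; set r := _.+1%:R^-1 => /andP[? ?] /andP[? ?] ?.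
by rewrite ltr_norml; apply/andP; split; lra.
Qed.

Lemma measurable_to_mx d (T : measurableType d) n (f : T -> 'cV[K]_n) :
  (forall j, measurable_fun setT (fun x => f x j 0)) -> measurable_fun setT f.
Proof.
move=> mf _; apply: borel_mx_ind.
- by rewrite preimage_set0 setI0.
- by move=> D; rewrite !setTI preimage_setC; exact: measurableC.
- move=> F; rewrite setTI preimage_bigcup => mF; apply: bigcup_measurable => i _.
  by have := mF i; rewrite setTI.
- move=> j a; have := mf j measurableT _ (measurable_itv `]a, +oo[).
  congr measurable; congr (_ `&` _); apply/seteqP; split=> x /=;
    by rewrite in_itv /= andbT.
Qed.

Lemma measurable_mxcoord d (T : measurableType d) m n (f : T -> 'M[K]_(m, n)) i j :
  measurable_fun setT f -> measurable_fun setT (fun x => f x i j).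
Proof. by move=> mf; exact: (measurableT_comp (@measurable_coord m n i j) mf). Qed.

Lemma measurable_fun_mulmx d (T : measurableType d) m n (M : 'M[K]_(m, n)) (f : T -> 'cV[K]_n) :
  measurable_fun setT f -> measurable_fun setT (fun x => M *m f x).
Proof.
move=> mf; apply: measurable_to_mx => j.
under eq_fun do rewrite mxE.
by apply: measurable_sum => k; apply: measurable_funM => //; exact: measurable_mxcoord.
Qed.

Lemma measurable_fun_mxD d (T : measurableType d) n (f g : T -> 'cV[K]_n) :
  measurable_fun setT f -> measurable_fun setT g -> measurable_fun setT (fun x => f x + g x).
Proof.
move=> mf mg; apply: measurable_to_mx => j; under eq_fun do rewrite mxE.
by apply: measurable_funD; exact: measurable_mxcoord.
Qed.

Lemma measurable_fun_mxB d (T : measurableType d) n (f g : T -> 'cV[K]_n) :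
  measurable_fun setT f -> measurable_fun setT g -> measurable_fun setT (fun x => f x - g x).
Proof.
move=> mf mg; apply: measurable_to_mx => j; under eq_fun do rewrite !mxE.
by apply: measurable_funB; exact: measurable_mxcoord.
Qed.

Lemma measurable_fun_cdot d (T : measurableType d) n (f g : T -> 'cV[K]_n) :
  measurable_fun setT f -> measurable_fun setT g ->
  measurable_fun setT (fun x => cdot (f x) (g x)).
Proof.
move=> mf mg; under eq_fun do rewrite cdotE.
by apply: measurable_sum => j; apply: measurable_funM; exact: measurable_mxcoord.
Qed.

Lemma measurable_fun_quad d (T : measurableType d) n (M : 'M[K]_n) (f : T -> 'cV[K]_n) :
  measurable_fun setT f -> measurable_fun setT (fun x => quad M (f x)).
Proof.
move=> mf; under eq_fun do rewrite quadE.
by apply: measurable_fun_cdot => //; exact: measurable_fun_mulmx.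
Qed.

End borel_matrices.

(** * Determination of weighted laws by their cosine integrals *)

Section sign_approximation.
Context {K : realType}.

Let p (y : K) := (3 * y - y ^+ 3) / 2.

(** The cubic [p] fixes -1, 0 and 1 and satisfies 1 - p(w) = (1 - w) (1 - w)(2 + w)/2. Iterates
    started at z > 0 stay above z, where the second factor is at most 1 - z/2, so they converge
    geometrically to 1; oddness of [p] covers z < 0. *)
Lemma sgr_iter_approx (y : K) : `|y| <= 1 ->
  (forall k, `|iter k p y| <= 1) /\ (fun k => iter k p y) @ \oo --> Num.sg y.
Proof.
have pos z : 0 < z -> z <= 1 -> forall k, z <= iter k p z <= 1 /\
    1 - iter k p z <= (1 - z / 2) ^+ k.
  move=> z0 z1; elim=> [|k [/andP[IH1 IH2] IH3]] /=; first by rewrite expr0 lexx z1; split=> //; lra.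
  set w := iter k p z in IH1 IH2 IH3 *.
  have -> : p w = 1 - (1 - w) * ((1 - w) * (2 + w) / 2) by rewrite /p; field.
  have h1 : (1 - w) * (2 + w) / 2 <= 1 - z / 2 by nra.
  have h0 : 0 <= (1 - w) * (2 + w) / 2 by rewrite divr_ge0// mulr_ge0//; lra.
  split; first by apply/andP; split; nra.
  rewrite opprB addrCA subrr addr0 exprSr.
  by apply: ler_pM => //; lra.
have podd z k : iter k p (- z) = - iter k p z.
  by elim: k => //= k ->; rewrite /p; field.
have p0 k : iter k p 0 = 0 by elim: k => //= k ->; rewrite /p; field.
have cpos z : 0 < z -> z <= 1 ->
    (forall k, `|iter k p z| <= 1) /\ (fun k => iter k p z) @ \oo --> Num.sg z.
  move=> z0 z1; split=> [k|].
    by have [/andP[h1 h2] _] := pos _ z0 z1 k; rewrite ger0_norm// (le_trans _ h1)// ltW.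
  rewrite gtr0_sg//; have ge : `|1 - z / 2| < 1 by rewrite ltr_norml; lra.
  have := cvg_expr ge => /cvgrPdist_le h; apply/cvgrPdist_le => e e0.
  apply: filterS (h _ e0) => k /=; rewrite sub0r normrN.
  have [/andP[h1 h2] h3] := pos _ z0 z1 k => he.
  by rewrite ger0_norm ?subr_ge0// (le_trans h3)// (le_trans (ler_norm _)).
have [z0|z0|->] := ltgtP y 0.
- move=> y1; have [||h1 h2] := cpos (- y); [lra|by rewrite -normrN in y1; apply: le_trans (ler_norm _) y1|].
  split=> [k|]; first by rewrite -normrN -podd.
  rewrite (_ : (fun k => _) = -%R \o (fun k => iter k p (- y))); last first.
    by apply/funext => k /=; rewrite podd opprK.
  by rewrite -[Num.sg y]opprK -sgrN; exact: cvgN.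
- by move=> y1; apply: cpos => //; apply: le_trans (ler_norm _) y1.
- move=> _; split=> [k|]; first by rewrite p0 normr0.
  rewrite sgr0 (_ : (fun k => _) = cst 0); first exact: cvg_cst.
  by apply/funext => k; rewrite p0.
Qed.

(** For fixed [y] and large k the argument y/(k+1) lies in ]-pi, pi[, where the sine has the sign of
    its argument. Slowing the frequency thus removes the periodicity. *)
Lemma sgr_sin_approx (y : K) :
  (fun k => Num.sg (sin (k.+1%:R^-1 * y))) @ \oo --> Num.sg y.
Proof.
have pos (z : K) : 0 < z -> \forall k \near \oo, 0 < sin (k.+1%:R^-1 * z).
  move=> z0; have e0 : 0 < pi / z by rewrite divr_gt0// pi_gt0.
  have := @near_infty_natSinv_lt K (PosNum e0); apply: filterS => k /= ke.
  apply: sin_gt0_pi; rewrite mulr_gt0 ?invr_gt0 ?ltr0n//=.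
  by rewrite -ltr_pdivlMr.
have [y0|y0|->] := ltgtP y 0.
- apply: cvg_near_cst; have := pos (- y); rewrite oppr_gt0 => /(_ y0).
  by apply: filterS => k; rewrite mulrN sinN oppr_gt0 => h; rewrite !ltr0_sg.
- by apply: cvg_near_cst; apply: filterS (pos y y0) => k h; rewrite !gtr0_sg.
- by apply: cvg_near_cst; apply: nearW => k; rewrite mulr0 sin0.
Qed.

End sign_approximation.

Section cosine_uniqueness.
Context {K : realType} {n : nat}.
Context {d1} {T1 : measurableType d1} (mu1 : {finite_measure set T1 -> \bar K}).
Context {d2} {T2 : measurableType d2} (mu2 : {finite_measure set T2 -> \bar K}).
Variables (Z1 : T1 -> 'cV[K]_n) (w1 : T1 -> K) (Z2 : T2 -> 'cV[K]_n) (w2 : T2 -> K).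
Hypotheses (mZ1 : measurable_fun setT Z1) (mZ2 : measurable_fun setT Z2).
Hypotheses (bw1 : bmf w1) (bw2 : bmf w2).

Let I1 (f : 'cV[K]_n -> K) := \int[mu1]_x (f (Z1 x) * w1 x).
Let I2 (f : 'cV[K]_n -> K) := \int[mu2]_x (f (Z2 x) * w2 x).

Let b1 f : bmf f -> bmf (fun x => f (Z1 x) * w1 x).
Proof. by move=> bf; apply: bmfM => //; exact: bmf_comp. Qed.
Let b2 f : bmf f -> bmf (fun x => f (Z2 x) * w2 x).
Proof. by move=> bf; apply: bmfM => //; exact: bmf_comp. Qed.

Let cosl u b : bmf (fun z : 'cV[K]_n => cos (cdot u z + b)).
Proof.
apply: bmf_cos; apply: measurable_funD; last exact: measurable_cst.
by apply: measurable_fun_cdot => //; exact: measurable_cst.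
Qed.

Let agree f := bmf f /\ I1 f = I2 f.

Let agreeD f g : agree f -> agree g -> agree (fun z => f z + g z).
Proof.
move=> [bf ef] [bg eg]; split; first exact: bmfD.
rewrite /I1 /I2; under eq_Rintegral do rewrite mulrDl.
rewrite int_bmfD; [|exact: b1|exact: b1].
under [RHS]eq_Rintegral do rewrite mulrDl.
rewrite int_bmfD; [|exact: b2|exact: b2].
by congr (_ + _).
Qed.

Let agreeZ c f : agree f -> agree (fun z => c * f z).
Proof.
move=> [bf ef]; split; first exact: bmfZ.
rewrite /I1 /I2; under eq_Rintegral do rewrite -mulrA.
rewrite int_bmfZ; last exact: b1.
under [RHS]eq_Rintegral do rewrite -mulrA.
rewrite int_bmfZ; last exact: b2.
by congr (_ * _).
Qed.

Let agree_lim (f_ : nat -> 'cV[K]_n -> K) f M :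
  (forall k, agree (f_ k)) -> bmf f -> (forall k x, `|f_ k x| <= M) ->
  (forall x, (fun k => f_ k x) @ \oo --> f x) -> agree f.
Proof.
move=> af bf bM cf; split=> //.
have [[mw1 [N1 bN1]] [mw2 [N2 bN2]]] := (bw1, bw2).
have M0 : 0 <= M by apply: le_trans (bM 0 0).
have c1 : (fun k => I1 (f_ k)) @ \oo --> I1 f.
  apply: (@Rint_cvg _ _ _ _ _ _ (M * N1)).
  - by move=> k; have [+ _] := b1 (af k).1.
  - by have [+ _] := b1 bf.
  - by apply: aeW => x; apply: cvgM; [exact: cf|exact: cvg_cst].
  - by move=> k x; rewrite normrM ler_pM.
have c2 : (fun k => I2 (f_ k)) @ \oo --> I2 f.
  apply: (@Rint_cvg _ _ _ _ _ _ (M * N2)).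
  - by move=> k; have [+ _] := b2 (af k).1.
  - by have [+ _] := b2 bf.
  - by apply: aeW => x; apply: cvgM; [exact: cf|exact: cvg_cst].
  - by move=> k x; rewrite normrM ler_pM.
have e12 : (fun k => I1 (f_ k)) = (fun k => I2 (f_ k)) by apply/funext => k; exact: (af k).2.
by rewrite e12 in c1; exact: (cvg_unique _ c1 c2).
Qed.

(* Unlike [agree], the class [multiplier] is stable under products. *)
Let good f := bmf f /\ forall u b, agree (fun z => f z * cos (cdot u z + b)).
Let multiplier h := bmf h /\ forall f, good f -> good (fun z => f z * h z).

Let goodD f g : good f -> good g -> good (fun z => f z + g z).
Proof.
move=> [bf gf] [bg gg]; split=> [|u b]; first exact: bmfD.
have := agreeD (gf u b) (gg u b); congr agree; apply/funext => z.
by rewrite mulrDl.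
Qed.

Let goodZ c f : good f -> good (fun z => c * f z).
Proof.
move=> [bf gf]; split=> [|u b]; first exact: bmfZ.
have := agreeZ c (gf u b); congr agree; apply/funext => z.
by rewrite mulrA.
Qed.

Let good_lim (f_ : nat -> 'cV[K]_n -> K) f M :
  (forall k, good (f_ k)) -> bmf f -> (forall k x, `|f_ k x| <= M) ->
  (forall x, (fun k => f_ k x) @ \oo --> f x) -> good f.
Proof.
move=> gf bf bM cf; split=> // u b.
apply: (@agree_lim (fun k z => f_ k z * cos (cdot u z + b)) _ M).
- by move=> k; exact: (gf k).2.
- by apply: bmfM.
- move=> k x; rewrite normrM -[M]mulr1 ler_pM//.
  by rewrite ler_norml cos_geN1 cos_le1.
- by move=> x; apply: cvgM; [exact: cf|exact: cvg_cst].
Qed.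

Let multD f g : multiplier f -> multiplier g -> multiplier (fun z => f z + g z).
Proof.
move=> [bf gf] [bg gg]; split=> [|h gh]; first exact: bmfD.
have := goodD (gf _ gh) (gg _ gh); congr good; apply/funext => z.
by rewrite mulrDr.
Qed.

Let multZ c f : multiplier f -> multiplier (fun z => c * f z).
Proof.
move=> [bf gf]; split=> [|h gh]; first exact: bmfZ.
have := goodZ c (gf _ gh); congr good; apply/funext => z.
by rewrite mulrCA.
Qed.

Let multM f g : multiplier f -> multiplier g -> multiplier (fun z => f z * g z).
Proof.
move=> [bf gf] [bg gg]; split=> [|h gh]; first exact: bmfM.
have := gg _ (gf _ gh); congr good; apply/funext => z.
by rewrite mulrA.
Qed.

Let mult_lim (f_ : nat -> 'cV[K]_n -> K) f M :
  (forall k, multiplier (f_ k)) -> (forall k x, `|f_ k x| <= M) ->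
  (forall x, (fun k => f_ k x) @ \oo --> f x) -> multiplier f.
Proof.
move=> gf bM cf.
have bf : bmf f.
  split.
    by apply: (@measurable_fun_cvg _ _ _ _ f_) => // k; exact: (gf k).1.1.
  by exists M => x; apply: (cvgr_to_le (cvg_norm (cf x))); exact: nearW.
split=> // h gh; have [bh _] := gh; have [mh [N Nh]] := bh.
apply: (@good_lim (fun k z => h z * f_ k z) _ (N * M)).
- by move=> k; exact: (gf k).2.
- exact: bmfM.
- by move=> k x; rewrite normrM ler_pM.
- by move=> x; apply: cvgM; [exact: cvg_cst|exact: cf].
Qed.

Let mult_cst c : multiplier (cst c).
Proof.
split=> [|h gh]; first exact: bmf_cst.
by have := goodZ c gh; congr good; apply/funext => z; rewrite /= mulrC.
Qed.

(** The product of two cosines is half the sum of the cosines with added and subtracted frequencies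
    and phases, and [good] quantifies over all frequencies and phases. *)
Let mult_cos w b : multiplier (fun z => cos (cdot w z + b)).
Proof.
split=> // f [bf gf]; split=> [|u c]; first exact: bmfM.
have := agreeD (agreeZ (2^-1) (gf (u + w) (c + b))) (agreeZ (2^-1) (gf (u - w) (c - b))).
congr agree; apply/funext => z; rewrite cdotDl cdotBl.
rewrite (_ : cdot u z + cdot w z + (c + b) = (cdot u z + c) + (cdot w z + b)); last by ring.
rewrite (_ : cdot u z - cdot w z + (c - b) = (cdot u z + c) - (cdot w z + b)); last by ring.
by rewrite cosB cosD; field.
Qed.

Let mult_sin w b : multiplier (fun z => sin (cdot w z + b)).
Proof.
have := mult_cos w (b - pi / 2); congr multiplier; apply/funext => z.
by rewrite addrA cosB cos_pihalf sin_pihalf mulr0 add0r mulr1.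
Qed.

Let mult_sgr_sin w b : multiplier (fun z => Num.sg (sin (cdot w z + b))).
Proof.
pose p (y : K) := (3 * y - y ^+ 3) / 2.
have s1 z : `|sin (cdot w z + b)| <= 1 by rewrite ler_norml sin_geN1 sin_le1.
apply: (@mult_lim (fun k z => iter k p (sin (cdot w z + b))) _ 1).
- elim=> [|k IH] /=; first exact: mult_sin.
  have := multD (multZ (3 / 2) IH) (multZ (- 1 / 2) (multM IH (multM IH IH))).
  congr multiplier; apply/funext => z /=; rewrite /p; set y := iter _ _ _.
  by rewrite /=; field.
- by move=> k x; have [+ _] := sgr_iter_approx (s1 x); apply.
- by move=> x; have [_ +] := sgr_iter_approx (s1 x).
Qed.

Let mult_halfspace (j : 'I_n) (a : K) : multiplier (\1_[set z : 'cV[K]_n | a < z j 0]).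
Proof.
have ms : multiplier (fun z => Num.sg (z j 0 - a)).
  apply: (@mult_lim (fun k z => Num.sg (sin (k.+1%:R^-1 * (z j 0 - a)))) _ 1).
  - move=> k; have := mult_sgr_sin (k.+1%:R^-1 *: delta_mx j 0) (- k.+1%:R^-1 * a).
    congr multiplier; apply/funext => z; congr (Num.sg (sin _)).
    by rewrite cdotZl cdot_delta mulrBr mulNr.
  - by move=> k x; rewrite normr_sg; case: (_ != 0); rewrite /= ?lexx ?ler01.
  - by move=> x; exact: sgr_sin_approx.
(* With s the sign of [z j 0 - a], the polynomial (s^2 + s)/2 takes the values 0, 0, 1 at s = -1, 0,
   1. *)
have := multD (multZ (2^-1) (multM ms ms)) (multZ (2^-1) ms).
congr multiplier; apply/funext => z; rewrite indicE.
have [h|h|h] := ltgtP (z j 0 - a) 0.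
- rewrite ltr0_sg// memNset; last by move=> /= h2; move: h; rewrite subr_lt0 => /(lt_trans h2); rewrite ltxx.
  by rewrite mulrNN !mulr1 mulrN mulr1 subrr.
- by rewrite gtr0_sg// mem_set /=; [field|rewrite -subr_gt0].
- by rewrite h sgr0 !mulr0 addr0 memNset//= => h2; move: h2; rewrite -subr_gt0 h ltxx.
Qed.

Let mult_borel (D : set 'cV[K]_n) : measurable D -> multiplier (\1_D).
Proof.
have multC (E : set 'cV[K]_n) : multiplier (\1_E) -> multiplier (\1_(~` E)).
  move=> mE; have := multD (mult_cst 1) (multZ (-1) mE); congr multiplier.
  apply/funext => z; rewrite !indicE in_setC /=.
  by case: (z \in E); rewrite /= ?mulr1 ?mulr0 ?subrr ?addr0.
have multI (E F : set 'cV[K]_n) : multiplier (\1_E) -> multiplier (\1_F) ->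
    multiplier (\1_(E `&` F)).
  move=> mE mF; have := multM mE mF; congr multiplier.
  by apply/funext => z; rewrite !indicE in_setI; case: (z \in E); case: (z \in F);
    rewrite /= ?mulr1 ?mulr0.
apply: (borel_mx_ind (H := fun D => multiplier (\1_D))) => //.
  by rewrite indic0; exact: mult_cst.
move=> F mF; pose G k := \bigcup_(i < k) F i.
apply: (@mult_lim (fun k => \1_(G k)) _ 1).
- elim=> [|k IH]; first by rewrite /G bigcup_mkord big_ord0 indic0; exact: mult_cst.
  rewrite /G bigcup_mkord big_ord_recr /= -bigcup_mkord -/(G k).
  by rewrite -[_ `|` _]setCK setCU; apply: (multC _ _); apply: multI; exact: multC.
- by move=> k x; rewrite indicE; case: (_ \in _); rewrite ?normr1 ?normr0.
- move=> x; apply: cvg_near_cst.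
  have [[i _ Fi]|nF] := pselect ((\bigcup_i F i) x).
    exists i.+1 => // k /= ik; rewrite !indicE !mem_set//; last by exists i.
    by exists i.
  apply: nearW => k; rewrite !indicE !memNset// => -[i _ Fi].
  by apply: nF; exists i.
Qed.

(* [p] below the graph: sin is pushed to its sign by iterating an odd cubic,
   so trigonometric polynomials generate indicators of half-spaces. *)
Lemma cos_unique :
  (forall u b, \int[mu1]_x (cos (cdot u (Z1 x) + b) * w1 x) =
               \int[mu2]_x (cos (cdot u (Z2 x) + b) * w2 x)) ->
  forall f, bmf f -> \int[mu1]_x (f (Z1 x) * w1 x) = \int[mu2]_x (f (Z2 x) * w2 x).
Proof.
move=> h f bf; have mf : multiplier f.
  move: f bf; apply: bmf_class => //.
  - by move=> f g _ _; exact: multD.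
  - by move=> c f _; exact: multZ.
  - by move=> f_ f M _ _ bM cf gf; exact: (mult_lim gf bM cf).
have g1 : good (cst 1).
  split=> [|u b]; first exact: bmf_cst.
  split=> [|]; first by apply: bmfZ.
  rewrite /I1 /I2 /=; under eq_Rintegral do rewrite mul1r.
  by under [RHS]eq_Rintegral do rewrite mul1r.
(* The hypothesis says that the constant 1 is [good]; multiplying it by f and taking frequency and
   phase 0 gives the equality for f. *)
have [_ /(_ 0 0) [_]] := mf.2 _ g1.
rewrite /I1 /I2 /=.
under eq_Rintegral do rewrite cdot0l add0r cos0 mulr1 mul1r.
by under [in X in _ = X -> _]eq_Rintegral do rewrite cdot0l add0r cos0 mulr1 mul1r.
Qed.

End cosine_uniqueness.

(** * Derivatives, densities and the cosine transform of the normal law *)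

Section real_derivatives.
Context {K : realType}.
Implicit Types (f g : K -> K) (x a b : K).

(* Unlike the type class [is_derive], a plain predicate is not resolved behind
   the scenes by instances with other shapes of derivatives. *)
Definition isd (f : K -> K) (x a : K) : Prop := is_derive x (1 : K) f a.

Lemma isdD f g x a b : isd f x a -> isd g x b -> isd (fun y => f y + g y) x (a + b).
Proof. by move=> hf hg; exact: is_deriveD. Qed.

Lemma isdB f g x a b : isd f x a -> isd g x b -> isd (fun y => f y - g y) x (a - b).
Proof. by move=> hf hg; exact: is_deriveB. Qed.

Lemma isdM f g x a b : isd f x a -> isd g x b ->
  isd (fun y => f y * g y) x (a * g x + f x * b).
Proof.
move=> hf hg; have := @is_deriveM _ _ f g x 1 a b hf hg.
by move=> h; apply: is_derive_eq; rewrite addrC [a * _]mulrC.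
Qed.

Lemma isd_cst c x : isd (fun=> c : K) x 0.
Proof. exact: is_derive_cst. Qed.

Lemma isd_id x : isd (fun y : K => y) x 1.
Proof. exact: is_derive_id. Qed.

Lemma isd_eq f x a b : isd f x a -> a = b -> isd f x b.
Proof. by move=> h <-. Qed.

Lemma isdZ c f x a : isd f x a -> isd (fun y => c * f y) x (c * a).
Proof.
by move=> hf; apply: (isd_eq (isdM (isd_cst c x) hf)); rewrite mul0r add0r.
Qed.

Lemma isdN f x a : isd f x a -> isd (fun y => - f y) x (- a).
Proof. by move=> hf; exact: is_deriveN. Qed.

Lemma isd_sum n (h : 'I_n -> K -> K) (dh : 'I_n -> K) x :
  (forall i, isd (h i) x (dh i)) ->
  isd (fun y => \sum_(i < n) h i y) x (\sum_(i < n) dh i).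
Proof.
move=> H; have := is_derive_sum H; rewrite /isd; congr is_derive; apply/funext => y.
by rewrite fct_sumE.
Qed.

Lemma isd_comp f g x a b : isd f (g x) a -> isd g x b ->
  isd (fun y => f (g y)) x (a * b).
Proof. by move=> hf hg; have := is_derive1_comp hf hg. Qed.

Lemma isd_cos g x a : isd g x a -> isd (fun y => cos (g y)) x (- sin (g x) * a).
Proof. by move=> h; apply: isd_comp h; exact: is_derive_cos. Qed.

Lemma isd_sin g x a : isd g x a -> isd (fun y => sin (g y)) x (cos (g x) * a).
Proof. by move=> h; apply: isd_comp h; exact: is_derive_sin. Qed.

Lemma isd_exp g x a : isd g x a -> isd (fun y => expR (g y)) x (expR (g x) * a).
Proof. by move=> h; apply: isd_comp h; exact: is_derive_expR. Qed.

Lemma isd_continuous f x a : isd f x a -> {for x, continuous f}.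
Proof. by move=> h; apply: differentiable_continuous; apply/derivable1_diffP; case: h. Qed.

Lemma isd_cst_eq f : (forall x, isd f x 0) -> forall x y, f x = f y.
Proof. by move=> h x y; exact: is_derive_0_is_cst. Qed.

(* Mean value theorem without strictness of the order on the end points. *)
Lemma isd_mvt f (df : K -> K) x y : x <= y ->
  (forall z, x <= z <= y -> isd f z (df z)) ->
  exists2 c, x <= c <= y & f y - f x = df c * (y - x).
Proof.
move=> xy h; have [||c] := @MVT_segment K f df x y xy.
- by move=> z; rewrite in_itv /= => /andP[/ltW z1 /ltW z2]; apply: h; rewrite z1.
- apply: continuous_in_subspaceT => z; rewrite inE/= in_itv /= => hz.
  exact: isd_continuous (h _ hz).
- by rewrite in_itv /= => hc e; exists c.
Qed.

End real_derivatives.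

Section density.
Context {K : realType} {d} {T : measurableType d}.

Lemma integrable_bmfM (mu : {measure set T -> \bar K}) (f p : T -> K) : bmf f ->
  mu.-integrable setT (EFin \o p) -> mu.-integrable setT (EFin \o (fun x => f x * p x)).
Proof.
move=> [mf [M Mf]] ip; have -> : EFin \o (fun x => f x * p x) = ((EFin \o f) \* (EFin \o p))%E.
  by apply/funext => x /=; rewrite EFinM.
apply: integrableMr => //; exists M; split; first exact: num_real.
by move=> N MN x _ /=; rewrite (le_trans (Mf x))// ltW.
Qed.

Lemma density_int (nu : {finite_measure set T -> \bar K}) (mu : {measure set T -> \bar K})
    (p : T -> K) :
  (forall x, 0 <= p x) -> mu.-integrable setT (EFin \o p) ->
  (forall D, measurable D -> nu D = (\int[mu]_(x in D) (p x)%:E)%E) ->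
  forall f, bmf f -> \int[nu]_x f x = \int[mu]_x (f x * p x).
Proof.
move=> p0 ip nuD f; move: f; apply: bmf_class.
- move=> D mD; rewrite /Rintegral.
  rewrite integral_indic// setIT.
  transitivity (fine (\int[mu]_(x in D) (p x)%:E)%E); first by congr fine; exact: nuD.
  rewrite integral_mkcond.
  congr fine; apply: eq_integral => x _; rewrite patchE indicE.
  by case: (x \in D); rewrite ?mul1r ?mul0r.
- move=> f g bf bg ef eg; rewrite int_bmfD// ef eg.
  under [RHS]eq_Rintegral do rewrite mulrDl.
  by rewrite RintegralD//; exact: integrable_bmfM.
- move=> c f bf ef; rewrite int_bmfZ// ef.
  under [RHS]eq_Rintegral do rewrite -mulrA.
  by rewrite RintegralZl//; exact: integrable_bmfM.
- move=> f_ f M bf_ bf bM cf ef.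
  have c1 : (fun n => \int[nu]_x f_ n x) @ \oo --> \int[nu]_x f x.
    apply: (@Rint_cvg _ _ _ _ _ _ M) => //.
    + by move=> n; have [] := bf_ n.
    + by have [] := bf.
    + exact: aeW.
  have mp : measurable_fun setT p by move/measurable_int: ip => /measurable_EFinP.
  have ig : mu.-integrable setT (EFin \o (fun x => M * p x)).
    by apply: integrable_bmfM => //; exact: bmf_cst.
  have [] := @dominated_convergence _ T K mu setT measurableT
    (fun n => EFin \o (fun x => f_ n x * p x)) (EFin \o (fun x => f x * p x)) _ _ _ _ ig _.
  + by move=> n; apply/measurable_EFinP; apply: measurable_funM => //; have [] := bf_ n.
  + by apply/measurable_EFinP; apply: measurable_funM => //; have [] := bf.
  + apply: aeW => x _; apply/fine_cvgP; split; first exact: nearW.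
    by apply: cvgM; [exact: cf|exact: cvg_cst].
  + apply: aeW => x n _ /=; rewrite lee_fin normrM (ger0_norm (p0 x)).
    by rewrite ler_wpM2r.
  move=> intf _ cvf.
  have c2 : (fun n => \int[mu]_x (f_ n x * p x)) @ \oo --> \int[mu]_x (f x * p x).
    by apply: fine_cvg; rewrite fineK//; exact: (@integrable_fin_num _ T K mu setT _ _ intf).
  rewrite (_ : (fun n => \int[nu]_x f_ n x) = (fun n => \int[mu]_x (f_ n x * p x))) in c1.
    exact: (cvg_unique _ c1 c2).
  by apply/funext => n; exact: ef.
Qed.

End density.

Section normal_cosine.
Context {K : realType}.
Notation leb := (@lebesgue_measure K).

(** Integration by parts on the line without boundary terms: the fundamental theorem on [-n, n],
    then dominated convergence on the one side and decay of H at the end points on the other. *)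
Lemma int_derive_eq0 (H h : K -> K) : (forall x : K, isd H x (h x)) ->
  continuous h -> leb.-integrable setT (EFin \o h) ->
  (fun n : nat => H n%:R) @ \oo --> (0 : K) ->
  (fun n : nat => H (- n%:R)) @ \oo --> (0 : K) -> \int[leb]_x h x = 0.
Proof.
move=> dH ch ih H1 H2.
have cH : continuous H by move=> x; exact: isd_continuous (dH x).
pose f_ (n : nat) x := \1_(`[- n%:R, n%:R]%classic : set K) x * h x.
have mh : measurable_fun setT h by exact: continuous_measurable_fun.
have [] := @dominated_convergence _ _ K leb setT measurableT
    (fun n => EFin \o f_ n) (EFin \o h) (EFin \o (fun x => `|h x|)) _ _ _ _ _.
- move=> n; apply/measurable_EFinP; apply: measurable_funM => //.
- exact/measurable_EFinP.
- apply: aeW => x _; apply/fine_cvgP; split; first exact: nearW.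
  apply: cvg_near_cst; near=> n; rewrite /f_ /= indicE mem_set ?mul1r//.
  rewrite /= in_itv /= -ler_norml; near: n.
  by apply: filterS (nbhs_infty_ger `|x|) => n.
- by have := integrable_abse ih; apply: eq_integrable.
- apply: aeW => x n _ /=; rewrite lee_fin normrM ler_piMl// indicE.
  by case: (_ \in _); rewrite ?normr1 ?normr0.
move=> intf _ cvf.
have c2 : (fun n => \int[leb]_x f_ n x) @ \oo --> \int[leb]_x h x.
  by apply: fine_cvg; rewrite fineK//; exact: (@integrable_fin_num _ _ K leb setT _ _ ih).
have c1 : (fun n => \int[leb]_x f_ n x) @ \oo --> (0 : K).
  apply: (@cvg_trans _ ((fun n : nat => H n%:R - H (- n%:R)) @ \oo)); last first.
    by rewrite -(subr0 (0 : K)); apply: cvgB; [exact: H1|exact: H2].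
  apply: near_eq_cvg; near=> n; have n0 : 0 < n%:R :> K.
    by rewrite ltr0n; near: n; exact: nbhs_infty_gt.
  rewrite /Rintegral; have <- : (\int[leb]_(x in `[(- n%:R)%R, n%:R%R]%classic) (h x)%:E)%E =
      (\int[leb]_x (f_ n x)%:E)%E.
    rewrite integral_mkcond; apply: eq_integral => x _; rewrite patchE /f_ indicE.
    by case: (x \in _); rewrite ?mul1r ?mul0r.
  rewrite (@continuous_FTC2 _ _ H) //=.
  + by rewrite (lt_trans _ n0)// oppr_lt0.
  + exact: continuous_subspaceT.
  + split; [by move=> x _; have [] := dH x| |].
      by apply: cvg_at_right_filter; exact: cH.
    by apply: cvg_at_left_filter; exact: cH.
  + by move=> x _; rewrite derive1E; case: (dH x).
exact: (cvg_unique _ c2 c1).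
Unshelve. all: by end_near. Qed.

Variables (m s : K).
Hypothesis s0 : s != 0.

Let p := normal_pdf m s.

Let pE x : p x = normal_peak s * expR (- (x - m) ^+ 2 / (s ^+ 2 *+ 2)).
Proof. by rewrite /p normal_pdfE. Qed.

Let s2 : 0 < s ^+ 2. Proof. by rewrite lt0r sqrf_eq0 s0 sqr_ge0. Qed.

Let dp (x : K) : isd p x (p x * (- (x - m) / s ^+ 2)).
Proof.
have -> : p = (fun x => normal_peak s * expR (- (2 * s ^+ 2)^-1 * ((x - m) * (x - m)))).
  apply/funext => y; rewrite pE; congr (_ * expR _).
  by rewrite -mulr_natl expr2; field; rewrite ?s0//.
apply: isd_eq.
  apply: isdZ; apply: isd_exp; apply: isdZ; apply: isdM.
    by apply: isdB; [exact: isd_id|exact: isd_cst].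
  by apply: isdB; [exact: isd_id|exact: isd_cst].
by cbv beta; field; rewrite ?s0//.
Qed.

Let p0 x : 0 <= p x. Proof. exact: normal_pdf_ge0. Qed.

Let cp : continuous p.
Proof. by move=> x; exact: isd_continuous (dp x). Qed.

(** A normal density with doubled variance. A multiple of it dominates |x - m| [p x]; this is the
    integrable majorant, uniform in the frequency, that allows differentiation under the
    integral. *)
Let q := normal_pdf m (Num.sqrt 2 * s).

Let sq0 : Num.sqrt 2 * s != 0 :> K.
Proof. by rewrite mulf_neq0// gt_eqF// sqrtr_gt0. Qed.

Let qE x : q x = normal_peak (Num.sqrt 2 * s) * expR (- ((x - m) ^+ 2 / (4 * s ^+ 2))).
Proof.
rewrite /q normal_pdfE//.
congr (_ * expR _); rewrite exprMn sqr_sqrtr// -mulr_natl mulNr.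
by congr (- (_ / _)); ring.
Qed.

Let c1 := normal_peak s * (2 * `|s|) / normal_peak (Num.sqrt 2 * s).

Let domq x : `|x - m| * p x <= c1 * q x.
Proof.
have k0 : 0 < normal_peak (Num.sqrt 2 * s).
  by rewrite normal_peak_gt0.
rewrite /c1 qE pE mulrA divfK ?gt_eqF//.
rewrite mulrCA -[leRHS]mulrA ler_wpM2l ?normal_peak_ge0//.
set y := (x - m) ^+ 2 / (4 * s ^+ 2).
have y0 : 0 <= y by rewrite divr_ge0 ?sqr_ge0// mulr_ge0// ltW.
have -> : - (x - m) ^+ 2 / (s ^+ 2 *+ 2) = - y + - y.
  by rewrite /y -mulr_natl; field; rewrite ?s0//.
rewrite expRD mulrA ler_wpM2r ?expR_ge0//.
rewrite expRN ler_pdivrMr ?expR_gt0//.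
(* Half of the Gaussian exponent absorbs the linear factor: |x - m| <= 2|s|(1 + y) by a completed
   square, and 1 + y <= e^y. *)
apply: (@le_trans _ _ (2 * `|s| * (1 + y))); last first.
  by rewrite ler_wpM2l ?expR_ge1Dx// mulr_ge0.
have sp : 0 < `|s| by rewrite normr_gt0.
have -> : y = `|x - m| ^+ 2 / (4 * `|s| ^+ 2).
  by rewrite !real_normK ?num_real.
set v := `|x - m|; have v0 : 0 <= v by rewrite normr_ge0.
rewrite (_ : 2 * _ * _ = v + ((v / 2 - `|s|) ^+ 2 + `|s| ^+ 2 + v ^+ 2 / 4) / `|s|); last first.
  by field; rewrite gt_eqF.
by rewrite lerDl divr_ge0 ?(ltW sp)// !addr_ge0 ?sqr_ge0// divr_ge0 ?sqr_ge0.
Qed.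

Let intp : leb.-integrable setT (EFin \o p).
Proof. exact: integrable_normal_pdf. Qed.

Let intq c : leb.-integrable setT (EFin \o (fun x => c * q x)).
Proof.
apply: integrable_bmfM; first exact: bmf_cst.
exact: integrable_normal_pdf.
Qed.

Let mlin u b : measurable_fun setT (fun x : K => u * (x - m) + b).
Proof.
apply: continuous_measurable_fun => x; apply: isd_continuous; apply: isdD; last exact: isd_cst.
by apply: isdZ; apply: isdB; [exact: isd_id|exact: isd_cst].
Qed.

Let mcos u b : continuous (fun x : K => cos (u * (x - m) + b)).
Proof.
move=> x; apply: isd_continuous; apply: isd_cos; apply: isdD; last exact: isd_cst.
by apply: isdZ; apply: isdB; [exact: isd_id|exact: isd_cst].
Qed.

Let msin u b : continuous (fun x : K => sin (u * (x - m) + b)).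
Proof.
move=> x; apply: isd_continuous; apply: isd_sin; apply: isdD; last exact: isd_cst.
by apply: isdZ; apply: isdB; [exact: isd_id|exact: isd_cst].
Qed.

Let F b u := \int[leb]_x (cos (u * (x - m) + b) * p x).

Let dF b (u : K) : isd (F b) u
  (\int[leb]_x (- sin (u * (x - m) + b) * (x - m) * p x)).
Proof.
have df1 x (v : K) : isd (fun v => cos (v * (x - m) + b) * p x) v
    (- sin (v * (x - m) + b) * (x - m) * p x).
  apply: isd_eq.
    apply: isdM; last exact: isd_cst.
    apply: isd_cos; apply: isdD; last exact: isd_cst.
    by apply: isdM; [exact: isd_id|exact: isd_cst].
  by cbv beta; ring.
pose f v x := cos (v * (x - m) + b) * p x.
have I : (`]u - 1, u + 1[%classic : set K) u by rewrite /= in_itv /=; apply/andP; split; lra.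
have ub v x : `| partial1of2 f v x| <= c1 * q x.
  have [dvf] := df1 x v; rewrite /partial1of2 derive1E => ->.
  rewrite normrM normrM normrN (ger0_norm (p0 x)) -mulrA.
  apply: le_trans (domq x); rewrite ler_piMl ?mulr_ge0//.
  by rewrite ler_norml sin_geN1 sin_le1.
have intf v : leb.-integrable setT (EFin \o f v).
  by apply: integrable_bmfM => //; apply: bmf_cos; exact: mlin.
have df x (v : K) : derivable (f ^~ x) v 1 by have [] := df1 x v.
have G0 x : 0 <= c1 * q x.
  by apply: le_trans (domq x); rewrite mulr_ge0.
have h1 := @derivable_under_integral K _ _ leb f setT measurableT u (u - 1) (u + 1) I
  (fun v _ => intf v) (fun v x _ _ => df x v) (fun x => c1 * q x) G0 (intq c1)
  (fun v x _ _ => ub v x).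
have h2 := @differentiation_under_integral K _ _ leb f setT measurableT u (u - 1) (u + 1) I
  (fun v _ => intf v) (fun v x _ _ => df x v) (fun x => c1 * q x) G0 (intq c1)
  (fun v x _ _ => ub v x).
split; first exact: h1.
rewrite -derive1E h2; apply: eq_Rintegral => x _.
by have [dvf] := df1 x u; rewrite /partial1of2 derive1E => ->.
Qed.

Let C := c1 * normal_peak (Num.sqrt 2 * s).

Let p_bound x : `|x - m| * p x <= C.
Proof.
apply: le_trans (domq x) _; rewrite /C ler_wpM2l//.
  by rewrite /c1 divr_ge0 ?normal_peak_ge0// mulr_ge0 ?normal_peak_ge0// mulr_ge0.
exact: normal_pdf_ub.
Qed.

Let C0 : 0 <= C.
Proof. by apply: le_trans (p_bound 0); rewrite mulr_ge0. Qed.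

Let p_cvg (r : nat -> K) : (forall n, `|r n| = n%:R) ->
  (fun n => p (r n)) @ \oo --> (0 : K).
Proof.
move=> hr; apply/cvgrPdist_le => e e0.
apply: filterS (nbhs_infty_ger (`|m| + C / e + 1)) => n hn.
rewrite sub0r normrN ger0_norm//.
have h1 : C / e + 1 <= `|r n - m|.
  by have := lerB_dist (r n) m; rewrite hr; lra.
have h2 : 0 < C / e + 1 by rewrite ltr_wpDl// divr_ge0// ltW.
have := p_bound (r n) => h3.
have h4 : (C / e + 1) * p (r n) <= C by rewrite (le_trans _ h3)// ler_wpM2r.
rewrite -(ler_pM2l h2) (le_trans h4)// mulrDl divfK ?gt_eqF// mul1r.
by rewrite lerDl ltW.
Qed.

Let ibp b u : \int[leb]_x (- sin (u * (x - m) + b) * (x - m) * p x) = - (s ^+ 2 * u) * F b u.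
Proof.
have i1 : leb.-integrable setT (EFin \o (fun x => - sin (u * (x - m) + b) * (x - m) * p x)).
  apply: (le_integrable measurableT _ _ (intq c1)).
    apply/measurable_EFinP; apply: measurable_funM; last exact: continuous_measurable_fun.
    apply: measurable_funM; last exact: measurable_funB.
    by apply: continuous_measurable_fun => x; apply: continuousN; exact: msin.
  move=> x _ /=; rewrite lee_fin normrM normrM normrN (ger0_norm (p0 x)) -mulrA.
  rewrite (le_trans _ (ler_norm _))// (le_trans _ (domq x))// ler_piMl ?mulr_ge0//.
  by rewrite ler_norml sin_geN1 sin_le1.
have i2 : leb.-integrable setT (EFin \o (fun x => cos (u * (x - m) + b) * p x)).
  by apply: integrable_bmfM => //; apply: bmf_cos; exact: mlin.
pose H x := sin (u * (x - m) + b) * p x.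
pose h x := (s ^+ 2)^-1 * (- sin (u * (x - m) + b) * (x - m) * p x) +
  u * (cos (u * (x - m) + b) * p x).
have dH (x : K) : isd H x (h x).
  apply: isd_eq.
    apply: isdM; last exact: dp.
    apply: isd_sin; apply: isdD; last exact: isd_cst.
    by apply: isdZ; apply: isdB; [exact: isd_id|exact: isd_cst].
  by rewrite /h; cbv beta; field; rewrite ?s0//.
have ih : leb.-integrable setT (EFin \o h).
  have -> : EFin \o h = (fun x =>
      ((s ^+ 2)^-1%R%:E * (EFin \o (fun x => - sin (u * (x - m) + b) * (x - m) * p x)%R) x) +
      (u%:E * (EFin \o (fun x => cos (u * (x - m) + b) * p x)%R) x))%E.
    by apply/funext => x /=; rewrite /h EFinD !EFinM.
  by apply: integrableD => //; exact: integrableZl.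
have ch : continuous h.
  move=> x; rewrite /h; apply: cvgD; apply: cvgM; try exact: cvg_cst.
    apply: cvgM; last exact: cp.
    apply: cvgM; first by apply: cvgN; exact: msin.
    by apply: cvgB; [exact: cvg_id|exact: cvg_cst].
  by apply: cvgM; [exact: mcos|exact: cp].
have cH (r : nat -> K) : (forall n, `|r n| = n%:R) -> (fun n => H (r n)) @ \oo --> (0 : K).
  move=> hr; have := p_cvg hr => /cvgrPdist_le hp.
  apply/cvgrPdist_le => e e0; apply: filterS (hp _ e0) => n.
  rewrite !sub0r !normrN; apply: le_trans; rewrite /H normrM ler_piMl//.
  by rewrite ler_norml sin_geN1 sin_le1.
have := int_derive_eq0 dH ch ih (cH (fun n => n%:R) (fun n => normr_nat _ n))
  (cH (fun n => - n%:R) (fun n => etrans (normrN _) (normr_nat _ n))).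
rewrite /h RintegralD//; last 2 first.
- by have := integrableZl measurableT (s ^+ 2)^-1 i1.
- by have := integrableZl measurableT u i2.
rewrite RintegralZl// RintegralZl// -/(F b u) => /eqP.
rewrite addr_eq0 => /eqP h0.
by rewrite mulNr -mulrA -mulrN -h0 mulVKf// sqrf_eq0.
Qed.

(** As a function of the frequency the integral F satisfies F' = -s^2 u F, by differentiation under
    the integral ([dF]) and integration by parts ([ibp]). Hence F times exp(s^2 u^2 / 2) is
    constant, equal to its value cos b at u = 0. *)
Lemma normal_pdf_cos b u :
  \int[leb]_x (cos (u * (x - m) + b) * p x) = expR (- (s ^+ 2 * u ^+ 2) / 2) * cos b.
Proof.
rewrite -/(F b u).
have e2 v : expR (- (- (s ^+ 2 * v ^+ 2) / 2)) != 0 :> K by rewrite gt_eqF// expR_gt0.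
pose g v := F b v * expR ((s ^+ 2 / 2) * (v * v)).
have gE v : F b v = g v * expR (- (s ^+ 2 * v ^+ 2) / 2).
  rewrite /g -mulrA -expRD (_ : _ + _ = 0) ?expR0 ?mulr1//.
  by field.
have dg v : isd g v 0.
  apply: isd_eq.
    apply: isdM; first exact: dF.
    apply: isd_exp; apply: isdZ; apply: isdM; exact: isd_id.
  by cbv beta; rewrite ibp; field.
rewrite gE (isd_cst_eq dg u 0) mulrC; congr (_ * _).
rewrite /g mulr0 mulr0 expR0 mulr1 /F.
under eq_Rintegral do rewrite mul0r add0r.
rewrite RintegralZl// /Rintegral.
by rewrite /p integral_normal_pdf mulr1.
Qed.

End normal_cosine.

(** * Image laws, Fubini for bounded functions, Gaussian cosine formulas *)

Section laws.
Context {K : realType}.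
Context {d1} {T1 : measurableType d1} (mu1 : {finite_measure set T1 -> \bar K}).
Context {d2} {T2 : measurableType d2} (mu2 : {finite_measure set T2 -> \bar K}).

Lemma weighted_law_int (Y : T1 -> T2) (w : T1 -> K) (v : T2 -> K) :
  measurable_fun setT Y -> bmf w -> bmf v ->
  (forall D, measurable D ->
    \int[mu1]_x (\1_D (Y x) * w x) = \int[mu2]_x (\1_D x * v x)) ->
  forall f, bmf f -> \int[mu1]_x (f (Y x) * w x) = \int[mu2]_x (f x * v x).
Proof.
move=> mY bw bv h.
have b1 f : bmf f -> bmf (fun x => f (Y x) * w x).
  by move=> bf; apply: bmfM => //; exact: bmf_comp.
have b2 f : bmf f -> bmf (fun x => f x * v x) by move=> bf; exact: bmfM.
apply: bmf_class => //.
- move=> f g bf bg ef eg; under eq_Rintegral do rewrite mulrDl.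
  rewrite int_bmfD ?ef ?eg; [|exact: b1|exact: b1].
  under [RHS]eq_Rintegral do rewrite mulrDl.
  by rewrite int_bmfD; [|exact: b2|exact: b2].
- move=> c f bf ef; under eq_Rintegral do rewrite -mulrA.
  rewrite int_bmfZ ?ef; last exact: b1.
  under [RHS]eq_Rintegral do rewrite -mulrA.
  by rewrite int_bmfZ//; exact: b2.
- move=> f_ f M bf_ bf bM cf ef.
  have [mw [N1 bN1]] := bw; have [mv [N2 bN2]] := bv.
  have c1 : (fun n => \int[mu1]_x (f_ n (Y x) * w x)) @ \oo --> \int[mu1]_x (f (Y x) * w x).
    apply: (@Rint_cvg _ _ _ _ _ _ (M * N1)).
    + by move=> n; have [+ _] := b1 _ (bf_ n).
    + by have [+ _] := b1 _ bf.
    + by apply: aeW => x; apply: cvgM; [exact: cf|exact: cvg_cst].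
    + by move=> n x; rewrite normrM ler_pM.
  have c2 : (fun n => \int[mu2]_x (f_ n x * v x)) @ \oo --> \int[mu2]_x (f x * v x).
    apply: (@Rint_cvg _ _ _ _ _ _ (M * N2)).
    + by move=> n; have [+ _] := b2 _ (bf_ n).
    + by have [+ _] := b2 _ bf.
    + by apply: aeW => x; apply: cvgM; [exact: cf|exact: cvg_cst].
    + by move=> n x; rewrite normrM ler_pM.
  rewrite (_ : (fun n => \int[mu1]_x (f_ n (Y x) * w x)) =
      (fun n => \int[mu2]_x (f_ n x * v x))) in c1.
    exact: (cvg_unique _ c1 c2).
  by apply/funext => n; exact: ef.
Qed.

Lemma int_indic (D : set T1) : measurable D -> \int[mu1]_x \1_D x = fine (mu1 D).
Proof. by move=> mD; rewrite /Rintegral integral_indic// setIT. Qed.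

Lemma law_int (Y : T1 -> T2) : measurable_fun setT Y ->
  (forall D, measurable D -> mu1 (Y @^-1` D) = mu2 D) ->
  forall f, bmf f -> \int[mu1]_x f (Y x) = \int[mu2]_x f x.
Proof.
move=> mY h f bf.
transitivity (\int[mu1]_x (f (Y x) * cst 1 x)).
  by apply: eq_Rintegral => x _; rewrite mulr1.
transitivity (\int[mu2]_x (f x * cst 1 x)); last first.
  by apply: eq_Rintegral => x _; rewrite mulr1.
apply: weighted_law_int => //; [exact: bmf_cst|exact: bmf_cst|move=> D mD].
transitivity (\int[mu1]_x \1_(Y @^-1` D) x).
  by apply: eq_Rintegral => x _; rewrite mulr1 !indicE; congr (nat_of_bool _)%:R;
    apply/idP/idP; rewrite !inE.
transitivity (\int[mu2]_x \1_D x); last first.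
  by apply: eq_Rintegral => x _; rewrite mulr1.
rewrite /Rintegral !integral_indic// ?setIT; last first.
  by have := mY measurableT D mD; rewrite setTI.
by congr fine; exact: h.
Qed.

End laws.

Section fubini.
Context {K : realType}.
Context {d1} {T1 : measurableType d1} (mu1 : {finite_measure set T1 -> \bar K}).
Context {d2} {T2 : measurableType d2} (mu2 : {finite_measure set T2 -> \bar K}).
Variable f : T1 * T2 -> K.
Hypothesis bf : bmf f.

Let intf : (mu1 \x mu2)%E.-integrable setT (EFin \o f).
Proof.
have [mf [M Mf]] := bf.
apply: measurable_bounded_integrable => //.
  have e : (mu1 \x mu2)%E setT = (mu1 setT * mu2 setT)%E.
    by rewrite -product_measure1E// setXTT.
  apply: (@le_lt_trans _ _ (mu1 setT * mu2 setT)%E); first by rewrite -e.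
  by rewrite lte_mul_pinfty// ?fin_num_measure// -ge0_fin_numE// fin_num_measure.
exists M; split; first exact: num_real.
by move=> N MN x _ /=; rewrite (le_trans (Mf x))// ltW.
Qed.

Lemma bmf_section1 x : bmf (fun y => f (x, y)).
Proof.
have [mf [M Mf]] := bf; split; last by exists M.
exact: (measurableT_comp mf (pair1_measurable x)).
Qed.

Lemma bmf_section2 y : bmf (fun x => f (x, y)).
Proof.
have [mf [M Mf]] := bf; split; last by exists M.
exact: (measurableT_comp mf (pair2_measurable y)).
Qed.

Lemma Rint_section1 x :
  (\int[mu2]_y f (x, y))%:E = (\int[mu2]_y (f (x, y))%:E)%E.
Proof.
rewrite /Rintegral fineK//; apply: (@integrable_fin_num _ T2 K mu2 setT) => //.
exact: bmf_int (bmf_section1 x).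
Qed.

Lemma Rint_section2 y :
  (\int[mu1]_x f (x, y))%:E = (\int[mu1]_x (f (x, y))%:E)%E.
Proof.
rewrite /Rintegral fineK//; apply: (@integrable_fin_num _ T1 K mu1 setT) => //.
exact: bmf_int (bmf_section2 y).
Qed.

Lemma bmf_fubini : \int[mu1]_x \int[mu2]_y f (x, y) = \int[mu2]_y \int[mu1]_x f (x, y).
Proof.
rewrite /Rintegral; congr fine.
under eq_integral do rewrite Rint_section1.
under [RHS]eq_integral do rewrite Rint_section2.
exact: (Fubini intf).
Qed.

Lemma bmf_fubini1 : \int[mu1]_x \int[mu2]_y f (x, y) = fine (\int[mu1 \x mu2]_z (f z)%:E).
Proof.
rewrite /Rintegral; congr fine.
under eq_integral do rewrite Rint_section1.
exact: (integral12_prod_meas1 intf).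
Qed.

Lemma bmf_int_section : bmf (fun x => \int[mu2]_y f (x, y)).
Proof.
have [mf [M Mf]] := bf; split.
  have := measurable_fubini_F intf; rewrite /fubini_F => mF.
  apply/measurable_EFinP; apply: eq_measurable_fun mF => x _ /=.
  by rewrite Rint_section1.
exists (M * fine (mu2 setT)) => x.
have bx := bmf_section1 x.
apply: le_trans (le_normr_Rintegral measurableT (bmf_int mu2 bx)) _.
rewrite -(Rintegral_cst mu2 measurableT) le_Rintegral//.
- by apply: integrable_norm; exact: bmf_int.
- by apply: bmf_int; exact: bmf_cst.
Qed.

End fubini.

Section normal_laws.
Context {K : realType}.

Lemma bmf_cos_affine (u b : K) : bmf (fun x : measurableTypeR K => cos (u * x + b)).
Proof.
apply: bmf_cos; apply: continuous_measurable_fun => x; apply: (@isd_continuous _ _ _ u).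
apply: isd_eq; first by apply: isdD; [apply: isdZ; exact: isd_id|exact: isd_cst].
by rewrite mulr1 addr0.
Qed.

Lemma normal_prob_int (m s : K) (f : measurableTypeR K -> K) : bmf f ->
  \int[normal_prob m s]_x f x = \int[lebesgue_measure]_x (f x * normal_pdf m s x).
Proof.
apply: density_int => //; first by move=> x; exact: normal_pdf_ge0.
exact: integrable_normal_pdf.
Qed.

Lemma normal_prob_cos (m s u b : K) : s != 0 ->
  \int[normal_prob m s]_x cos (u * x + b) = expR (- (s ^+ 2 * u ^+ 2) / 2) * cos (u * m + b).
Proof.
move=> s0; rewrite normal_prob_int; last exact: bmf_cos_affine.
rewrite -(normal_pdf_cos m s0); apply: eq_Rintegral => x _.
by congr (cos _ * _); ring.
Qed.

Lemma gaussian1_cos d (T : measurableType d) (P : probability T K) (Y : T -> K) (m v : K) :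
  measurable_fun setT Y -> 0 <= v ->
  (forall D, measurable D -> P (Y @^-1` D) = gaussian1 m v D) ->
  forall u b, \int[P]_x cos (u * Y x + b) = expR (- (v * u ^+ 2) / 2) * cos (u * m + b).
Proof.
move=> mY v0 hY u b; rewrite /gaussian1 in hY.
have [vz|vn] := eqVneq v 0.
  rewrite vz mul0r oppr0 mul0r expR0 mul1r.
  rewrite vz eqxx in hY.
  rewrite (law_int (mu2 := \d_m) mY hY (bmf_cos_affine u b)).
  rewrite /Rintegral integral_dirac//; first by rewrite diracT mul1e.
  by apply/measurable_EFinP; have [] := bmf_cos_affine u b.
rewrite (negbTE vn) in hY.
rewrite (law_int (mu2 := normal_prob m (Num.sqrt v)) mY hY (bmf_cos_affine u b)).
rewrite normal_prob_cos; last by rewrite gt_eqF// sqrtr_gt0 lt0r vn.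
by rewrite sqr_sqrtr.
Qed.

(** The characteristic function of N(m, P) in real form; varying the phase [b] recovers its real and
    imaginary parts. *)
Definition cosdata {n} (nu : probability 'cV[K]_n K) (m : 'cV[K]_n) (P : 'M[K]_n) :=
  forall u b, \int[nu]_z cos (cdot u z + b) = expR (- quad P u / 2) * cos (cdot u m + b).

Lemma measurable_cdotl n (u : 'cV[K]_n) : measurable_fun setT (cdot u).
Proof. by apply: measurable_fun_cdot => //; exact: measurable_cst. Qed.

Lemma gaussian_law_cos d (T : measurableType d) (Pr : probability T K) n (Y : T -> 'cV[K]_n) m P :
  psdmx P -> measurable_fun setT Y -> gaussian_law (pushforward Pr Y) m P ->
  forall u b, \int[Pr]_w cos (cdot u (Y w) + b) = expR (- quad P u / 2) * cos (cdot u m + b).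
Proof.
move=> [_ Pp] mY hY u b.
have := @gaussian1_cos _ T Pr (fun w => cdot u (Y w)) (cdot u m) (quad P u) _ (Pp u) _ 1 b.
rewrite expr1n mulr1 mul1r => <-.
- by apply: eq_Rintegral => w _; rewrite mul1r.
- by apply: measurable_fun_cdot => //; exact: measurable_cst.
- by move=> D mD; have := hY u D mD.
Qed.

Lemma gaussian_law_cosdata n (nu : probability 'cV[K]_n K) m P :
  psdmx P -> gaussian_law nu m P -> cosdata nu m P.
Proof.
move=> Pp h u b; apply: (@gaussian_law_cos _ _ nu n id) => //.
Qed.

(* The weight exp(-Y^2/2) is the average of cos(s Y) over a standard normal s;
   the resulting integral over s is again a normal one. *)
Lemma gaussian_weight d (T : measurableType d) (mu : {finite_measure set T -> \bar K})
    (w Y Z : T -> K) (C a b c al et : K) :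
  bmf w -> measurable_fun setT Y -> measurable_fun setT Z -> 0 <= c ->
  (forall s phi, \int[mu]_x (cos (Z x + s * Y x + phi) * w x) =
     C * expR (- (a + 2 * b * s + c * s ^+ 2) / 2) * cos (al + s * et + phi)) ->
  forall phi, \int[mu]_x (cos (Z x + phi) * (expR (- Y x ^+ 2 / 2) * w x)) =
    C * (Num.sqrt (1 + c))^-1 * expR (- (a + (et ^+ 2 - b ^+ 2) / (1 + c)) / 2) *
      cos (al - b * et / (1 + c) + phi).
Proof.
move=> bw mY mZ c0 h phi.
have c1 : 0 < 1 + c by lra.
have one0 : 1 != 0 :> K by exact: oner_neq0.
transitivity (\int[mu]_x \int[normal_prob 0 1]_s
    (cos (Z x + s * Y x + phi) * w x)).
  apply: eq_Rintegral => x _.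
  transitivity (w x * \int[normal_prob 0 1]_s cos (Y x * s + (Z x + phi))).
    rewrite normal_prob_cos// mulr0 add0r expr1n mul1r.
    by ring.
  rewrite -int_bmfZ; last exact: bmf_cos_affine.
  by apply: eq_Rintegral => s _; rewrite mulrC; congr (cos _ * _); ring.
have bF : bmf (fun z : T * measurableTypeR K => cos (Z z.1 + z.2 * Y z.1 + phi) * w z.1).
  apply: bmfM; last by apply: bmf_comp => //; exact: measurable_fst.
  apply: bmf_cos; apply: measurable_funD; last exact: measurable_cst.
  apply: measurable_funD; first by apply: (measurableT_comp mZ); exact: measurable_fst.
  apply: measurable_funM; first exact: measurable_snd.
  by apply: (measurableT_comp mY); exact: measurable_fst.
rewrite (@bmf_fubini K _ T mu _ _ (normal_prob 0 1) _ bF).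
under eq_Rintegral do rewrite h.
rewrite normal_prob_int; last first.
  have -> : (fun s : measurableTypeR K => C * expR (- (a + 2 * b * s + c * s ^+ 2) / 2) *
      cos (al + s * et + phi)) = (fun s => \int[mu]_x (cos (Z x + s * Y x + phi) * w x)).
    by apply/funext => s; rewrite h.
  have bF' : bmf (fun z : measurableTypeR K * T => cos (Z z.2 + z.1 * Y z.2 + phi) * w z.2).
    have := bmf_comp bF (@measurable_swap _ _ (measurableTypeR K) T).
    by [].
  exact: (bmf_int_section (normal_prob 0 1) mu bF').
(* Completing the square in (1 + c)s^2 + 2bs + a leaves a normal law in s with mean -b/(1 + c) and
   standard deviation [sg]; the change of normalisation contributes the factor [sg]. *)
set sg := (Num.sqrt (1 + c))^-1.
have sg0 : sg != 0 by rewrite invr_eq0 gt_eqF// sqrtr_gt0.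
have sg2 : sg ^+ 2 = (1 + c)^-1 by rewrite /sg exprVn sqr_sqrtr// ltW.
transitivity (C * sg * expR (- (a - b ^+ 2 / (1 + c)) / 2) *
   \int[normal_prob (- b / (1 + c)) sg]_s cos (et * s + (al + phi))).
  rewrite normal_prob_int; last exact: bmf_cos_affine.
  rewrite -RintegralZl//; last first.
    apply: integrable_bmfM; first exact: bmf_cos_affine.
    exact: integrable_normal_pdf.
  apply: eq_Rintegral => s _.
  rewrite !normal_pdfE// /normal_peak /normal_fun sg2.
  rewrite -[1 ^+ 2 * pi *+ 2]mulr_natr expr1n mul1r.
  have -> : Num.sqrt ((1 + c)^-1 * pi *+ 2) = sg * Num.sqrt (pi * 2).
    by rewrite -mulr_natr -mulrA sqrtrM ?invr_ge0 ?(ltW c1)// /sg sqrtrV ?(ltW c1).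
  have q0 : Num.sqrt (pi * 2) != 0 :> K by rewrite gt_eqF// sqrtr_gt0 mulr_gt0 ?pi_gt0.
  have -> : al + s * et + phi = et * s + (al + phi) by ring.
  have -> : expR (- (a + 2 * b * s + c * s ^+ 2) / 2) =
      expR (- (a - b ^+ 2 / (1 + c)) / 2) * expR (- (s - - b / (1 + c)) ^+ 2 / ((1 + c)^-1 *+ 2))
        / expR (- (s - 0) ^+ 2 / (2 *+ 1)) .
    rewrite -expRN -!expRD; congr expR; rewrite -mulr_natr mulr1n subr0; field.
    by rewrite gt_eqF.
  have e0 : expR (- (s - 0) ^+ 2 / (2 *+ 1)) != 0 :> K by rewrite gt_eqF// expR_gt0.
  rewrite mulr1n in e0 *.
  by field; rewrite q0 sg0 e0.
rewrite normal_prob_cos// sg2 -!mulrA; congr (_ * (_ * _)).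
rewrite mulrA -expRD; congr (expR _ * cos _); field; by rewrite gt_eqF.
Qed.

End normal_laws.

(** * Relative entropy of two laws with proportional tilts *)

Section entropy.
Context {K : realType} {d} {T : measurableType d}.

Lemma measurable_lne : measurable_fun setT (@lne K).
Proof.
apply: (measurability _ (ErealGenOInfty.measurableE K)) => _ [_ [r ->] <-].
rewrite setTI (_ : _ @^-1` _ = `](expR r)%:E, +oo[%classic); first exact: emeasurable_itv.
apply/seteqP; split=> x /=; rewrite !in_itv /= !andbT => h.
  have [x0|x0] := leP x 0%E; first by move: h; rewrite le0_lneNy// ltNge leNye.
  by move: h; rewrite -lte_expeR lneK ?in_itv/= ?leey ?andbT ?ltW.
have x0 : (0 < x)%E by apply: lt_trans h; rewrite lte_fin expR_gt0.
by rewrite -lte_expeR lneK ?in_itv/= ?leey ?andbT ?ltW.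
Qed.

Variables (nu1 nu2 : probability T K) (q1 q2 : T -> K) (C1 C2 : K).
Hypotheses (mq1 : measurable_fun setT q1) (mq2 : measurable_fun setT q2).
Hypotheses (q10 : forall x, 0 <= q1 x) (q20 : forall x, 0 <= q2 x).
Hypotheses (C1p : 0 < C1) (C2p : 0 < C2).
Hypothesis q12 : forall f, bmf f ->
  C2 * \int[nu1]_x (f x * expR (- q1 x)) = C1 * \int[nu2]_x (f x * expR (- q2 x)).

Let k := ln (C1 / C2).
Let q x := q1 x - q2 x.
Let D x := expR (k + q x).

Let mq : measurable_fun setT q. Proof. exact: measurable_funB. Qed.

Let mD : measurable_fun setT D.
Proof.
by apply: measurableT_comp => //; apply: measurable_funD => //; exact: measurable_cst.
Qed.

(** The density [D] may be unbounded whereas [q12] only admits bounded test functions. On the part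
    of A where q1 <= n the function exp(q1) is bounded and cancels the tilt; monotone convergence
    then removes the truncation. *)
Lemma tilted_density A : measurable A -> nu1 A = (\int[nu2]_(x in A) (D x)%:E)%E.
Proof.
move=> mA.
pose B (n : nat) := [set x | q1 x <= n%:R].
have mB n : measurable (B n).
  have := mq1 measurableT (measurable_itv `]-oo, (n%:R : K)]).
  by rewrite setTI; congr measurable; apply/seteqP; split => x /=; rewrite in_itv.
have mAB n : measurable (A `&` B n) by exact: measurableI.
have ndAB : nondecreasing_seq (fun n => A `&` B n).
  move=> m n mn; apply/subsetPset => x [Ax Bx]; split=> //.
  by apply: le_trans Bx _; rewrite ler_nat.
have UAB : \bigcup_n (A `&` B n) = A.
  apply/seteqP; split=> [x [n _ []]//|x Ax].
  have [n _ /(_ n (leqnn n)) /= hn] := nbhs_infty_ger (q1 x).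
  by exists n.
have c1 : (fun n => nu1 (A `&` B n)) @ \oo --> nu1 A.
  rewrite -{2}UAB; apply: nondecreasing_cvg_mu => //.
  by rewrite UAB.
pose g n x : \bar K := (\1_(A `&` B n) x * D x)%:E.
have mg n : measurable_fun setT (g n).
  by apply/measurable_EFinP; apply: measurable_funM => //; exact: measurable_indic.
have g0 n x : (0 <= g n x)%E by rewrite lee_fin mulr_ge0 ?expR_ge0.
have ndg x : {homo g^~ x : n m / (n <= m)%N >-> (n <= m)%E}.
  move=> m n mn; rewrite lee_fin ler_wpM2r ?expR_ge0// !indicE.
  case: (boolP (x \in A `&` B m)) => [|_]; last exact: ler0n.
  by rewrite inE => hx; rewrite mem_set//; move: hx; apply/subsetPset; exact: ndAB.
have gl x : (fun n => g n x) @ \oo --> ((D x)%:E * (\1_A x)%:E)%E.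
  have [Ax|nAx] := pselect (A x); last first.
    apply: cvg_near_cst; apply: nearW => n; rewrite /g !indicE !memNset//; last by case.
    by rewrite mul0r mule0.
  apply: cvg_near_cst; apply: filterS (nbhs_infty_ger (q1 x)) => n hn.
  by rewrite /g !indicE !mem_set// mul1r mule1.
have c2 : (fun n => \int[nu2]_x g n x)%E @ \oo --> (\int[nu2]_(x in A) (D x)%:E)%E.
  have -> : (\int[nu2]_(x in A) (D x)%:E)%E = (\int[nu2]_x limn (fun n => g n x))%E.
    rewrite integral_mkcond; apply: eq_integral => x _.
    have /cvg_lim -> // := gl x; rewrite patchE indicE.
    by case: (x \in A); rewrite ?mule1 ?mule0.
  by apply: cvg_monotone_convergence => // x _ m n mn; exact: ndg.
suff e n : nu1 (A `&` B n) = (\int[nu2]_x g n x)%E.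
  rewrite (_ : (fun n => nu1 (A `&` B n)) = (fun n => \int[nu2]_x g n x)%E) in c1.
    exact: (cvg_unique _ c1 c2).
  by apply/funext.
pose f x := \1_(A `&` B n) x * expR (q1 x).
have bf : bmf f.
  split.
    apply: measurable_funM; first exact: measurable_indic.
    exact: measurableT_comp.
  exists (expR n%:R) => x; rewrite /f indicE.
  case: (boolP (x \in _)) => /=; last by rewrite mul0r normr0 expR_ge0.
  by rewrite inE => -[_ Bx]; rewrite mul1r ger0_norm ?expR_ge0// ler_expR.
have h := q12 bf.
have i1 : \int[nu1]_x (f x * expR (- q1 x)) = fine (nu1 (A `&` B n)).
  rewrite -(int_indic nu1 (mAB n)); apply: eq_Rintegral => x _.
  by rewrite /f -mulrA -expRD subrr expR0 mulr1.
have i2 : \int[nu2]_x (\1_(A `&` B n) x * D x) = C1 / C2 * \int[nu2]_x (f x * expR (- q2 x)).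
  rewrite -int_bmfZ; last first.
    apply: bmfM => //; split; first by apply: measurableT_comp => //; exact: measurableT_comp.
    by exists 1 => x; rewrite ger0_norm ?expR_ge0// -expR0 ler_expR oppr_le0.
  apply: eq_Rintegral => x _.
  rewrite /D /f !expRD lnK ?posrE ?divr_gt0// expRN; ring.
have i3 : fine (nu1 (A `&` B n)) = \int[nu2]_x (\1_(A `&` B n) x * D x).
  rewrite i2 -i1 mulrAC -h [C2 * _]mulrC mulfK ?gt_eqF//.
rewrite -[LHS]fineK ?fin_num_measure// i3 /Rintegral fineK//.
have bG : bmf (fun x => \1_(A `&` B n) x * D x).
  have := bmfZ (C1 / C2) (bmfM bf (_ : bmf (fun x => expR (- q2 x)))).
  have bq : bmf (fun x => expR (- q2 x)).
    split; first by apply: measurableT_comp => //; exact: measurableT_comp.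
    by exists 1 => x; rewrite ger0_norm ?expR_ge0// -expR0 ler_expR oppr_le0.
  move=> /(_ bq); congr bmf; apply/funext => x.
  by rewrite /D /f !expRD lnK ?posrE ?divr_gt0// expRN; ring.
by apply: (@integrable_fin_num _ T K nu2 setT) => //; exact: (bmf_int nu2 bG).
Qed.

(* Log-densities are compared with [expR_ge1Dx], which turns the entropy into
   its symmetrised form and makes the normalising constants disappear. *)
Lemma relative_entropy_le :
  nu1.-integrable setT (EFin \o q) -> nu2.-integrable setT (EFin \o q) ->
  (relative_entropy nu1 nu2 <= (\int[nu1]_x q x - \int[nu2]_x q x)%:E)%E.
Proof.
move=> iq1 iq2.
have dom : nu1 `<< nu2.
  apply/null_content_dominatesP => A mA A0; rewrite tilted_density//.
  by apply: null_set_integral => //; apply: measurable_funTS; exact/measurable_EFinP.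
rewrite /relative_entropy; case: asboolP => // _.
have iD : nu2.-integrable setT (EFin \o D).
  apply/integrableP; split; first exact/measurable_EFinP.
  under eq_integral do rewrite /= ger0_norm ?expR_ge0//.
  by rewrite -tilted_density// probability_setT ltry.
have iRN : nu2.-integrable setT (Radon_Nikodym (charge_of_finite_measure nu1) nu2).
  exact: Radon_Nikodym_integrable.
have mRN := measurable_int _ iRN.
have aeD : ae_eq nu2 setT (Radon_Nikodym (charge_of_finite_measure nu1) nu2) (EFin \o D).
  apply: integral_ae_eq => //; first exact/measurable_EFinP.
  by move=> E _ mE; rewrite -Radon_Nikodym_integral//= tilted_density.
(* The Radon-Nikodym derivative is identified only up to [nu2]-null sets, but its logarithm is
   integrated against [nu1]; domination transfers the equality. *)
have aeD1 := null_dominates_ae_eq measurableT dom aeD.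
have -> : (\int[nu1]_z lne (Radon_Nikodym (charge_of_finite_measure nu1) nu2 z))%E =
    (\int[nu1]_z (k + q z)%:E)%E.
  apply: ae_eq_integral => //.
  - exact: (measurableT_comp measurable_lne mRN).
  - by apply/measurable_EFinP; apply: measurable_funD => //; exact: measurable_cst.
  - apply: filterS aeD1 => x h _; transitivity (lne (D x)%:E); first by congr lne; exact: h.
    by rewrite lne_EFin ?expR_gt0// expRK.
have ik (nu : probability T K) : nu.-integrable setT (EFin \o cst k).
  by apply: bmf_int; exact: bmf_cst.
have cc (nu : probability T K) c : \int[nu]_x cst c x = c.
  transitivity (c * fine (nu setT)); first exact: Rintegral_cst.
  by rewrite probability_setT mulr1.
have ck nu := cc nu k.
have ikq (nu : probability T K) : nu.-integrable setT (EFin \o q) ->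
    nu.-integrable setT (EFin \o (fun x => k + q x)).
  move=> iq; have -> : EFin \o (fun x => k + q x) = ((EFin \o cst k) \+ (EFin \o q))%E.
    by apply/funext => x.
  by apply: integrableD => //; exact: ik.
have ckq (nu : probability T K) : nu.-integrable setT (EFin \o q) ->
    \int[nu]_x (k + q x) = k + \int[nu]_x q x.
  by move=> iq; rewrite (RintegralD _ (ik nu) iq)// ck.
have -> : (\int[nu1]_z (k + q z)%:E)%E = (k + \int[nu1]_x q x)%:E.
  by rewrite -ckq// /Rintegral fineK//; apply: (integrable_fin_num measurableT (ikq _ iq1)).
rewrite lee_fin addrC lerD2l.
have hD : \int[nu2]_x D x = 1.
  by rewrite /Rintegral -tilted_density// probability_setT.
have : \int[nu2]_x (1 + (k + q x)) <= \int[nu2]_x D x.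
  apply: le_Rintegral => //; last by move=> x _; exact: expR_ge1Dx.
  have -> : EFin \o (fun x => 1 + (k + q x)) =
      ((EFin \o cst 1%R) \+ (EFin \o (fun x => k + q x)%R))%E by apply/funext.
  by apply: integrableD => //; [apply: bmf_int; exact: bmf_cst|exact: ikq].
rewrite hD (RintegralD _ _ (ikq _ iq2))//; last by apply: bmf_int; exact: bmf_cst.
rewrite ckq// (_ : \int[nu2]_x (1 : K) = 1); [by lra|exact: cc].
Qed.

End entropy.

(** * First and second moments recovered from cosine integrals *)

Section sine_bounds.
Context {K : realType}.

Lemma cos_dist1 (y : K) : `|cos y - 1| <= `|y|.
Proof.
wlog y0 : y / 0 <= y => [h|].
  have [/h//|/ltW yn] := leP 0 y.
  by have := h (- y); rewrite cosN normrN; apply; rewrite oppr_ge0.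
have [|c _] := @isd_mvt K (fun y => cos y) (fun y => - sin y * 1) 0 y y0.
  by move=> z _; apply: isd_cos; exact: isd_id.
rewrite cos0 => ->; rewrite mulr1 subr0 normrM normrN ler_piMl//.
by rewrite ler_norml sin_geN1 sin_le1.
Qed.

Lemma sin_dist (y : K) : `|sin y - y| <= y ^+ 2.
Proof.
wlog y0 : y / 0 <= y => [h|].
  have [/h//|/ltW yn] := leP 0 y.
  by have := h (- y); rewrite sinN -opprD normrN sqrrN; apply; rewrite oppr_ge0.
have [|c /andP[c0 cy]] := @isd_mvt K (fun y => sin y - y) (fun y => cos y * 1 - 1) 0 y y0.
  by move=> z _; apply: isdB; [apply: isd_sin|]; exact: isd_id.
rewrite sin0 !subr0 mulr1 => ->.
rewrite normrM expr2 (ger0_norm y0) ler_wpM2r// (le_trans (cos_dist1 _))//.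
by rewrite ger0_norm.
Qed.

Lemma sin_le_norm (y : K) : `|sin y| <= `|y|.
Proof.
wlog y0 : y / 0 <= y => [h|].
  have [/h//|/ltW yn] := leP 0 y.
  by have := h (- y); rewrite sinN !normrN; apply; rewrite oppr_ge0.
have [|c _] := @isd_mvt K (fun y => sin y) (fun y => cos y * 1) 0 y y0.
  by move=> z _; apply: isd_sin; exact: isd_id.
rewrite sin0 !subr0 mulr1 => ->; rewrite normrM ler_piMl//.
by rewrite ler_norml cos_geN1 cos_le1.
Qed.

End sine_bounds.

Section integral_values.
Context {K : realType} {d} {T : measurableType d} (P : probability T K).

(** The real integral is a total function; pairing its value with integrability lets moments be
    computed compositionally. *)
Definition intv (f : T -> K) (c : K) :=
  P.-integrable setT (EFin \o f) /\ \int[P]_x f x = c.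

Lemma intv_eq f c c' : intv f c -> c = c' -> intv f c'.
Proof. by move=> h <-. Qed.

Lemma intv_cst c : intv (cst c) c.
Proof.
split; first by apply: bmf_int; exact: bmf_cst.
transitivity (c * fine (P setT)); first exact: Rintegral_cst.
by rewrite probability_setT mulr1.
Qed.

Lemma intvD f g a b : intv f a -> intv g b -> intv (fun x => f x + g x) (a + b).
Proof.
move=> [fi fa] [gi gb]; split; last by rewrite RintegralD// fa gb.
have -> : EFin \o (fun x => f x + g x) = ((EFin \o f) \+ (EFin \o g))%E by apply/funext.
exact: integrableD.
Qed.

Lemma intvZ k f a : intv f a -> intv (fun x => k * f x) (k * a).
Proof.
move=> [fi fa]; split; last by rewrite RintegralZl// fa.
by have := integrableZl measurableT k fi.
Qed.

Lemma intv_sum n (f : 'I_n -> T -> K) (c : 'I_n -> K) :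
  (forall i, intv (f i) (c i)) -> intv (fun x => \sum_i f i x) (\sum_i c i).
Proof.
elim: n f c => [|n IH] f c h.
  rewrite big_ord0; have -> : (fun x => \sum_(i < 0) f i x) = cst 0.
    by apply/funext => x; rewrite big_ord0.
  exact: intv_cst.
rewrite big_ord_recl; have -> : (fun x => \sum_(i < n.+1) f i x) =
    (fun x => f ord0 x + \sum_(i < n) f (lift ord0 i) x).
  by apply/funext => x; rewrite big_ord_recl.
by apply: intvD; [exact: h|exact: IH].
Qed.

Lemma intv_EFin f c : intv f c -> (\int[P]_x (f x)%:E)%E = c%:E.
Proof.
move=> [fi <-]; rewrite /Rintegral fineK//.
exact: (integrable_fin_num measurableT fi).
Qed.

End integral_values.

Section moments.
Context {K : realType} {d} {T : measurableType d} (P : probability T K).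
Variables (Y : T -> K) (m v : K).
Hypothesis mY : measurable_fun setT Y.
Hypothesis v0 : 0 <= v.
Hypothesis hY : forall u b, \int[P]_x cos (u * Y x + b) =
  expR (- (v * u ^+ 2) / 2) * cos (u * m + b).

Let X x := Y x - m.

Let mX : measurable_fun setT X.
Proof. by apply: measurable_funB => //; exact: measurable_cst. Qed.

Let hX u b : \int[P]_x cos (u * X x + b) = expR (- (v * u ^+ 2) / 2) * cos b.
Proof.
rewrite (_ : b = u * m + (b - u * m)); last by ring.
rewrite -hY; apply: eq_Rintegral => x _; congr cos; rewrite /X; ring.
Qed.

Let r (k : nat) : K := k.+1%:R^-1.
Let r0 k : 0 < r k. Proof. by rewrite invr_gt0 ltr0n. Qed.

(** A bounded substitute for X: |S k| <= |X| and S k tends to X pointwise, while the integrals of S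
    k and of its square are cosine integrals, the latter by sin^2 y = (1 - cos 2y)/2. *)
Let S k x := sin (r k * X x) / r k.

Let mS k : measurable_fun setT (S k).
Proof.
apply: measurable_funM; last exact: measurable_cst.
have ms : measurable_fun setT (@sin K).
  by apply: continuous_measurable_fun; exact: continuous_sin.
by apply: (measurableT_comp ms); apply: measurable_funM.
Qed.

Let S_le k x : `|S k x| <= `|X x|.
Proof.
rewrite normrM [`|(r k)^-1|]gtr0_norm ?invr_gt0// ler_pdivrMr//.
by apply: le_trans (sin_le_norm _) _; rewrite normrM mulrC (gtr0_norm (r0 k)).
Qed.

Let r_cvg c : (fun k => r k * c) @ \oo --> (0 : K).
Proof. by rewrite -[X in _ --> X](mul0r c); apply: cvgM; [exact: cvg_harmonic|exact: cvg_cst]. Qed.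

Let S_cvg x : (fun k => S k x) @ \oo --> X x.
Proof.
apply/cvgrPdist_le => e e0; have /cvgrPdist_le/(_ _ e0) := r_cvg (X x ^+ 2).
apply: filterS => k; rewrite sub0r normrN; apply: le_trans.
rewrite distrC (_ : S k x - X x = (sin (r k * X x) - r k * X x) / r k); last first.
  by rewrite /S mulrBl mulrAC divff ?mul1r// gt_eqF.
rewrite normrM [`|(r k)^-1|]gtr0_norm ?invr_gt0// ler_pdivrMr//.
apply: le_trans (sin_dist _) _.
have -> : `|r k * X x ^+ 2| = r k * X x ^+ 2 by rewrite ger0_norm// mulr_ge0 ?sqr_ge0// ltW.
by rewrite le_eqVlt; apply/orP; left; apply/eqP; ring.
Qed.

Let bS2 k : bmf (fun x => S k x ^+ 2).
Proof.
split; first by apply: measurable_funX.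
have ri : 0 <= (r k)^-1 by rewrite invr_ge0 ltW.
exists (((r k)^-1) ^+ 2) => x; rewrite normrX ler_sqr ?nnegrE//.
rewrite normrM [`|(r k)^-1|]ger0_norm// ler_piMl//.
by rewrite ler_norml sin_geN1 sin_le1.
Qed.

Let int_S2 k : \int[P]_x (S k x ^+ 2) = (1 - expR (- (2 * v * r k ^+ 2))) / (2 * r k ^+ 2).
Proof.
have rn : r k != 0 by rewrite gt_eqF.
have e x : S k x ^+ 2 = (2 * r k ^+ 2)^-1 * (1 - cos (2 * r k * X x + 0)).
  rewrite addr0 (_ : 2 * r k * X x = (r k * X x) *+ 2); last by rewrite mulr2n; ring.
  by rewrite cos_mulr2n /S cos2sin2 -[_ *+ 2]mulr_natl; field.
have bc : bmf (fun x => cos (2 * r k * X x + 0)).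
  by apply: bmf_cos; apply: measurable_funD => //; exact: measurable_funM.
under eq_Rintegral do rewrite e.
rewrite int_bmfZ; last by apply: bmfB => //; exact: bmf_cst.
rewrite int_bmfB//; last exact: bmf_cst.
have -> : \int[P]_x (1 : K) = 1 by have [] := intv_cst P (1 : K).
rewrite hX cos0 mulr1 mulrC; congr ((1 - expR _) / _).
by field.
Qed.

Let int_S2_le k : \int[P]_x (S k x ^+ 2) <= v.
Proof.
rewrite int_S2 ler_pdivrMr ?mulr_gt0 ?exprn_gt0//.
have := expR_ge1Dx (- (2 * v * r k ^+ 2)); lra.
Qed.

(** Fatou's lemma applied to the bounds on the integrals of (S k)^2. It comes before any other
    moment, since X^2 and 1 + X^2 are the majorants for the dominated convergences below. *)
Let X2_fin : (\int[P]_x (X x ^+ 2)%:E <= v%:E)%E.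
Proof.
have -> : (\int[P]_x (X x ^+ 2)%:E)%E = (\int[P]_x limn_einf (fun k => (S k x ^+ 2)%:E))%E.
  apply: eq_integral => x _.
  have c : (fun k => (S k x ^+ 2)%:E) @ \oo --> (X x ^+ 2)%:E.
    apply/fine_cvgP; split; first exact: nearW.
    by apply: cvgM; exact: S_cvg.
  by rewrite is_cvg_limn_einfE; [apply/esym/cvg_lim|apply: cvgP c].
apply: le_trans (fatou _ _ _ _) _ => //.
- by move=> k; apply/measurable_EFinP; have [] := bS2 k.
- by move=> k x _; rewrite lee_fin sqr_ge0.
rewrite limn_einf_lim; apply: lime_le.
  by apply: is_cvg_einfs.
apply: nearW => k; apply: ereal_inf_le; exists (\int[P]_x (S k x ^+ 2)%:E)%E.
  by exists k => /=.
rewrite (_ : (\int[P]_x (S k x ^+ 2)%:E)%E = (\int[P]_x (S k x ^+ 2))%:E); last first.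
  by rewrite /Rintegral fineK//; apply: (integrable_fin_num measurableT (bmf_int P (bS2 k))).
by rewrite lee_fin.
Qed.

Lemma integrable_sqr : P.-integrable setT (EFin \o (fun x => X x ^+ 2)).
Proof.
apply/integrableP; split; first by apply/measurable_EFinP; apply: measurable_funX.
under eq_integral do rewrite /= ger0_norm ?sqr_ge0//.
by apply: le_lt_trans X2_fin _; rewrite ltry.
Qed.

Let integrable_one_sqr : P.-integrable setT (EFin \o (fun x => 1 + X x ^+ 2)).
Proof.
have -> : EFin \o (fun x => 1 + X x ^+ 2) =
    ((EFin \o cst 1%R) \+ (EFin \o (fun x => X x ^+ 2)%R))%E by apply/funext.
by apply: integrableD => //; [apply: bmf_int; exact: bmf_cst|exact: integrable_sqr].
Qed.

Let norm_le_one_sqr x : `|X x| <= 1 + X x ^+ 2.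
Proof. by rewrite -real_normK ?num_real//; have := sqr_ge0 (`|X x| - 1); nra. Qed.

Lemma intv_centered : intv P X 0.
Proof.
have [] := @dominated_convergence _ T K P setT measurableT
  (fun k => EFin \o S k) (EFin \o X) _ _ _ _ integrable_one_sqr _.
- by move=> k; apply/measurable_EFinP.
- exact/measurable_EFinP.
- by apply: aeW => x _; apply/fine_cvgP; split; [exact: nearW|exact: S_cvg].
- by apply: aeW => x k _ /=; rewrite lee_fin (le_trans (S_le k x)).
move=> iX _ cX; split=> //.
have c1 : (fun k => \int[P]_x S k x) @ \oo --> \int[P]_x X x.
  by apply: fine_cvg; rewrite fineK//; exact: (integrable_fin_num measurableT iX).
suff c2 : (fun k => \int[P]_x S k x) @ \oo --> (0 : K) by exact: (cvg_unique _ c1 c2).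
rewrite (_ : (fun k => _) = cst 0); first exact: cvg_cst.
apply/funext => k /=.
have -> : \int[P]_x S k x = (r k)^-1 * \int[P]_x cos (r k * X x + - (pi / 2)).
  rewrite -int_bmfZ; last first.
    apply: bmf_cos; apply: measurable_funD; last exact: measurable_cst.
    exact: measurable_funM.
  apply: eq_Rintegral => x _.
  by rewrite cosB cos_pihalf sin_pihalf mulr0 add0r mulr1 mulrC.
by rewrite hX cosN cos_pihalf !mulr0.
Qed.

Lemma intv_sqr : intv P (fun x => X x ^+ 2) v.
Proof.
split; first exact: integrable_sqr.
have [] := @dominated_convergence _ T K P setT measurableT
  (fun k => EFin \o (fun x => S k x ^+ 2)) (EFin \o (fun x => X x ^+ 2)) _ _ _ _ integrable_sqr _.
- by move=> k; apply/measurable_EFinP; have [] := bS2 k.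
- by apply/measurable_EFinP; apply: measurable_funX.
- apply: aeW => x _; apply/fine_cvgP; split; first exact: nearW.
  by apply: cvgM; exact: S_cvg.
- apply: aeW => x k _ /=; rewrite lee_fin normrX -[leRHS]real_normK ?num_real//.
  by rewrite ler_sqr ?nnegrE.
move=> iX _ cX.
have c1 : (fun k => \int[P]_x S k x ^+ 2) @ \oo --> \int[P]_x (X x ^+ 2).
  by apply: fine_cvg; rewrite fineK//; exact: (integrable_fin_num measurableT iX).
apply/eqP; rewrite eq_le; apply/andP; split.
  by apply: (cvgr_to_le c1); apply: nearW => k; exact: int_S2_le.
(* The integrals of (S k)^2 equal (1 - e^{-2vy})/(2y) with y = (r k)^2. They are squeezed between v
   - 2 v^2 r_k and v, by e^{-2z} <= 1/(1 + 2z) <= 1 - 2z + 4z^2 and y <= r_k. *)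
have c2 : (fun k => v - r k * (2 * v ^+ 2)) @ \oo --> v - 0.
  by apply: cvgB; [exact: cvg_cst|exact: r_cvg].
rewrite subr0 in c2.
apply: (ler_cvg_to c2 c1); apply: nearW => k.
rewrite int_S2; set y := r k ^+ 2; have y0 : 0 < y by rewrite exprn_gt0.
have yr : y <= r k by rewrite /y expr2 ler_piMl ?(ltW (r0 k))// invf_le1 ?ler1n ?ltr0n.
have e1 := expR_ge1Dx (2 * v * y).
rewrite ler_pdivlMr ?mulr_gt0// expRN.
set z := v * y; have z0 : 0 <= z by rewrite mulr_ge0// ltW.
have zE : 2 * v * y = 2 * z by rewrite /z; ring.
rewrite zE in e1 *.
have h2 : 0 < 1 + 2 * z by lra.
have h : (expR (2 * z))^-1 <= (1 + 2 * z)^-1 by rewrite lef_pV2// posrE expR_gt0.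
have h3 : (1 + 2 * z)^-1 <= 1 - 2 * z + 4 * z ^+ 2.
  rewrite -div1r ler_pdivrMr//.
  by have := mulr_ge0 z0 (sqr_ge0 z); rewrite -exprS; nra.
have h4 : (v - r k * (2 * v ^+ 2)) * (2 * y) <= (v - y * (2 * v ^+ 2)) * (2 * y).
  rewrite ler_pM2r ?mulr_gt0// lerD2l lerN2 ler_wpM2r// mulr_ge0//.
  by rewrite sqr_ge0.
have h5 : (v - y * (2 * v ^+ 2)) * (2 * y) = 2 * z - 4 * z ^+ 2 by rewrite /z; ring.
by apply: le_trans h4 _; rewrite h5; move: h h3; set e := _^-1; lra.
Qed.

End moments.

(** * Square roots of positive semi-definite matrices *)

Section psd_square_root.
Import complex.
Context {K : realType}.

Lemma interpolation_poly (s : seq K) (f : K -> K) :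
  exists p : {poly K}, forall x, x \in s -> p.[x] = f x.
Proof.
elim: s => [|a s [p hp]]; first by exists 0.
have [as_|as_] := boolP (a \in s).
  by exists p => x; rewrite inE => /predU1P[->|]; apply: hp.
pose q := \prod_(b <- s) ('X - b%:P).
have qa : q.[a] != 0.
  by apply: contra as_; rewrite -[_ == 0]/(root q a) root_prod_XsubC.
exists (p + ((f a - p.[a]) / q.[a])%:P * q) => x; rewrite inE hornerD hornerM hornerC.
move=> /predU1P[->|xs]; first by rewrite divfK// addrC subrK.
have /eqP -> : root q x by rewrite root_prod_XsubC.
by rewrite mulr0 addr0 hp.
Qed.

Lemma horner_mx_tr n (M : 'M[K]_n.+1) (p : {poly K}) : M^T = M ->
  (horner_mx M p)^T = horner_mx M p.
Proof.
move=> Ms; elim/poly_ind: p => [|p c IH]; first by rewrite rmorph0 trmx0.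
rewrite rmorphD rmorphM /= horner_mx_X horner_mx_C linearD /= tr_scalar_mx.
rewrite trmx_mul Ms IH; congr (_ + _).
by have /(congr1 (horner_mx M)) := mulrC 'X p; rewrite !rmorphM /= horner_mx_X.
Qed.

(* The complex spectral theorem diagonalises M with real nonnegative entries;
   [p] interpolates the fourth root there. *)
Theorem psd_sqrt n (M : 'M[K]_n.+1) : psdmx M -> exists N, psdmx N /\ N *m N = M.
Proof.
move=> [Ms Mp].
pose C := Num.ClosedField.clone (complex K) _.
pose F : {rmorphism K -> C} := GRing.RMorphism.clone _ _ (real_complex K) _.
have Freal x : (F x)^* = F x.
  apply/CrealP; rewrite qualifE /=.
  rewrite -[0](rmorph0 F) !lecR.
  by have := num_real x; rewrite qualifE.
pose A := map_mx F M.
have Aherm : A \is hermsymmx.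
  apply/is_hermitianmxP; rewrite expr0 scale1r.
  apply/matrixP => i j; rewrite !mxE Freal.
  by rewrite -[in RHS]Ms mxE.
have /orthomx_spectralP AE := hermitian_normalmx Aherm.
have Dreal := hermitian_spectral_diag_real Aherm.
set U := spectralmx A in AE; set D := spectral_diag A in AE Dreal.
have Uu : U \in unitmx := spectral_unit A.
have Dev i : exists l : K, 0 <= l /\ D 0 i = F l.
  have /mxOverP/(_ 0 i) /complex_realP[l lE] := Dreal.
  exists l; split=> //.
  have : eigenvalue A (F l).
    apply/eigenvalueP; exists (row i U).
      rewrite -row_mul AE -[in LHS]mulmxA mulKVmx// row_mul row_diag_mx.
      by rewrite -scalemxAl -rowE lE.
    apply/negP => /eqP U0; have := row_mul i U (invmx U).
    rewrite U0 mul0mx mulmxV// => /rowP/(_ i); rewrite !mxE eqxx => /eqP.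
    by rewrite oner_eq0.
  (* A real eigenvalue of the complexified matrix is an eigenvalue of M itself; its real eigenvector
     can be inserted in the quadratic form, which gives 0 <= l. *)
  rewrite eigenvalue_map => /eigenvalueP[v vM v0].
  have v0' : v^T != 0 by apply: contra_neq v0 => /(congr1 trmx); rewrite trmxK trmx0.
  have := Mp v^T; rewrite quadE -[X in cdot _ (X *m _)]Ms -trmx_mul vM.
  rewrite linearZ /= cdotZr pmulr_lge0// lt0r cdot_ge0 andbT.
  by apply: contra_neq v0'; exact: cdot_eq0.
have [d hd] := choice Dev.
have [r hr] := interpolation_poly [seq d i | i <- enum 'I_n.+1] (fun x => Num.sqrt (Num.sqrt x)).
(* The fourth root is taken because L is only known to be symmetric, as a polynomial in M; its
   square [L *m L] is then visibly positive semi-definite and is the required root. *)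
pose L := horner_mx M r.
have Ls : L^T = L := horner_mx_tr r Ms.
exists (L *m L); split.
  split; first by rewrite trmx_mul Ls.
  by move=> z; rewrite quadE -mulmxA -{1}Ls -cdot_mulmxl cdot_ge0.
pose q := r * r * (r * r) - 'X.
suff : horner_mx M q = 0.
  rewrite /q rmorphB !rmorphM /= horner_mx_X => /eqP; rewrite subr_eq0 => /eqP.
  by [].
apply: (@map_mx_inj _ _ F); rewrite map_mx0 map_horner_mx -/A AE.
rewrite horner_mx_uconjC// horner_mx_diag.
suff -> : map_mx (horner (map_poly F q)) D = 0 by rewrite linear0 mulmx0 mul0mx.
apply/rowP => i; rewrite !mxE (hd i).2 horner_map.
have -> : q.[d i] = 0; last by rewrite rmorph0.
have [d0 _] := hd i.
rewrite /q hornerD hornerN hornerX !hornerM hr; last by rewrite map_f// mem_enum.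
set s := Num.sqrt (Num.sqrt (d i)).
transitivity ((s ^+ 2) ^+ 2 - d i); first by ring.
by rewrite /s sqr_sqrtr ?sqrtr_ge0// sqr_sqrtr// subrr.
Qed.

End psd_square_root.

(** * Trace pairing and quadratic moments of Gaussian vectors *)

Section trace_form.
Context {K : realType}.

(* The trace of [V^T *m P]. *)
Definition mdot {n} (V P : 'M[K]_n) : K := \sum_i \sum_j V i j * P i j.

Lemma mdotDl n (V W P : 'M[K]_n) : mdot (V + W) P = mdot V P + mdot W P.
Proof.
rewrite -big_split; apply: eq_bigr => i _; rewrite -big_split; apply: eq_bigr => j _.
by rewrite mxE mulrDl.
Qed.

Lemma mdotC n (V P : 'M[K]_n) : mdot V P = mdot P V.
Proof. by do 2!(apply: eq_bigr => ? _); rewrite mulrC. Qed.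

Lemma mdotNl n (V P : 'M[K]_n) : mdot (- V) P = - mdot V P.
Proof.
rewrite -sumrN; apply: eq_bigr => i _; rewrite -sumrN; apply: eq_bigr => j _.
by rewrite mxE mulNr.
Qed.

Lemma mdotBl n (V W P : 'M[K]_n) : mdot (V - W) P = mdot V P - mdot W P.
Proof. by rewrite mdotDl mdotNl. Qed.

Lemma mdotBr n (V W P : 'M[K]_n) : mdot P (V - W) = mdot P V - mdot P W.
Proof. by rewrite mdotC mdotBl ![mdot _ P]mdotC. Qed.

Lemma mdot_le n (V P : 'M[K]_n) a b : opb V a -> opb P b ->
  `|mdot V P| <= n%:R ^+ 2 * (a * b).
Proof.
move=> Va Pb; rewrite (le_trans (ler_norm_sum _ _ _))//.
have hij i j : true -> `|V i j * P i j| <= a * b.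
  by move=> _; rewrite normrM ler_pM// opb_coord.
have h i : true -> `|\sum_j V i j * P i j| <= n%:R * (a * b).
  move=> _; rewrite (le_trans (ler_norm_sum _ _ _))//.
  by rewrite (le_trans (ler_sum _ (hij i)))// sumr_const card_ord mulr_natl.
rewrite (le_trans (ler_sum _ h))// sumr_const card_ord.
by rewrite expr2 -mulrA !mulr_natl.
Qed.

Lemma quad_sum n (V : 'M[K]_n) z : quad V z = \sum_i \sum_j V i j * (z i 0 * z j 0).
Proof.
rewrite quadE cdotE; apply: eq_bigr => i _; rewrite mxE mulr_sumr.
by apply: eq_bigr => j _; ring.
Qed.

Lemma sum_col_outer m n (N : 'M[K]_(m, n)) : \sum_j col j N *m (col j N)^T = N *m N^T.
Proof.
apply/matrixP => i k; rewrite summxE !mxE; apply: eq_bigr => j _.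
by rewrite mxE big_ord1 !mxE.
Qed.

Lemma sum_col_sqr m n (N : 'M[K]_(m, n)) z :
  \sum_j cdot (col j N) z ^+ 2 = quad (N *m N^T) z.
Proof.
rewrite quadE -mulmxA cdot_mulmxr cdotE; apply: eq_bigr => j _.
rewrite expr2; congr (_ * _); rewrite cdotE mxE; apply: eq_bigr => i _;
  by rewrite !mxE.
Qed.

Lemma quad_outer n (l z : 'cV[K]_n) : quad (l *m l^T) z = cdot l z ^+ 2.
Proof.
rewrite quadE -mulmxA [l^T *m z]mx11_scalar mul_mx_scalar cdotZr -/(cdot l z).
by rewrite [cdot z l]cdotC expr2.
Qed.

End trace_form.

Section gaussian_vectors.
Context {K : realType} {n : nat}.
Variables (nu : probability 'cV[K]_n K) (m : 'cV[K]_n) (P : 'M[K]_n).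
Hypotheses (Pp : psdmx P) (hnu : cosdata nu m P).

Let hlin u v b : \int[nu]_z cos (v * cdot u z + b) =
  expR (- (quad P u * v ^+ 2) / 2) * cos (v * cdot u m + b).
Proof.
rewrite -cdotZl [quad P u * _]mulrC -quadcZ -hnu.
by apply: eq_Rintegral => z _; rewrite cdotZl.
Qed.

Lemma intv_cdot u : intv nu (fun z => cdot u (z - m)) 0.
Proof.
have := intv_centered (measurable_cdotl u) (hlin u).
by congr intv; apply/funext => z; rewrite cdotBr.
Qed.

Lemma intv_cdot_sqr u : intv nu (fun z => cdot u (z - m) ^+ 2) (quad P u).
Proof.
have := intv_sqr (measurable_cdotl u) (Pp.2 u) (hlin u).
by congr intv; apply/funext => z; rewrite cdotBr.
Qed.

Let quad_delta i j : cdot (delta_mx i 0) (P *m delta_mx j 0) = P i j.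
Proof. by rewrite cdot_delta -colE mxE. Qed.

(** Polarisation: the product of two coordinates is a quarter of the difference of the squares of
    their sum and difference, both of which are squares of linear forms. *)
Lemma intv_cov i j : intv nu (fun z => (z - m) i 0 * (z - m) j 0) (P i j).
Proof.
have := intvD (intvZ (1 / 4) (intv_cdot_sqr (delta_mx i 0 + delta_mx j 0)))
  (intvZ (- 1 / 4) (intv_cdot_sqr (delta_mx i 0 - delta_mx j 0))).
rewrite !quadcD ?Pp.1// mulmxN cdotNr quad_delta.
rewrite (_ : quad P (- delta_mx j 0) = quad P (delta_mx j 0)); last first.
  by rewrite !quadE mulmxN cdotNl cdotNr opprK.
move=> h; have -> : (fun z => (z - m) i 0 * (z - m) j 0) =
    (fun z => 1 / 4 * cdot (delta_mx i 0 + delta_mx j 0) (z - m) ^+ 2 +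
      - 1 / 4 * cdot (delta_mx i 0 - delta_mx j 0) (z - m) ^+ 2).
  by apply/funext => z; rewrite cdotDl cdotBl !cdot_delta; field.
by apply: (intv_eq h); field.
Qed.

Lemma intv_coord i : intv nu (fun z => (z - m) i 0) 0.
Proof.
by have := intv_cdot (delta_mx i 0); congr intv; apply/funext => z; rewrite cdot_delta.
Qed.

Lemma intv_quad V a : intv nu (fun z => quad V (z - a)) (mdot V P + quad V (m - a)).
Proof.
pose f i j z := V i j * ((z - m) i 0 * (z - m) j 0 + (m - a) j 0 * (z - m) i 0
  + (m - a) i 0 * (z - m) j 0 + (m - a) i 0 * (m - a) j 0).
have hf i j : intv nu (f i j) (V i j * (P i j + (m - a) i 0 * (m - a) j 0)).
  apply: intvZ; apply: (@intv_eq _ _ _ _ _ (P i j + (m - a) j 0 * 0 + (m - a) i 0 * 0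
    + (m - a) i 0 * (m - a) j 0)); last by rewrite !mulr0 !addr0.
  apply: intvD; last exact: intv_cst.
  apply: intvD; last by apply: intvZ; exact: intv_coord.
  apply: intvD; first exact: intv_cov.
  by apply: intvZ; exact: intv_coord.
have := intv_sum (fun i => intv_sum (hf i)).
rewrite (_ : \sum_i _ = mdot V P + quad V (m - a)); last first.
  rewrite quad_sum -big_split; apply: eq_bigr => i _; rewrite -big_split.
  by apply: eq_bigr => j _; rewrite /= mulrDr.
congr intv; apply/funext => z; rewrite quad_sum; apply: eq_bigr => i _.
by apply: eq_bigr => j _; rewrite /f !mxE; ring.
Qed.

End gaussian_vectors.

(** * Affine couplings, conditioning, entropy and transport between Gaussian laws *)

Section wasserstein_bounds.
Context {K : realType} {n : nat}.
Variables (nu1 nu2 : probability 'cV[K]_n K) (m1 m2 : 'cV[K]_n) (P1 P2 Tm : 'M[K]_n).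
Hypotheses (h1 : cosdata nu1 m1 P1) (h2 : cosdata nu2 m2 P2).
Hypothesis hT : Tm *m P1 *m Tm^T = P2.

Let F z := m2 + Tm *m (z - m1).

Let mF : measurable_fun setT F.
Proof.
apply: measurable_fun_mxD; first exact: measurable_cst.
by apply: measurable_fun_mulmx; apply: measurable_fun_mxB => //; exact: measurable_cst.
Qed.

Let FE D : measurable D -> nu1 (F @^-1` D) = nu2 D.
Proof.
move=> mD.
have mFD : measurable (F @^-1` D) by have := mF measurableT mD; rewrite setTI.
rewrite -[LHS]fineK ?fin_num_measure// -[RHS]fineK ?fin_num_measure//; congr (_%:E).
rewrite -(int_indic nu1 mFD) -(int_indic nu2 mD).
have e : forall u b, \int[nu1]_x (cos (cdot u (F x) + b) * cst 1 x) =
    \int[nu2]_x (cos (cdot u (id x) + b) * cst 1 x).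
  move=> u b; under eq_Rintegral do rewrite mulr1.
  under [RHS]eq_Rintegral do rewrite mulr1.
  rewrite h2 -hT quad_conj.
  transitivity (\int[nu1]_x cos (cdot (Tm^T *m u) x + (cdot u (m2 - Tm *m m1) + b))).
    apply: eq_Rintegral => x _; congr cos.
    by rewrite /F -cdot_mulmxr cdotBr cdotDr mulmxBr cdotBr; ring.
  rewrite h1; congr (_ * cos _).
  by rewrite -cdot_mulmxr cdotBr; ring.
have := cos_unique (Z2 := id) mF (@measurable_id _ _ _) (bmf_cst 1) (bmf_cst 1) e (bmf_indic mD).
move=> h; transitivity (\int[nu1]_x (\1_D (F x) * cst 1 x)).
  apply: eq_Rintegral => x _; rewrite mulr1 !indicE.
  by have -> : (F x \in D) = (x \in F @^-1` D) by apply/idP/idP; rewrite !inE.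
by rewrite h; apply: eq_Rintegral => x _; rewrite mulr1.
Qed.

Let mpair : measurable_fun setT (fun z => (z, F z)).
Proof. exact: measurable_fun_pair. Qed.

(** The coupling is the law of (z, F z) under [nu1]. That F carries [nu1] to [nu2] is [FE]: the two
    laws have the same cosine integrals because of [hT]. *)
Lemma wasserstein_affine k : (wasserstein k nu1 nu2 <=
  poweR (\int[nu1]_z (enorm (z - F z) ^+ k)%:E) k%:R^-1)%E.
Proof.
pose X : {mfun 'cV[K]_n >-> ('cV[K]_n * 'cV[K]_n)%type} := mfun_Sub (mem_set mpair).
apply: ereal_inf_lbound; exists (distribution nu1 X : probability _ _).
  split=> D mD; rewrite /distribution /pushforward /=.
    by rewrite -comp_preimage.
  by rewrite -comp_preimage; exact: FE.
rewrite ge0_integral_distribution//.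
  apply/measurable_EFinP; apply: measurable_funX.
  have -> : (fun z : 'cV[K]_n * 'cV[K]_n => enorm (z.1 - z.2)) =
      (fun z => Num.sqrt (cdot (z.1 - z.2) (z.1 - z.2))).
    by apply/funext => z; rewrite enormE.
  apply: (measurableT_comp (continuous_measurable_fun (@sqrt_continuous K))).
  by apply: measurable_fun_cdot; apply: measurable_fun_mxB;
    [exact: measurable_fst|exact: measurable_snd|exact: measurable_fst|exact: measurable_snd].
by move=> y; rewrite lee_fin; apply: exprn_ge0; exact: enorm_ge0.
Qed.

End wasserstein_bounds.

Section gaussian_conditioning.
Context {K : realType} {n : nat}.

(** The Kalman update for one scalar observation with unit noise, in Sherman-Morrison form: it
    equals (P^-1 + l l')^-1 when P is invertible and makes sense for singular P. *)
Definition update_cov (P : 'M[K]_n) (l : 'cV[K]_n) : 'M[K]_n :=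
  P - (1 + quad P l)^-1 *: (P *m l *m (P *m l)^T).

Definition update_mean (m : 'cV[K]_n) (P : 'M[K]_n) (l : 'cV[K]_n) (a : K) : 'cV[K]_n :=
  m - ((cdot l m - a) / (1 + quad P l)) *: (P *m l).

Lemma quad_update (P : 'M[K]_n) l u :
  quad (update_cov P l) u = quad P u - cdot u (P *m l) ^+ 2 / (1 + quad P l).
Proof. by rewrite /update_cov quadB quadZ quad_outer [cdot _ u]cdotC mulrC. Qed.

(* Conditioning a Gaussian vector [X] on the noisy observation [a] of the
   linear form [cdot l X]; [E] carries variables that are observed later. *)
Lemma gaussian_update d (T : measurableType d) (mu : {finite_measure set T -> \bar K})
    (X : T -> 'cV[K]_n) (E w : T -> K) (C : K) (m : 'cV[K]_n) (P : 'M[K]_n) l a :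
  measurable_fun setT X -> measurable_fun setT E -> bmf w -> psdmx P ->
  (forall u b, \int[mu]_x (cos (cdot u (X x) + E x + b) * w x) =
    C * (expR (- quad P u / 2) * cos (cdot u m + b))) ->
  forall u b, \int[mu]_x (cos (cdot u (X x) + E x + b) *
      (expR (- (cdot l (X x) - a) ^+ 2 / 2) * w x)) =
    C * ((Num.sqrt (1 + quad P l))^-1 * expR (- (cdot l m - a) ^+ 2 / (1 + quad P l) / 2)) *
    (expR (- quad (update_cov P l) u / 2) * cos (cdot u (update_mean m P l a) + b)).
Proof.
move=> mX mE bw [Ps Pp] h u b.
have mlX v : measurable_fun setT (fun x => cdot v (X x)).
  by apply: measurable_fun_cdot => //; exact: measurable_cst.
have c0 : 0 <= quad P l by exact: Pp.
have c1 : 1 + quad P l != 0 by rewrite gt_eqF// ltr_wpDr.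
have := @gaussian_weight K _ T mu w (fun x => cdot l (X x) - a)
  (fun x => cdot u (X x) + E x) C (quad P u) (cdot u (P *m l)) (quad P l)
  (cdot u m) (cdot l m - a) bw _ _ c0 _ b.
move=> -> //; first last.
- move=> s phi.
  transitivity (\int[mu]_x (cos (cdot (u + s *: l) (X x) + E x + (phi - s * a)) * w x)).
    by apply: eq_Rintegral => x _; rewrite cdotDl cdotZl; congr (cos _ * _); ring.
  rewrite h quadcD// -scalemxAr cdotZr quadcZ cdotDl cdotZl mulrA.
  by congr (_ * expR _ * cos _); field.
- exact: measurable_funD.
- by apply: measurable_funB => //; exact: measurable_cst.
rewrite quad_update /update_mean cdotBr cdotZr.
rewrite -!mulrA; congr (_ * (_ * _)); rewrite !mulrA -expRD; congr (expR _ * cos _).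
  by field.
by field.
Qed.

Lemma rank_one_invmx (V : 'M[K]_n) l : posdefmx V ->
  posdefmx (V + l *m l^T) /\ invmx (V + l *m l^T) = update_cov (invmx V) l.
Proof.
move=> Vp; have Vu := posdef_unit Vp.
have psl : psdmx (l *m l^T).
  by split=> [|z]; rewrite ?trmx_mul ?trmxK// quad_outer sqr_ge0.
have Wp := posdefD Vp psl; split=> //.
have Wu := posdef_unit Wp.
have c1 : 1 + quad (invmx V) l != 0.
  by rewrite gt_eqF// ltr_wpDr// (posdef_psd (posdef_inv Vp)).2.
apply: (can_inj (mulKmx Wu)); rewrite mulmxV// /update_cov mulmxBr -scalemxAr !mulmxDl mulmxV//.
have sP := invmx_sym Vp.1.
rewrite trmx_mul sP.
have -> : V *m (invmx V *m l *m (l^T *m invmx V)) = l *m (l^T *m invmx V).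
  by rewrite -mulmxA mulKVmx.
have -> : l *m l^T *m (invmx V *m l *m (l^T *m invmx V)) =
    quad (invmx V) l *: (l *m (l^T *m invmx V)).
  rewrite -[l *m l^T *m _]mulmxA [l^T *m (_ *m _)]mulmxA [l^T *m (_ *m l)]mx11_scalar.
  by rewrite mul_scalar_mx -scalemxAr -/(cdot l (invmx V *m l)) -quadE.
set L := l *m (l^T *m _); have -> : L + quad (invmx V) l *: L = (1 + quad (invmx V) l) *: L.
  by rewrite scalerDl scale1r.
by rewrite scalerA mulVf// scale1r /L mulmxA addrK.
Qed.

(** Information parameters: V is the precision and h is V applied to the mean. Each quadratic weight
    adds a term to both, so the outcome does not depend on the order in which weights are
    applied. *)
Definition tilted (nu : probability 'cV[K]_n K) (w : 'cV[K]_n -> K) (V : 'M[K]_n)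
    (h : 'cV[K]_n) :=
  [/\ bmf w, posdefmx V & exists2 C, 0 < C & forall u b,
    \int[nu]_z (cos (cdot u z + b) * w z) =
    C * (expR (- quad (invmx V) u / 2) * cos (cdot u (invmx V *m h) + b))].

Lemma bmf_expN d (T : measurableType d) (q : T -> K) :
  measurable_fun setT q -> (forall x, 0 <= q x) -> bmf (fun x => expR (- q x)).
Proof.
move=> mq q0; split; first by apply: measurableT_comp => //; exact: measurableT_comp.
by exists 1 => x; rewrite ger0_norm ?expR_ge0// -expR0 ler_expR oppr_le0.
Qed.

Lemma tilted_step nu w V h l a : tilted nu w V h ->
  tilted nu (fun z => expR (- (cdot l z - a) ^+ 2 / 2) * w z) (V + l *m l^T) (h + a *: l).
Proof.
move=> [bw Vp [C C0 hC]]; have [Wp WE] := rank_one_invmx l Vp.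
have Vu := posdef_unit Vp.
have psdP := posdef_psd (posdef_inv Vp).
have c1 : 0 < 1 + quad (invmx V) l by rewrite ltr_wpDr// psdP.2.
have mq : measurable_fun setT (fun z : 'cV[K]_n => (cdot l z - a) ^+ 2 / 2).
  apply: measurable_funM; last exact: measurable_cst.
  apply: measurable_funX; apply: measurable_funB; last exact: measurable_cst.
  exact: measurable_cdotl.
split=> //.
  apply: bmfM => //.
  have := bmf_expN mq; under eq_fun do rewrite -mulNr; apply => z.
  by rewrite divr_ge0// sqr_ge0.
set m := invmx V *m h in hC.
exists (C * ((Num.sqrt (1 + quad (invmx V) l))^-1 *
    expR (- (cdot l m - a) ^+ 2 / (1 + quad (invmx V) l) / 2))).
  by rewrite mulr_gt0// mulr_gt0 ?invr_gt0 ?sqrtr_gt0// expR_gt0.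
move=> u b.
have hC' : forall u b, \int[nu]_z (cos (cdot u (id z) + cst 0 z + b) * w z) =
    C * (expR (- quad (invmx V) u / 2) * cos (cdot u m + b)).
  by move=> u' b'; under eq_Rintegral do rewrite addr0; exact: hC.
have := gaussian_update l a (@measurable_id _ _ _) (measurable_cst _) bw psdP hC' u b.
under eq_Rintegral do rewrite /= addr0.
move=> ->; rewrite WE; congr (_ * (_ * cos (cdot _ _ + _))).
rewrite /update_mean /update_cov mulmxBl mulmxDr -scalemxAr -/m -scalemxAl mulmxDr.
have tr v : (invmx V *m l *m (invmx V *m l)^T) *m v = cdot v (invmx V *m l) *: (invmx V *m l).
  rewrite -mulmxA [_^T *m v]mx11_scalar mul_mx_scalar.
  by rewrite -/(cdot (invmx V *m l) v) cdotC.
rewrite -scalemxAr !tr.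
have -> : cdot l (invmx V *m l) = quad (invmx V) l by rewrite quadE.
have -> : cdot h (invmx V *m l) = cdot l m.
  by rewrite /m cdot_mulmxr invmx_sym ?Vp.1// cdotC.
apply/colP => i; rewrite !mxE; field.
by rewrite gt_eqF.
Qed.

End gaussian_conditioning.

Section gaussian_entropy.
Context {K : realType} {n : nat}.
Implicit Types (nu : probability 'cV[K]_n.+1 K) (P V : 'M[K]_n.+1) (m h : 'cV[K]_n.+1).

Lemma tilted_seq nu w V h (s : seq ('cV[K]_n.+1 * K)) : tilted nu w V h ->
  tilted nu (fun z => expR (- (\sum_(p <- s) (cdot p.1 z - p.2) ^+ 2 / 2)) * w z)
    (V + \sum_(p <- s) p.1 *m p.1^T) (h + \sum_(p <- s) p.2 *: p.1).
Proof.
elim: s w V h => [|[l a] s IH] w V h hw.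
  rewrite !big_nil !addr0; move: hw; congr tilted; apply/funext => z.
  by rewrite big_nil oppr0 expR0 mul1r.
rewrite !big_cons !addrA; have := IH _ _ _ (tilted_step l a hw).
congr tilted; apply/funext => z; rewrite big_cons mulrA -expRD; congr (expR _ * _).
by rewrite /= mulNr opprD addrC.
Qed.

(** Writing V = N N' splits the quadratic weight into a product of rank-one weights, one for each
    column of N, to which [tilted_seq] applies. *)
Lemma tilted_quad nu m P V m' : posdefmx P -> cosdata nu m P -> posdefmx V ->
  tilted nu (fun z => expR (- (quad V (z - m') / 2)))
    (invmx P + V) (invmx P *m m + V *m m').
Proof.
move=> Pp hnu Vp; have Pu := posdef_unit Pp.
have t0 : tilted nu (cst 1) (invmx P) (invmx P *m m).
  split; [exact: bmf_cst|exact: posdef_inv|exists 1; first exact: ltr01].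
  move=> u b; rewrite invmxK mulKVmx// mul1r -hnu.
  by under eq_Rintegral do rewrite mulr1.
have [N [Np NN]] := psd_sqrt (posdef_psd Vp).
have NT : N *m N^T = V by rewrite Np.1.
have := tilted_seq [seq (col j N, cdot (col j N) m') | j <- index_enum 'I_n.+1] t0.
rewrite !big_map /= sum_col_outer NT.
have -> : \sum_j cdot (col j N) m' *: col j N = V *m m'.
  rewrite -NT -sum_col_outer mulmx_suml; apply: eq_bigr => j _.
  by rewrite -mulmxA [_^T *m m']mx11_scalar mul_mx_scalar.
congr tilted; apply/funext => z; rewrite mulr1; congr expR; congr (- _).
rewrite big_map /= -mulr_suml -NT -sum_col_sqr; congr (_ / _).
by apply: eq_bigr => j _; rewrite cdotBr.
Qed.

(** Tilting each law by the Gaussian exponent of the other produces the same information parameters,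
    with precision [V1 + V2]. This is the relation [q12] required by [relative_entropy_le], and no
    density or determinant is computed. The bound is the symmetrised divergence, so the covariances
    enter through their difference and that of their inverses. *)
Theorem gaussian_entropy nu1 nu2 m1 m2 P1 P2 : posdefmx P1 -> posdefmx P2 ->
  cosdata nu1 m1 P1 -> cosdata nu2 m2 P2 ->
  (relative_entropy nu1 nu2 <=
    (2^-1 * (mdot (invmx P2 - invmx P1) (P1 - P2) +
      quad (invmx P1 + invmx P2) (m1 - m2)))%:E)%E.
Proof.
move=> P1p P2p h1 h2; set V1 := invmx P1; set V2 := invmx P2.
have V1p : posdefmx V1 := posdef_inv P1p.
have V2p : posdefmx V2 := posdef_inv P2p.
pose q1 z := quad V2 (z - m2) / 2; pose q2 z := quad V1 (z - m1) / 2.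
have mq V m : measurable_fun setT (fun z : 'cV[K]_n.+1 => quad V (z - m) / 2).
  apply: measurable_funM; last exact: measurable_cst.
  by apply: measurable_fun_quad; apply: measurable_fun_mxB => //; exact: measurable_cst.
have q10 z : 0 <= q1 z by rewrite divr_ge0// (posdef_psd V2p).2.
have q20 z : 0 <= q2 z by rewrite divr_ge0// (posdef_psd V1p).2.
have [b1 _ [C1 C10 t1]] := tilted_quad m2 P1p h1 V2p.
have [b2 _ [C2 C20 t2]] := tilted_quad m1 P2p h2 V1p.
have q12 f : bmf f -> C2 * \int[nu1]_x (f x * expR (- q1 x)) =
    C1 * \int[nu2]_x (f x * expR (- q2 x)).
  move=> bf.
  have e u b : \int[nu1]_x (cos (cdot u (id x) + b) * (C2 * expR (- q1 x))) =
      \int[nu2]_x (cos (cdot u (id x) + b) * (C1 * expR (- q2 x))).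
    have bc : bmf (fun x : 'cV[K]_n.+1 => cos (cdot u x + b)).
      apply: bmf_cos; apply: measurable_funD; last exact: measurable_cst.
      exact: measurable_cdotl.
    under eq_Rintegral do rewrite mulrCA.
    rewrite int_bmfZ; last exact: bmfM.
    under [RHS]eq_Rintegral do rewrite mulrCA.
    rewrite int_bmfZ; last exact: bmfM.
    rewrite t1 t2 [in RHS](addrC (invmx P2)) [in RHS](addrC (invmx P2 *m _)).
    by rewrite mulrCA.
  have := cos_unique (@measurable_id _ _ _) (@measurable_id _ _ _)
    (bmfZ C2 b1) (bmfZ C1 b2) e bf.
  under eq_Rintegral do rewrite mulrCA.
  rewrite int_bmfZ; last exact: bmfM.
  move=> ->; under eq_Rintegral do rewrite mulrCA.
  by rewrite int_bmfZ//; exact: bmfM.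
have iq nu m P (Pp : posdefmx P) (hn : cosdata nu m P) :
    intv nu (fun x => q1 x - q2 x)
      (2^-1 * (mdot V2 P + quad V2 (m - m2)) - 2^-1 * (mdot V1 P + quad V1 (m - m1))).
  have := intvD (intvZ 2^-1 (intv_quad (posdef_psd Pp) hn V2 m2))
    (intvZ (- 2^-1) (intv_quad (posdef_psd Pp) hn V1 m1)).
  by rewrite mulNr; congr intv; apply/funext => x; rewrite mulNr /q1 /q2 ![_ / 2]mulrC.
have [i1 e1] := iq _ _ _ P1p h1; have [i2 e2] := iq _ _ _ P2p h2.
apply: le_trans (relative_entropy_le (mq V2 m2) (mq V1 m1) q20 C10 C20 q12 i1 i2) _.
rewrite e1 e2 lee_fin !subrr !quadc0.
have -> : quad V1 (m2 - m1) = quad V1 (m1 - m2).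
  by rewrite -(opprB m1) !quadE mulmxN cdotNl cdotNr opprK.
rewrite quadD !mdotBl !mdotBr; lra.
Qed.

End gaussian_entropy.

Lemma cdot_sqrD (K : realType) n (u v : 'cV[K]_n) :
  cdot (u + v) (u + v) = cdot u u + 2 * cdot u v + cdot v v.
Proof. by rewrite cdotDr !cdotDl [cdot v u]cdotC; ring. Qed.

Section gaussian_wasserstein.
Context {K : realType} {n : nat}.
Implicit Types (nu : probability 'cV[K]_n.+1 K) (P : 'M[K]_n.+1) (m : 'cV[K]_n.+1).

Lemma wasserstein_same_cov nu1 nu2 m1 m2 P k : (1 <= k)%N ->
  cosdata nu1 m1 P -> cosdata nu2 m2 P ->
  (wasserstein k nu1 nu2 <= (enorm (m1 - m2))%:E)%E.
Proof.
move=> k1 h1 h2; have hT : 1%:M *m P *m 1%:M^T = P by rewrite trmx1 mul1mx mulmx1.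
apply: le_trans (wasserstein_affine h1 h2 hT k) _.
have -> : (\int[nu1]_z (enorm (z - (m2 + 1%:M *m (z - m1))) ^+ k)%:E)%E =
    (enorm (m1 - m2) ^+ k)%:E.
  transitivity (\int[nu1]_z (cst (enorm (m1 - m2) ^+ k)%:E) z)%E.
    apply: eq_integral => z _; rewrite mul1mx; congr ((enorm _ ^+ _)%:E).
    by rewrite addrCA opprD addrA subrr add0r opprB.
  by rewrite integral_cst//= probability_setT mule1.
rewrite poweR_EFin lee_fin.
rewrite -powR_mulrn// -powRrM divff ?powRr1//.
by rewrite pnatr_eq0 -lt0n.
Qed.

(** With L = P1^{1/2} and N = (L^-1 P2 L^-1)^{1/2}, the map L N L^-1 carries covariance P1 to P2.
    Coercivity of P1 makes its distance to the identity linear in |P1 - P2|, whereas [P2] is allowed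
    to be singular. The factor n+1 comes from the entrywise trace bound [mdot_le]. *)
Lemma wasserstein2_le nu1 nu2 m1 m2 P1 P2 p e dl : psdmx P1 -> psdmx P2 ->
  ldb P1 e -> opb P1 p -> opb (P1 - P2) dl ->
  cosdata nu1 m1 P1 -> cosdata nu2 m2 P2 ->
  (wasserstein 2 nu1 nu2 <=
    (enorm (m1 - m2) + n.+1%:R * (p * (e^-1 * Num.sqrt e^-1) * dl))%:E)%E.
Proof.
move=> P1p P2p le op od h1 h2.
have [L [Lp LL]] := psd_sqrt P1p.
have P1u := ldb_unit le; have e0 : 0 < e by case: le.
have Lu : L \in unitmx by move: P1u; rewrite -LL unitmx_mul andbb.
have iP : invmx P1 = invmx L *m invmx L.
  apply: (can_inj (mulKmx P1u)); rewrite mulmxV// -LL mulmxA -(mulmxA L L) mulmxV// mulmx1.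
  by rewrite mulmxV.
have iLs := invmx_sym Lp.1.
have oL : opb L (Num.sqrt p).
  split=> [|z]; first exact: sqrtr_ge0.
  rewrite -ler_sqr ?nnegrE ?mulr_ge0 ?sqrtr_ge0// exprMn (sqr_sqrtr (opb_ge0 op)).
  rewrite !enorm_sqr cdot_mulmxl Lp.1 mulmxA LL -quadE.
  by apply: le_trans (ler_norm _) _; exact: quad_opb.
have oiL : opb (invmx L) (Num.sqrt e^-1).
  split=> [|z]; first exact: sqrtr_ge0.
  rewrite -ler_sqr ?nnegrE ?mulr_ge0 ?sqrtr_ge0// exprMn (@sqr_sqrtr _ e^-1) ?invr_ge0 ?(ltW e0)//.
  rewrite !enorm_sqr cdot_mulmxl iLs mulmxA -iP -quadE.
  by apply: le_trans (ler_norm _) _; apply: quad_opb; exact: ldb_inv.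
pose G := invmx L *m P2 *m (invmx L)^T.
have [N [Np NN]] := psd_sqrt (psd_conj (invmx L) P2p).
pose Tm := L *m N *m invmx L.
have hT : Tm *m P1 *m Tm^T = P2.
  rewrite /Tm !trmx_mul iLs Lp.1 Np.1 -LL !mulmxA.
  rewrite mulmxKV// mulmxK// -(mulmxA L N N) NN iLs !mulmxA mulmxV// mul1mx.
  by rewrite mulmxKV.
apply: le_trans (wasserstein_affine h1 h2 hT 2) _.
have oN : opb (1%:M - N) (e^-1 * dl).
  have lN : ldb (N + 1%:M) 1.
    split=> // z; rewrite quadD quad1 mul1r.
    by have := Np.2 z; lra.
  have Nu := ldb_unit lN.
  (* From 1 - N^2 = (1 - N)(1 + N) and 1 - N^2 = L^-1 (P1 - P2) L^-1; the inverse of 1 + N has norm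
     at most 1 since N is positive semi-definite. *)
  have -> : 1%:M - N = invmx L *m (P1 - P2) *m invmx L *m invmx (N + 1%:M).
    apply: (can_inj (mulmxK Nu)); rewrite mulmxKV// mulmxDr mulmx1 mulmxBl mul1mx NN.
    rewrite addrC addrA subrK mulmxBr mulmxBl -LL mulKmx// mulmxV// iLs.
    by [].
  have e2 : e^-1 = Num.sqrt e^-1 * Num.sqrt e^-1 by rewrite -expr2 sqr_sqrtr// invr_ge0 ltW.
  have := opbM (opbM (opbM oiL od) oiL) (ldb_inv lN).
  by rewrite invr1 mulr1 mulrAC -e2.
pose b := Num.sqrt p * (e^-1 * dl) * Num.sqrt e^-1.
have oT : opb (1%:M - Tm) b.
  have -> : 1%:M - Tm = L *m (1%:M - N) *m invmx L.
    by rewrite mulmxBr mulmx1 mulmxBl mulmxV.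
  exact: opbM (opbM oL oN) oiL.
pose D := 1%:M - Tm; set dm := m1 - m2.
have b0 : 0 <= b := opb_ge0 oT; have p0 : 0 <= p := opb_ge0 op.
have iv : intv nu1 (fun z => enorm (z - (m2 + Tm *m (z - m1))) ^+ 2)
    (cdot dm dm + mdot (D^T *m D) P1).
  have := intvD (intvD (intv_cst nu1 (cdot dm dm)) (intvZ 2 (intv_cdot h1 (D^T *m dm))))
    (intv_quad P1p h1 (D^T *m D) m1).
  rewrite subrr quadc0 mulr0 !addr0; congr intv; apply/funext => z.
  rewrite enorm_sqr; have -> : z - (m2 + Tm *m (z - m1)) = dm + D *m (z - m1).
    rewrite /D /dm mulmxBl mul1mx; apply/colP => i; rewrite !mxE; ring.
  set y := z - m1.
  by rewrite cdot_sqrD quadE -mulmxA [cdot (D *m y) _]cdot_mulmxl [cdot dm (D *m y)]cdot_mulmxr.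
rewrite (intv_EFin iv) poweR_EFin lee_fin.
have cm : mdot (D^T *m D) P1 <= (n.+1%:R * (b * Num.sqrt p)) ^+ 2.
  apply: le_trans (ler_norm _) _; apply: le_trans (mdot_le (opbM (opb_tr oT) oT) op) _.
  suff -> : (n.+1%:R * (b * Num.sqrt p)) ^+ 2 = n.+1%:R ^+ 2 * (b * b * p) by [].
  by rewrite 2!exprMn sqr_sqrtr// -expr2.
have cE : n.+1%:R * (b * Num.sqrt p) = n.+1%:R * (p * (e^-1 * Num.sqrt e^-1) * dl).
  congr (_ * _); rewrite /b -[in RHS](sqr_sqrtr p0); ring.
rewrite cE in cm; set c := n.+1%:R * _ in cm *.
have c0 : 0 <= c by rewrite /c -cE; apply: mulr_ge0 => //; apply: mulr_ge0 => //; exact: sqrtr_ge0.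
have s0 : 0 <= enorm dm + c by apply: addr_ge0 => //; exact: enorm_ge0.
set x := cdot dm dm + _; have x0 : 0 <= x.
  by rewrite /x; have [_ <-] := iv; apply: Rintegral_ge0 => z _; rewrite sqr_ge0.
have xs : x <= (enorm dm + c) ^+ 2.
  rewrite /x -enorm_sqr sqrrD; have := mulr_ge0 (enorm_ge0 dm) c0; lra.
rewrite powR12_sqrt// -[leRHS]ger0_norm// -sqrtr_sqr.
by rewrite ler_sqrt// sqr_ge0.
Qed.

End gaussian_wasserstein.

(** * Entrywise calculus and the matrix exponential *)

Section matrix_limits.
Context {K : realType}.

Lemma cvg_mx (T : Type) (F : set_system T) {FF : Filter F} m n (f : T -> 'M[K]_(m, n)) (l : 'M[K]_(m, n)) :
  (forall i j, (fun t => f t i j) @ F --> l i j) -> f @ F --> l.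
Proof.
move=> h; apply/cvg_ballP => e e0.
have : \forall t \near F, forall i, forall j, ball (l i j) e (f t i j).
  apply: filter_forall => i; apply: filter_forall => j.
  by have /cvg_ballP/(_ e e0) := h i j.
by apply: filterS => t ht; split.
Qed.

Lemma cvg_mx_coord (T : Type) (F : set_system T) {FF : Filter F} m n (f : T -> 'M[K]_(m, n)) (l : 'M[K]_(m, n)) i j :
  f @ F --> l -> (fun t => f t i j) @ F --> l i j.
Proof.
move=> h.
exact: (@continuous_cvg _ _ _ F FF f (fun M : 'M[K]_(m, n) => M i j) l (@coord_continuous K m n i j l) h).
Qed.

Lemma cvg_eqfun1 (T : Type) (F : set_system T) (f g : T -> K) (l : K) :
  f @ F --> l -> f =1 g -> g @ F --> l.
Proof. by move=> h /funext <-. Qed.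

Lemma cvg_bigsum (T : Type) (F : set_system T) {FF : Filter F} n (f : 'I_n -> T -> K) (l : 'I_n -> K) :
  (forall i, f i @ F --> l i) -> (fun t => \sum_i f i t) @ F --> \sum_i l i.
Proof.
elim: n f l => [|n IH] f l h.
  rewrite big_ord0 (_ : (fun t => _) = cst 0); first exact: cvg_cst.
  by apply/funext => t; rewrite big_ord0.
rewrite big_ord_recl (_ : (fun t => _) = (fun t => f ord0 t + \sum_i f (lift ord0 i) t)).
  by apply: cvgD; [exact: h|exact: IH].
by apply/funext => t; rewrite big_ord_recl.
Qed.

Lemma cvg_mulmx (T : Type) (F : set_system T) {FF : Filter F} m n p
    (f : T -> 'M[K]_(m, n)) (g : T -> 'M[K]_(n, p)) (a : 'M[K]_(m, n)) (b : 'M[K]_(n, p)) :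
  f @ F --> a -> g @ F --> b -> (fun t => f t *m g t) @ F --> a *m b.
Proof.
move=> fa gb; apply: cvg_mx => i j; rewrite mxE.
under eq_fun do rewrite mxE.
by apply: cvg_bigsum => k; apply: cvgM; exact: cvg_mx_coord.
Qed.

End matrix_limits.

Section matrix_derivatives.
Context {K : realType}.

Definition misd {m n} (F : K -> 'M[K]_(m, n)) (x : K) (D : 'M[K]_(m, n)) :=
  forall i j, isd (fun t => F t i j) x (D i j).

Lemma misd_eq m n (F : K -> 'M[K]_(m, n)) x D D' : misd F x D -> D = D' -> misd F x D'.
Proof. by move=> h <-. Qed.

Lemma misd_cst m n (M : 'M[K]_(m, n)) x : misd (fun=> M) x 0.
Proof. by move=> i j; rewrite mxE; exact: isd_cst. Qed.

Lemma misdD m n (F G : K -> 'M[K]_(m, n)) x D E : misd F x D -> misd G x E ->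
  misd (fun t => F t + G t) x (D + E).
Proof.
move=> hF hG i j; rewrite mxE; have := isdD (hF i j) (hG i j).
by congr isd; apply/funext => t; rewrite mxE.
Qed.

Lemma misdN m n (F : K -> 'M[K]_(m, n)) x D : misd F x D ->
  misd (fun t => - F t) x (- D).
Proof.
move=> hF i j; rewrite mxE; have := isdN (hF i j).
by congr isd; apply/funext => t; rewrite mxE.
Qed.

Lemma misdB m n (F G : K -> 'M[K]_(m, n)) x D E : misd F x D -> misd G x E ->
  misd (fun t => F t - G t) x (D - E).
Proof. by move=> hF hG; apply: misdD => //; exact: misdN. Qed.

Lemma misdM m n p (F : K -> 'M[K]_(m, n)) (G : K -> 'M[K]_(n, p)) x D E :
  misd F x D -> misd G x E ->
  misd (fun t => F t *m G t) x (D *m G x + F x *m E).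
Proof.
move=> hF hG i j.
have := isd_sum (fun k => isdM (hF i k) (hG k j)).
rewrite big_split /= !mxE => h; apply: isd_eq.
  by move: h; congr isd; apply/funext => t; rewrite mxE.
by [].
Qed.

Lemma misdMl m n p (M : 'M[K]_(m, n)) (G : K -> 'M[K]_(n, p)) x E :
  misd G x E -> misd (fun t => M *m G t) x (M *m E).
Proof.
by move=> h; apply: (misd_eq (misdM (misd_cst M x) h)); rewrite mul0mx add0r.
Qed.

Lemma misdMr m n p (M : 'M[K]_(n, p)) (G : K -> 'M[K]_(m, n)) x E :
  misd G x E -> misd (fun t => G t *m M) x (E *m M).
Proof.
by move=> h; apply: (misd_eq (misdM h (misd_cst M x))); rewrite mulmx0 addr0.
Qed.

Lemma misd_tr m n (F : K -> 'M[K]_(m, n)) x D : misd F x D -> misd (fun t => (F t)^T) x D^T.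
Proof.
move=> h i j; rewrite mxE; have := h j i; congr isd.
by apply/funext => t; rewrite mxE.
Qed.

Lemma misd_cst_eq m n (F : K -> 'M[K]_(m, n)) : (forall x, misd F x 0) ->
  forall x y, F x = F y.
Proof.
move=> h x y; apply/matrixP => i j; apply: (@isd_cst_eq K (fun t => F t i j)).
by move=> z; have := h z i j; rewrite mxE.
Qed.

Lemma misd_comp m n (F : K -> 'M[K]_(m, n)) (g : K -> K) x D a :
  misd F (g x) D -> isd g x a -> misd (fun t => F (g t)) x (a *: D).
Proof.
move=> hF hg i j; rewrite mxE mulrC.
exact: (isd_comp (hF i j) hg).
Qed.

Lemma misd_quad n (F : K -> 'M[K]_n) x D z : misd F x D ->
  isd (fun t => quad (F t) z) x (quad D z).
Proof.
move=> h; have h1 := misdMr z (misdMl z^T h).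
have := h1 0 0; by [].
Qed.

Lemma misd_continuous m n (F : K -> 'M[K]_(m, n)) x D : misd F x D -> {for x, continuous F}.
Proof. by move=> h; apply: cvg_mx => i j; exact: isd_continuous (h i j). Qed.

End matrix_derivatives.

Section matrix_exponential.
Context {K : realType} {n : nat}.
Implicit Types (M N : 'M[K]_n.+1).

(** Power series coefficients in t of an entry of N e^{tM}. The left factor N closes the family
    under differentiation, which replaces N by NM, so each entry is handled as a scalar power
    series. *)
Let expc N M i j (k : nat) : K := k`!%:R^-1 * (N *m M ^+ k) i j.

Lemma opbX M a k : opb M a -> opb (M ^+ k) (a ^+ k).
Proof.
move=> h; elim: k => [|k IH]; last by rewrite !exprS; exact: opbM.
by rewrite !expr0; split=> [|z]; rewrite ?ler01// mul1mx mul1r.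
Qed.

Let expc_cvg N M i j t : cvgn (pseries (expc N M i j) t).
Proof.
apply: normed_cvg.
have oM := opb_frob M; have oN := opb_frob N.
have f0 := opb_ge0 oM; have g0 := opb_ge0 oN.
apply: (@series_le_cvg _ _ (fun k => frob N * exp_coeff (frob M * `|t|) k)).
- by move=> k /=.
- by move=> k; rewrite mulr_ge0// exp_coeff_ge0// mulr_ge0.
- move=> k; rewrite /= /exp_coeff /expc /= !normrM normrX exprMn.
  rewrite (ger0_norm (_ : 0 <= k`!%:R^-1)) ?invr_ge0//.
  have := opb_coord i j (opbM oN (opbX k oM)) => h.
  have tk : 0 <= `|t| ^+ k by rewrite exprn_ge0.
  have fk : 0 <= k`!%:R^-1 :> K by rewrite invr_ge0.
  rewrite (_ : frob N * _ = k`!%:R^-1 * (frob N * frob M ^+ k) * `|t| ^+ k); last by ring.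
  by rewrite ler_wpM2r// ler_wpM2l.
- have -> : (fun k => frob N * exp_coeff (frob M * `|t|) k) =
    (frob N \*: exp_coeff (frob M * `|t|)) by apply/funext.
  by apply: is_cvg_seriesZ; exact: is_cvg_series_exp_coeff.
Qed.

Let expc_diffs N M i j : pseries_diffs (expc N M i j) = expc (N *m M) M i j.
Proof.
apply/funext => k; rewrite /pseries_diffs /expc mulrA.
congr (_ * _); last by rewrite exprS mulmxA.
by rewrite factS natrM invfM mulrA divff ?mul1r.
Qed.

Let expE N M t i j := limn (pseries (expc N M i j) t).

Let expE_isd N M i j t : isd (fun t => expE N M t i j) t (expE (N *m M) M t i j).
Proof.
have := @pseries_snd_diffs K (expc N M i j) (`|t| + 1) t.
rewrite !expc_diffs; apply => //.
by rewrite [ltRHS]ger0_norm ?addr_ge0// ltrDl.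
Qed.

Lemma expmx_series N M t i j :
  pseries (expc N M i j) t @ \oo --> (N *m expmx (t *: M)) i j.
Proof.
have c1 i' j' : pseries (expc 1%:M M i' j') t @ \oo --> expE 1%:M M t i' j'.
  exact: expc_cvg.
have e : expmx (t *: M) = \matrix_(i, j) expE 1%:M M t i j.
  apply: cvg_lim => //; apply: cvg_mx => i' j'; rewrite mxE.
  apply: (cvg_eqfun1 (c1 i' j')) => k.
  rewrite /pseries /series /= summxE; apply: eq_bigr => l _.
  rewrite /expc mul1mx exprZn mxE mxE; ring.
rewrite e mxE.
under eq_bigr do rewrite mxE.
have h := cvg_bigsum (fun l => cvgM (cvg_cst (N i l)) (c1 l j)).
apply: (cvg_eqfun1 (h _ _ _)) => k /=.
rewrite /pseries /series /=.
under eq_bigr do rewrite mulr_sumr.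
rewrite exchange_big /=; apply: eq_bigr => l _.
rewrite /expc mxE mulr_sumr mulr_suml; apply: eq_bigr => p _.
by rewrite mul1mx; ring.
Qed.

Lemma expmx_misd M t : misd (fun t => expmx (t *: M)) t (M *m expmx (t *: M)).
Proof.
move=> i j.
have e N s : expE N M s i j = (N *m expmx (s *: M)) i j.
  by apply: cvg_lim => //; exact: expmx_series.
have := @expE_isd 1%:M M i j t; rewrite mul1mx e; congr isd.
by apply/funext => s; rewrite e mul1mx.
Qed.

Lemma expmx0 M : expmx (0 *: M) = 1%:M.
Proof.
apply/matrixP => i j; have h := @expmx_series 1%:M M 0 i j.
rewrite mul1mx in h; apply: (cvg_unique _ h) => //.
apply: cvg_near_cst; near=> k0.
have [k ->] : exists k, k0 = k.+1 by exists k0.-1; rewrite prednK//; near: k0; exact: nbhs_infty_gt.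
rewrite /pseries /series /= big_nat_recl// big1_seq ?addr0.
  by rewrite /expc fact0 invr1 mul1r mul1mx expr0 mulr1.
by move=> l _; rewrite expr0n mulr0.
Unshelve. all: by end_near. Qed.

Lemma expmx_comm M t : M *m expmx (t *: M) = expmx (t *: M) *m M.
Proof.
apply/matrixP => i j; have h1 := @expmx_series M M t i j.
have h2 l : pseries (expc 1%:M M i l) t @ \oo --> expmx (t *: M) i l.
  by have := @expmx_series 1%:M M t i l; rewrite mul1mx.
have h := cvg_bigsum (fun l => cvgM (h2 l) (cvg_cst (M l j))).
apply: (cvg_unique _ h1) => //; rewrite mxE.
apply: (cvg_eqfun1 (h _ _ _)) => k /=.
rewrite /pseries /series /=.
under eq_bigr do rewrite mulr_suml.
rewrite exchange_big /=; apply: eq_bigr => l _.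
rewrite /expc (_ : M *m M ^+ l = M ^+ l *m M); last first.
  by rewrite -[LHS](exprS M l) exprSr.
rewrite [in RHS]mxE mulr_sumr mulr_suml; apply: eq_bigr => p _.
by rewrite mul1mx; ring.
Qed.

(** The product has derivative zero, since M commutes with its exponential. Applied to the
    exponential itself, this provides its inverse. *)
Lemma expmx_linear_ode p M (F : K -> 'M[K]_(n.+1, p)) :
  (forall t, misd F t (M *m F t)) -> forall t, expmx ((- t) *: M) *m F t = F 0.
Proof.
move=> hF t.
have := @misd_cst_eq K _ _ (fun t => expmx ((- t) *: M) *m F t) _ t 0.
rewrite oppr0 expmx0 mul1mx; apply => x.
have dN : isd (fun t : K => - t) x (-1) by apply: isdN; exact: isd_id.
have d1 := misd_comp (@expmx_misd M (- x)) dN.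
apply: (misd_eq (misdM d1 (hF x))).
by rewrite scaleN1r mulNmx expmx_comm !mulmxA addNr.
Qed.

Lemma expmxVl M t : expmx ((- t) *: M) *m expmx (t *: M) = 1%:M.
Proof. by rewrite (expmx_linear_ode (expmx_misd M)) expmx0. Qed.

Lemma expmxVr M t : expmx (t *: M) *m expmx ((- t) *: M) = 1%:M.
Proof. by have := expmxVl M (- t); rewrite opprK. Qed.

Lemma expmx_misdr M t : misd (fun t => expmx (t *: M)) t (expmx (t *: M) *m M).
Proof. by rewrite -expmx_comm; exact: expmx_misd. Qed.

End matrix_exponential.

(** * Lyapunov equations, gramians and the rank condition *)

Section lyapunov.
Context {K : realType} {n : nat}.
Implicit Types (M X W : 'M[K]_n.+1).

Lemma le_expR_decay (x c b : K) : 0 < b -> 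
  (forall t : K, 0 <= t -> x <= c * expR (- b * t)) -> x <= 0.
Proof.
move=> b0 h; rewrite leNgt; apply/negP => x0.
have c0 : 0 < c by have := h 0 (lexx _); rewrite mulr0 expR0; lra.
(* At this time x e^{bt} >= x (1 + c/x) = x + c > c, a contradiction obtained without passing to a
   limit. *)
have t0 : 0 <= c / (b * x) by rewrite divr_ge0 ?mulr_ge0 ?ltW.
have := h _ t0; rewrite mulNr expRN ler_pdivlMr ?expR_gt0//.
have e : b * (c / (b * x)) = c / x by field; rewrite !gt_eqF.
rewrite e; apply/negP; rewrite -ltNge.
rewrite (@lt_le_trans _ _ (x * (1 + c / x)))//; last first.
  by apply: ler_wpM2l; [exact: ltW|exact: expR_ge1Dx].
by rewrite mulrDr mulr1 mulrCA divff ?mulr1 ?gt_eqF// ltrDr.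
Qed.

Definition decays M (a b : K) :=
  [/\ 0 < a, 0 < b & forall t : K, 0 <= t -> opb (expmx (t *: M)) (a * expR (- b * t))].

(** If XM + M'X = -W, this is the gramian, the integral of e^{sM'} W e^{sM} over [0, t], written
    without an integral. Negative times are used too. *)
Definition lyap_gap M X (t : K) := X - (expmx (t *: M))^T *m X *m expmx (t *: M).

Lemma lyap_gap_misd M X W t : X *m M + M^T *m X = - W ->
  misd (lyap_gap M X) t ((expmx (t *: M))^T *m W *m expmx (t *: M)).
Proof.
move=> h; apply: (misd_eq (misdB (misd_cst X t)
  (misdM (misdMr X (misd_tr (@expmx_misd K n M t))) (@expmx_misd K n M t)))).
rewrite sub0r trmx_mul -!mulmxA -mulmxDr -[W]opprK -h mulNmx mulmxN; congr (- (_ *m _)).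
by rewrite mulmxDl !mulmxA addrC.
Qed.

Lemma quad_expmx M W t z :
  quad ((expmx (t *: M))^T *m W *m expmx (t *: M)) z = quad W (expmx (t *: M) *m z).
Proof. by have := quad_conj W (expmx (t *: M))^T z; rewrite trmxK. Qed.

Lemma lyap_gap_isd M X W t z : X *m M + M^T *m X = - W ->
  isd (fun t => quad (lyap_gap M X t) z) t (quad W (expmx (t *: M) *m z)).
Proof. by move=> /lyap_gap_misd h; rewrite -quad_expmx; exact: misd_quad. Qed.

Lemma lyap_gap_mono M X W z s t : psdmx W -> X *m M + M^T *m X = - W -> s <= t ->
  quad (lyap_gap M X s) z <= quad (lyap_gap M X t) z.
Proof.
move=> Wp h st; have [c _ e] := isd_mvt st (fun u _ => lyap_gap_isd u z h).
by rewrite -subr_ge0 e mulr_ge0 ?subr_ge0// Wp.2.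
Qed.

Lemma lyap_gap0 M X : lyap_gap M X 0 = 0.
Proof. by rewrite /lyap_gap expmx0 trmx1 mul1mx mulmx1 subrr. Qed.

Lemma lyap_gap_sym M X t : X^T = X -> (lyap_gap M X t)^T = lyap_gap M X t.
Proof. by move=> h; rewrite /lyap_gap linearB /= !trmx_mul trmxK h mulmxA. Qed.

Lemma isd_near0 (f : K -> K) x a e : 0 < e -> isd f x a ->
  (forall y, x - e < y < x + e -> f y = 0) -> a = 0.
Proof.
move=> e0 h f0; have h0 : is_derive x (1 : K) (cst 0 : K -> K) a.
  apply: near_eq_is_derive h; exists e => //= y /=.
  by rewrite ltr_distlC => /f0.
by have <- := @derive_val _ _ _ _ _ _ _ h0; rewrite derive_cst.
Qed.

(** If the form vanishes at z at time 1, by monotonicity it vanishes on all of [0, 1], so its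
    derivative does and W e^{sM} z = 0 there. Repeated differentiation gives W M^k e^{sM} z = 0 for
    every k, and the observability hypothesis forces e^{sM} z = 0. *)
Lemma lyap_gap_posdef M X W : psdmx W -> X^T = X -> X *m M + M^T *m X = - W ->
  (forall w : 'cV[K]_n.+1, (forall k : nat, W *m M ^+ k *m w = 0) -> w = 0) ->
  posdefmx (lyap_gap M X 1).
Proof.
move=> Wp Xs h obs; split=> [|z z0]; first exact: lyap_gap_sym.
have mono s t : s <= t -> _ := lyap_gap_mono z Wp h.
have := mono 0 1 ler01; rewrite {1}lyap_gap0 quadE mul0mx cdot0r le_eqVlt => /orP[/eqP q0|//].
exfalso; move/eqP: z0; apply.
have flat s : 0 <= s <= 1 -> quad (lyap_gap M X s) z = 0.
  move=> /andP[s0 s1]; apply/eqP; rewrite eq_le {1}q0 mono//=.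
  by have := mono _ _ s0; rewrite lyap_gap0 quadE mul0mx cdot0r.
have near0 (f : K -> K) s a : 0 < s < 1 -> isd f s a ->
    (forall y, 0 < y < 1 -> f y = 0) -> a = 0.
  move=> /andP[s0 s1] hf f0; apply: (@isd_near0 f s a (Num.min s (1 - s))) => //.
    by rewrite lt_min s0 subr_gt0.
  move=> y /andP[y1 y2]; apply: f0.
  have m1 : Num.min s (1 - s) <= s by rewrite ge_min lexx.
  have m2 : Num.min s (1 - s) <= 1 - s by rewrite ge_min lexx orbT.
  by apply/andP; split; lra.
have W0 s : 0 < s < 1 -> W *m expmx (s *: M) *m z = 0.
  move=> s01; rewrite -mulmxA; apply: psd_ker => //.
  apply: (near0 _ _ _ s01 (lyap_gap_isd s z h)).
  by move=> y /andP[? ?]; apply: flat; apply/andP; split; exact: ltW.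
have Wk k : forall s, 0 < s < 1 -> W *m M ^+ k *m expmx (s *: M) *m z = 0.
  elim: k => [s s01|k IH s s01]; first by rewrite expr0 mulmx1 W0.
  apply/matrixP => i j; rewrite [RHS]mxE.
  have := misdMr z (misdMl (W *m M ^+ k) (@expmx_misd K n M s)).
  rewrite exprSr !mulmxA => /(_ i j) hd; apply: (near0 _ _ _ s01 hd).
  by move=> y y01; rewrite IH ?mxE.
(* Observability is applied to e^{M/2} z: the identities hold only inside ]0, 1[, where two-sided
   derivatives are available. *)
have h2 : (0 < 2^-1 :> K) && (2^-1 < 1 :> K) by apply/andP; split; lra.
rewrite -[z]mul1mx -(expmxVl M 2^-1) -mulmxA (obs (expmx (2^-1 *: M) *m z)) ?mulmx0//.
by move=> k; rewrite mulmxA Wk.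
Qed.

Lemma decays_sandwich M a b X t : decays M a b -> 0 <= t ->
  opb ((expmx (t *: M))^T *m X *m expmx (t *: M)) (a ^+ 2 * frob X * expR (- (2 * b) * t)).
Proof.
move=> [a0 b0 h] t0; have := opbM (opbM (opb_tr (h t t0)) (opb_frob X)) (h t t0).
rewrite (_ : - (2 * b) * t = - b * t + - b * t); last by ring.
by rewrite expRD; congr opb; ring.
Qed.

(** Monotonicity replaces t by arbitrarily large times, at which the gap differs from X by an
    exponentially small term; this also covers negative t. *)
Lemma lyap_le M X W a b z t : psdmx W -> decays M a b ->
  X *m M + M^T *m X = - W -> quad (lyap_gap M X t) z <= quad X z.
Proof.
move=> Wp dec h; rewrite -subr_le0.
have b20 : 0 < 2 * b by case: dec => *; rewrite mulr_gt0.
set c := a ^+ 2 * frob X * cdot z z.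
apply: (@le_expR_decay _ (c * expR (2 * b * `|t|)) (2 * b)) => // s s0.
rewrite -mulrA -expRD.
apply: (@le_trans _ _ (quad (lyap_gap M X (s + `|t|)) z - quad X z)).
  rewrite lerD2r; apply: (lyap_gap_mono z Wp h).
  by rewrite (le_trans (ler_norm t))// lerDr.
rewrite /lyap_gap quadB addrAC subrr sub0r (le_trans (ler_norm _))// normrN.
apply: (@le_trans _ _ (c * expR (- (2 * b) * (s + `|t|)))).
  by rewrite /c mulrAC; apply: quad_opb; apply: decays_sandwich => //; rewrite addr_ge0.
apply: ler_wpM2l; first exact: mulr_ge0 (mulr_ge0 (sqr_ge0 _) (frob_ge0 _)) (cdot_ge0 _).
have t0 := normr_ge0 t; rewrite ler_expR.
rewrite -subr_ge0 (_ : _ - _ = 2 * (2 * b * `|t|)); last by ring.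
apply: mulr_ge0 => //; apply: mulr_ge0 => //; exact: ltW.
Qed.

Lemma lyap_inj M a b X : decays M a b -> X *m M + M^T *m X = 0 -> X = 0.
Proof.
move=> dec h.
have b20 : 0 < 2 * b by case: dec => *; rewrite mulr_gt0.
have h0 : X *m M + M^T *m X = - 0 by rewrite oppr0.
have c t : lyap_gap M X t = 0.
  rewrite -(lyap_gap0 M X); apply: misd_cst_eq => s.
  by apply: (misd_eq (lyap_gap_misd s h0)); rewrite mulmx0 mul0mx.
apply/matrixP => i j; rewrite mxE; apply/eqP; rewrite -normr_le0.
apply: (@le_expR_decay _ (a ^+ 2 * frob X) (2 * b)) => // t t0.
have := c t; rewrite /lyap_gap => /eqP; rewrite subr_eq0 => /eqP XE.
by rewrite {1}XE; apply: opb_coord; exact: decays_sandwich.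
Qed.

(** The Lyapunov operator is injective by [lyap_inj], hence bijective in finite dimension, so no
    improper integral is formed. Symmetry of the solution follows from injectivity applied to X' -
    X. *)
Lemma lyap_ex M a b W : decays M a b -> W^T = W ->
  exists X, X^T = X /\ X *m M + M^T *m X = - W.
Proof.
move=> dec Ws.
pose L X := X *m M + M^T *m X.
have Llin : linear L.
  by move=> c X Y; rewrite /L mulmxDl mulmxDr -scalemxAl -scalemxAr scalerDr addrACA.
pose LL : {linear _ -> _} := HB.pack L (GRing.isLinear.Build _ _ _ _ L Llin).
have free : row_free (lin_mx LL).
  rewrite -kermx_eq0; apply/eqP/row_matrixP => i; rewrite row0.
  set v := row i _; have vL : v *m lin_mx LL = 0.
    by apply/eqP; rewrite -sub_kermx row_sub.
  have := vL; rewrite -[v]vec_mxK mul_vec_lin => /(congr1 vec_mx).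
  by rewrite mxvecK linear0 => /(lyap_inj dec) ->; rewrite linear0.
have [X XE] : exists X, L X = - W.
  exists (vec_mx (mxvec (- W) *m invmx (lin_mx LL))).
  apply: (can_inj mxvecK); rewrite -(mul_vec_lin LL) vec_mxK mulmxKV//.
  by rewrite -row_free_unit.
exists X; split=> //; apply/eqP; rewrite -subr_eq0; apply/eqP/(lyap_inj dec).
have := congr1 trmx XE; rewrite /L linearD /= !trmx_mul trmxK linearN /= Ws -XE /L => XE'.
rewrite mulmxBl mulmxBr -[X in X = _]/(X^T *m M - _ + _) addrACA -opprD.
by rewrite [X^T *m M + _]addrC XE' subrr.
Qed.

End lyapunov.

Section rank.
Context {K : realType} {n : nat}.
Implicit Types (A R S M N T W : 'M[K]_n.+1).

Lemma sqrtmxP M : psdmx M -> psdmx (sqrtmx M) /\ sqrtmx M *m sqrtmx M = M.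
Proof. by move=> /psd_sqrt[N hN]; exact: (getPex (P := [set N | _]) (ex_intro _ N hN)). Qed.

Lemma trmx_expr M k : (M ^+ k)^T = M^T ^+ k.
Proof.
elim: k => [|k IH]; first by rewrite !expr0 trmx1.
by rewrite exprS exprSr -IH -[M * _]/(M *m _) trmx_mul.
Qed.

(** Full row rank of the block row means that only 0 annihilates all blocks A^k R^{1/2} from the
    left; R and its square root have the same kernel. *)
Lemma rank_observable A R (w : 'cV[K]_n.+1) : psdmx R ->
  \rank (\mxrow_(k < n.+1) (A ^+ k *m sqrtmx R)) = n.+1 ->
  (forall k : nat, R *m A^T ^+ k *m w = 0) -> w = 0.
Proof.
move=> Rp rk h; have [[Ns Np] NN] := sqrtmxP Rp.
have N0 (k : nat) : w^T *m (A ^+ k *m sqrtmx R) = 0.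
  apply: trmx_inj; rewrite !trmx_mul trmxK Ns trmx0 trmx_expr.
  rewrite -mulmxA; apply: cdot_eq0.
  by rewrite cdot_mulmxl Ns (mulmxA (sqrtmx R) (sqrtmx R)) NN mulmxA h cdot0r.
have free : row_free (\mxrow_(k < n.+1) (A ^+ k *m sqrtmx R)) by rewrite /row_free rk.
apply: trmx_inj; rewrite trmx0; apply: (row_free_inj free).
rewrite mul0mx mul_mxrow; apply/eqP; rewrite -mxrow0; apply/eqP/eq_mxrow => k.
exact: N0.
Qed.

(** Output injection preserves the unobservable subspace: along a trajectory annihilated by W the
    extra term T W contributes nothing. It passes from the closed loop back to A. *)
Lemma kernel_shift N T W (w : 'cV[K]_n.+1) :
  (forall k : nat, W *m (N + T *m W) ^+ k *m w = 0) ->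
  forall k : nat, W *m N ^+ k *m w = 0.
Proof.
move=> h; suff e (k : nat) : (N + T *m W) ^+ k *m w = N ^+ k *m w.
  by move=> k; rewrite -mulmxA -e mulmxA.
elim: k => [|k IH]; first by rewrite !expr0.
rewrite !exprS -[_ * _ ^+ k]/(_ *m _ ^+ k) -mulmxA mulmxDl IH.
rewrite -[T *m W *m _]mulmxA -IH (mulmxA W) h mulmx0 addr0.
by rewrite -[N * _]/(N *m _) IH mulmxA.
Qed.

End rank.

(** * Explicit Riccati flow with bounds uniform in the initial covariance *)

Section riccati_flow.
Context {K : realType} {n : nat}.
Variables (A R S Pinf G : 'M[K]_n.+1) (a b : K).
Hypotheses (Rp : psdmx R) (Sp : psdmx S) (rk : rank_condition A R S).
Hypotheses (Pp : posdefmx Pinf) (ric : riccati A R S Pinf = 0).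

Definition closed_loop := A - Pinf *m S.
Let M := closed_loop.
Let Y := invmx Pinf.
Hypotheses (dec : decays M a b).
Hypotheses (Gs : G^T = G) (GL : G *m M + M^T *m G = - S).

Let Pu : Pinf \in unitmx. Proof. exact: posdef_unit. Qed.
Let Yp : posdefmx Y. Proof. exact: posdef_inv. Qed.
Let Ys : Y^T = Y. Proof. by case: Yp. Qed.
Let Ps : Pinf^T = Pinf. Proof. by case: Pp. Qed.
Let Ss : S^T = S. Proof. by case: Sp. Qed.
Let Rs : R^T = R. Proof. by case: Rp. Qed.
Let e t := expmx (t *: M).

(** The stationary Riccati equation read as a similarity: M is conjugate through Pinf to -(A' + YR).
    Hence observability of (YRY, M) reduces in [obsR] to the rank condition on (A, R), the term YR
    being an output injection. *)
Let YM : Y *m M = - (A^T + Y *m R) *m Y.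
Proof.
have MP : M *m Pinf = - (Pinf *m (A^T + Y *m R)).
  rewrite mulmxDr mulKVmx// /M /closed_loop mulmxBl; apply/eqP; rewrite -addr_eq0.
  by rewrite addrAC addrA; exact/eqP/ric.
by rewrite -[M](mulmxK Pu) MP mulmxA mulmxN mulKmx.
Qed.

Let obsS (w : 'cV[K]_n.+1) : (forall k : nat, S *m M ^+ k *m w = 0) -> w = 0.
Proof.
move=> h; case: rk => _ rk2; apply: (rank_observable Sp rk2).
rewrite trmxK; apply: (@kernel_shift _ _ A (- Pinf)) => k.
by rewrite mulNmx h.
Qed.

Let obsR (w : 'cV[K]_n.+1) : (forall k : nat, Y *m R *m Y *m M ^+ k *m w = 0) -> w = 0.
Proof.
move=> h; suff Yw : Y *m w = 0 by rewrite -[w](mulKVmx Pu) -/Y Yw mulmx0.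
case: rk => rk1 _; apply: (rank_observable Rp rk1).
have YMk (k : nat) : Y *m M ^+ k = (- A^T + - Y *m R) ^+ k *m Y.
  elim: k => [|k IH]; first by rewrite !expr0 mulmx1 mul1mx.
  rewrite exprSr exprSr -[M ^+ k * M]/(M ^+ k *m M) mulmxA IH -mulmxA YM mulmxA.
  by congr (_ *m _); rewrite mulmxN -mulmxN opprD mulNmx.
have h1 : forall k : nat, R *m (- A^T) ^+ k *m (Y *m w) = 0.
  apply: (@kernel_shift _ _ _ (- Y)) => k.
  rewrite -[RHS](mulmx0 _ Pinf) -(h k) -!mulmxA mulKVmx//; congr (_ *m _).
  by rewrite !mulmxA YMk.
move=> k; have := h1 k; rewrite -scaleN1r exprZn -scalemxAr -scalemxAl.
move=> /(congr1 ( *:%R ((-1) ^+ k))).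
by rewrite scalerA -expr2 sqrr_sign scale1r scaler0.
Qed.

(** H is the infinite-horizon gramian with source YRY ([HL]). Its positive definiteness is the
    strict inequality G < Pinf^-1. *)
Let H := Y - G.
Let Hs : H^T = H. Proof. by rewrite /H linearB /= Ys Gs. Qed.
Let YRYp : psdmx (Y *m R *m Y).
Proof. by have := psd_conj Y Rp; rewrite Ys. Qed.

Let HL : H *m M + M^T *m H = - (Y *m R *m Y).
Proof.
rewrite /H (mulmxBl Y G M) (mulmxBr M^T Y G) addrACA -opprD GL opprK YM.
have -> : M^T *m Y = A^T *m Y - S.
  by rewrite /M /closed_loop linearB /= trmx_mul Ss Ps mulmxBl -mulmxA mulmxV ?mulmx1.
by rewrite mulNmx mulmxDl opprD addrACA addNr add0r addrNK.
Qed.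

Let Gt t := lyap_gap M G t.
Let Gts t : (Gt t)^T = Gt t. Proof. exact: lyap_gap_sym. Qed.
Let Gt_mono s t z : s <= t -> quad (Gt s) z <= quad (Gt t) z.
Proof. exact: (lyap_gap_mono z Sp GL). Qed.
Let Gt_le t z : quad (Gt t) z <= quad G z.
Proof. by apply: (lyap_le z t Sp dec GL). Qed.

Let G1p : posdefmx (Gt 1). Proof. exact: (lyap_gap_posdef Sp Gs GL obsS). Qed.

Let posdef_ge (M1 M2 : 'M[K]_n.+1) : posdefmx M1 -> M2^T = M2 ->
  (forall z, quad M1 z <= quad M2 z) -> posdefmx M2.
Proof. by move=> [_ h] s2 le; split=> // z z0; rewrite (lt_le_trans (h z z0)). Qed.

Let Gtp t : 1 <= t -> posdefmx (Gt t).
Proof. by move=> t1; apply: (posdef_ge G1p (Gts t)) => z; apply: Gt_mono; exact: t1. Qed.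

Let Gp : posdefmx G. Proof. by apply: (posdef_ge G1p Gs) => z; exact: Gt_le. Qed.

Let Kt t := lyap_gap M H t.
Let K1p : posdefmx (Kt 1). Proof. exact: (lyap_gap_posdef YRYp Hs HL obsR). Qed.
Let Hp : posdefmx H.
Proof. by apply: (posdef_ge K1p Hs) => z; exact: (lyap_le z 1 YRYp dec HL). Qed.

Let Th t := invmx (Gt t) - Pinf.
Let PinfE : Pinf = invmx Y. Proof. by rewrite invmxK. Qed.
(** Since G_t <= G, the inverse of G_t dominates that of G, so [Th t] >= G^-1 - Pinf, a fixed
    positive definite matrix because G < Pinf^-1; adding P only helps. *)
Let Thi : exists e0, forall t P, 1 <= t -> psdmx P -> ldb (Th t + P) e0.
Proof.
have : posdefmx (invmx G - Pinf) by rewrite PinfE; exact: (inv_antitone_strict Gp Yp Hp).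
move=> /posdef_ldb[e0 [e00 h]]; exists e0 => t P t1 [_ Pge]; split=> // z.
rewrite quadD (le_trans (h z))// -[leLHS]addr0; apply: lerD; last exact: Pge.
rewrite !quadB lerD2r; apply: (inv_antitone (Gtp t1) Gp) => v; exact: Gt_le.
Qed.

(** By the stationary equation V - Pinf U solves W' = MW, so it equals e^{tM}(P - Pinf). Then U' =
    -M'U + SW, and variation of constants gives this formula, in which the gramian appears. *)
Definition riccati_den (t : K) (P : 'M[K]_n.+1) : 'M[K]_n.+1 :=
  (expmx ((- t) *: M))^T *m (1%:M + Gt t *m (P - Pinf)).
Definition riccati_num (t : K) (P : 'M[K]_n.+1) : 'M[K]_n.+1 :=
  Pinf *m riccati_den t P + expmx (t *: M) *m (P - Pinf).
Let U := riccati_den.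
Let V := riccati_num.

Lemma riccati_den0 P : U 0 P = 1%:M.
Proof.
by rewrite /U /riccati_den oppr0 expmx0 trmx1 mul1mx /Gt lyap_gap0 mul0mx addr0.
Qed.

Lemma riccati_num0 P : V 0 P = P.
Proof. by rewrite /V /riccati_num -/U riccati_den0 expmx0 mulmx1 mul1mx addrC subrK. Qed.

Let eE t P : e t *m (P - Pinf) = V t P - Pinf *m U t P.
Proof. by rewrite /V /riccati_num addrAC subrr add0r. Qed.

Let MT : M^T = A^T - S *m Pinf.
Proof. by rewrite /M /closed_loop linearB /= trmx_mul Ss Ps. Qed.

Lemma riccati_den_misd t P : misd (U^~ P) t (- A^T *m U t P + S *m V t P).
Proof.
have dN : isd (fun t : K => - t) t (-1) by apply: isdN; exact: isd_id.
have d1 := misd_tr (misd_comp (@expmx_misdr K n M (- t)) dN).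
have d2 := misdD (misd_cst (1%:M : 'M[K]_n.+1) t) (misdMr (P - Pinf) (lyap_gap_misd t GL)).
apply: (misd_eq (misdM d1 d2)).
have ee : (expmx ((- t) *: M))^T *m (expmx (t *: M))^T = 1%:M.
  by rewrite -trmx_mul expmxVr trmx1.
rewrite scaleN1r linearN /= trmx_mul mulNmx add0r -[_ *m _ *m (1%:M + _)]mulmxA.
rewrite -[_^T *m (1%:M + _)]/(U t P).
rewrite -[(expmx (t *: M))^T *m S *m _ *m _]mulmxA eE -[(expmx (t *: M))^T *m S *m _]mulmxA.
rewrite (mulmxA (expmx ((- t) *: M))^T (expmx (t *: M))^T) ee mul1mx MT.
rewrite mulmxBr mulmxBl !mulNmx opprB !mulmxA.
move: (S *m Pinf *m U t P) (A^T *m U t P) (S *m V t P) => x1 x2 x3.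
by apply/matrixP => i j; rewrite !mxE; ring.
Qed.

Lemma riccati_num_misd t P : misd (V^~ P) t (R *m U t P + A *m V t P).
Proof.
apply: (misd_eq (misdD (misdMl Pinf (riccati_den_misd t P))
  (misdMr (P - Pinf) (@expmx_misd K n M t)))).
rewrite -mulmxA eE /M /closed_loop mulmxDr mulmxBl !mulmxBr.
have : riccati A R S Pinf *m U t P = 0 by rewrite ric mul0mx.
rewrite /riccati mulmxBl !mulmxDl mulNmx mulmxN !mulmxA.
set x1 := Pinf *m A^T *m _; set x2 := Pinf *m S *m V t P; set x3 := A *m V t P.
set x4 := A *m Pinf *m _; set x5 := R *m _; set x6 := Pinf *m S *m _ *m _.
move: x1 x2 x3 x4 x5 x6 => x1 x2 x3 x4 x5 x6 h.
apply/eqP; rewrite -subr_eq0 -[X in _ == X]oppr0 -h; apply/eqP.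
apply/matrixP => i j; rewrite !mxE; ring.
Qed.

Let g t := invmx (Gt t).
Let Z t P := invmx (Th t + P).
Let es t : (e t)^T *m (expmx ((- t) *: M))^T = 1%:M.
Proof. by rewrite -trmx_mul expmxVl trmx1. Qed.

Let invmx_eq (A1 B1 : 'M[K]_n.+1) : A1 *m B1 = 1%:M -> invmx A1 = B1.
Proof.
by move=> h; have [u _] := mulmx1_unit h; rewrite -[LHS]mulmx1 -h mulmxA mulVmx// mul1mx.
Qed.

Section time.
Variable t : K.
Hypothesis t1 : 1 <= t.
Let Gu : Gt t \in unitmx. Proof. exact: posdef_unit (Gtp t1). Qed.
Let gs : (g t)^T = g t. Proof. exact: invmx_sym. Qed.

Section one_covariance.
Variable P : 'M[K]_n.+1.
Hypothesis Pps : psdmx P.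
Let Zu : Th t + P \in unitmx.
Proof. by case: Thi => e0 h; exact: ldb_unit (h t P t1 Pps). Qed.
Let Ths : (Th t + P)^T = Th t + P.
Proof. by rewrite linearD /= linearB /= gs Ps Pps.1. Qed.
Let Zs : (Z t P)^T = Z t P. Proof. exact: invmx_sym. Qed.

Let denE : U t P = (expmx ((- t) *: M))^T *m (Gt t *m (Th t + P)).
Proof.
rewrite /U /riccati_den; congr (_ *m _).
rewrite (mulmxBr (Gt t) P Pinf) (mulmxDr (Gt t) (Th t) P) (mulmxBr (Gt t) (invmx (Gt t)) Pinf).
rewrite mulmxV ?Gu//.
by move: (Gt t *m Pinf) (Gt t *m P) => x y; apply/matrixP => i j; rewrite !mxE; ring.
Qed.

Lemma riccati_den_inv : U t P *m (Z t P *m g t *m (e t)^T) = 1%:M.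
Proof.
rewrite denE -!mulmxA (mulmxA (Th t + P)) mulmxV// mul1mx (mulmxA (Gt t)) mulmxV// mul1mx.
by rewrite -trmx_mul expmxVr trmx1.
Qed.

Lemma riccati_den_unit : U t P \in unitmx.
Proof. by have [] := mulmx1_unit riccati_den_inv. Qed.

Lemma riccati_gainE : (invmx (U t P))^T = e t *m g t *m Z t P.
Proof. by rewrite (invmx_eq riccati_den_inv) !trmx_mul trmxK Zs gs mulmxA. Qed.

Lemma riccati_covE : V t P *m invmx (U t P) =
  Pinf + e t *m (g t - g t *m Z t P *m g t) *m (e t)^T.
Proof.
rewrite /V /riccati_num -/U mulmxDl mulmxK ?riccati_den_unit//; congr (_ + _).
rewrite (invmx_eq riccati_den_inv) -!mulmxA; congr (_ *m _).
rewrite !mulmxA; congr (_ *m _).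
have -> : P - Pinf = (Th t + P) - g t by rewrite /Th -/(g t); move: (g t) => x; apply/matrixP => i j; rewrite !mxE; ring.
by rewrite !mulmxBl mulmxV// mul1mx.
Qed.

Lemma riccati_cov_sym : (V t P *m invmx (U t P))^T = V t P *m invmx (U t P).
Proof.
rewrite riccati_covE linearD /= Ps !trmx_mul trmxK linearB /= gs !trmx_mul gs Zs.
by rewrite !mulmxA.
Qed.

End one_covariance.

Let cov P := V t P *m invmx (U t P).
Let gain P := (invmx (U t P))^T.

(** The resolvent identity, from which the differences of gains and covariances follow. *)
Let Zdiff P Q : psdmx P -> psdmx Q -> Z t P - Z t Q = - (Z t P *m (P - Q) *m Z t Q).
Proof.
move=> Pps Qps; case: Thi => e0 h.
have Pu' := ldb_unit (h t P t1 Pps); have Qu := ldb_unit (h t Q t1 Qps).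
have -> : P - Q = (Th t + P) - (Th t + Q).
  by move: (Th t) => x; apply/matrixP => i j; rewrite !mxE; ring.
rewrite mulmxBr mulmxBl mulVmx// mul1mx -mulmxA mulmxV// mulmx1 opprB.
by [].
Qed.

Lemma riccati_gain_diff P Q : psdmx P -> psdmx Q ->
  gain P - gain Q = - (gain P *m (P - Q) *m Z t Q).
Proof.
move=> Pps Qps; rewrite /gain !riccati_gainE// -mulmxBr Zdiff// mulmxN.
by rewrite !mulmxA.
Qed.

(** A gain stands on each side of P - Q and each carries one factor e^{tM}; this is why covariances
    converge at the double rate 2b. *)
Lemma riccati_cov_diff P Q : psdmx P -> psdmx Q ->
  cov P - cov Q = gain P *m (P - Q) *m (gain Q)^T.
Proof.
move=> Pps Qps; rewrite /cov /gain !riccati_covE// !riccati_gainE//.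
have Zsym : (Z t Q)^T = Z t Q.
  by apply: invmx_sym; rewrite linearD /= linearB /= gs Ps Qps.1.
rewrite !trmx_mul Zsym gs; set d := P - Q.
have -> (x y z : 'M[K]_n.+1) : x + y - (x + z) = y - z by rewrite opprD addrACA addrN add0r.
rewrite -mulmxBl -mulmxBr !mulmxA; congr (_ *m _).
have -> (x y z : 'M[K]_n.+1) : (x - y) - (x - z) = z - y.
  by apply/matrixP => i j; rewrite !mxE; ring.
rewrite -mulmxBl -mulmxBr -opprB Zdiff// opprK -/d !mulmxA.
by [].
Qed.

Section bounds.
Variables (e0 g1 e1 : K).
Hypotheses (He0 : forall t P, 1 <= t -> psdmx P -> ldb (Th t + P) e0) (Hg1 : ldb (Gt 1) g1).

Let gb : opb (g t) g1^-1.
Proof.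
case: Hg1 => g10 h; apply: ldb_inv; split=> [|z]; first exact: g10.
apply: le_trans (h z) _; apply: Gt_mono; exact: t1.
Qed.

Let Zb P : psdmx P -> opb (Z t P) e0^-1.
Proof. by move=> Pps; exact: ldb_inv (He0 t1 Pps). Qed.

Let eb : opb (e t) (a * expR (- b * t)).
Proof. by case: dec => _ _; apply; rewrite (le_trans ler01). Qed.

Lemma riccati_gain_bound P : psdmx P -> opb (gain P) (a * g1^-1 * e0^-1 * expR (- b * t)).
Proof.
move=> Pps; rewrite /gain riccati_gainE//.
by have := opbM (opbM eb gb) (Zb Pps); congr opb; ring.
Qed.

Lemma riccati_mean_diff P Q x y : psdmx P -> psdmx Q ->
  enorm (gain P *m x - gain Q *m y) <=
  a * g1^-1 * e0^-1 * expR (- b * t) * (enorm (x - y) + e0^-1 * (spnorm (P - Q) * enorm x)).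
Proof.
move=> Pps Qps; have := riccati_gain_bound; set c := _ * expR _ => h.
(* Splitting in this order lets |P - Q| be multiplied by the norm of x only, as the final estimate
   requires. *)
have -> : gain P *m x - gain Q *m y = gain Q *m (x - y) + (gain P - gain Q) *m x.
  rewrite mulmxBr mulmxBl.
  by move: (gain P *m x) (gain Q *m x) => u v; apply/matrixP => i j; rewrite !mxE; ring.
rewrite (le_trans (enormD _ _))// mulrDr lerD//; first exact: (h Q Qps).2.
have -> : gain P - gain Q = gain Q *m (P - Q) *m - Z t P.
  rewrite -[LHS]opprB riccati_gain_diff// opprK -opprB mulmxN mulmxN mulNmx.
  by [].
have := (opbM (opbM (h Q Qps) (opb_spnorm (P - Q))) (opbN (Zb Pps))).2 x.
by move=> /le_trans; apply; rewrite le_eqVlt; apply/orP; left; apply/eqP; ring.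
Qed.

Lemma riccati_cov_bound P Q : psdmx P -> psdmx Q ->
  opb (cov P - cov Q) ((a * g1^-1 * e0^-1) ^+ 2 * expR (- (2 * b * t)) * spnorm (P - Q)).
Proof.
move=> Pps Qps; rewrite riccati_cov_diff//.
have := opbM (opbM (riccati_gain_bound Pps) (opb_spnorm (P - Q))) (opb_tr (riccati_gain_bound Qps)).
congr opb; rewrite (_ : - (2 * b * t) = - b * t + - b * t); last by ring.
by rewrite expRD; ring.
Qed.

Lemma riccati_cov_upper P : psdmx P ->
  opb (cov P) (frob Pinf + a ^+ 2 * (g1^-1 + g1^-1 ^+ 2 * e0^-1)).
Proof.
move=> Pps; rewrite /cov riccati_covE//.
have h := opbD gb (opbN (opbM (opbM gb (Zb Pps)) gb)).
have [c0 h1] := opbM (opbM eb h) (opb_tr eb).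
apply: opbD; first exact: opb_frob.
have le : a * expR (- b * t) * (g1^-1 + g1^-1 * e0^-1 * g1^-1) * (a * expR (- b * t)) <=
    a ^+ 2 * (g1^-1 + g1^-1 ^+ 2 * e0^-1).
  have x1 : expR (- b * t) <= 1.
    case: dec => _ b0 _; rewrite -expR0 ler_expR mulNr oppr_le0 mulr_ge0 ?(ltW b0)//.
    exact: le_trans t1.
  have x0 := expR_ge0 (- b * t).
  have c1 : 0 <= a ^+ 2 * (g1^-1 + g1^-1 ^+ 2 * e0^-1).
    have ha := opb_ge0 gb; have hb := opb_ge0 (Zb Pps).
    by rewrite mulr_ge0 ?sqr_ge0 ?addr_ge0 ?mulr_ge0 ?sqr_ge0.
  set u := expR _ in x1 x0 *.
  rewrite (_ : _ * (a * u) = a ^+ 2 * (g1^-1 + g1^-1 ^+ 2 * e0^-1) * u ^+ 2); last by ring.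
  by rewrite -[leRHS]mulr1 ler_wpM2l// expr_le1.
split=> [|z]; first exact: le_trans c0 le.
by apply: le_trans (h1 z) _; apply: ler_wpM2r; [exact: enorm_ge0|exact: le].
Qed.

End bounds.

(** Here B = e^{-tM'} D e^{-tM}, and the covariance reached from P = 0 is Pinf - B^-1 ([cov0E]).
    Written through the gap of H at time -t, B is visibly nondecreasing in t, so a lower bound at
    time 1 persists. *)
Let D := Y - Gt t.
Let B := Y - lyap_gap M H (- t).

Let DE : D = H + (e t)^T *m G *m e t.
Proof. by rewrite /D /Gt /lyap_gap /H opprB [_ - G]addrC addrA addrC addrA; apply/matrixP => i j; rewrite !mxE; ring. Qed.

Let BE : B = (expmx ((- t) *: M))^T *m D *m expmx ((- t) *: M).
Proof.
rewrite DE mulmxDr mulmxDl !mulmxA -trmx_mul expmxVr trmx1 mul1mx.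
rewrite -[G *m e t *m _]mulmxA expmxVr mulmx1 /B /lyap_gap /H.
by move: (_ *m expmx _) => x; apply/matrixP => i j; rewrite !mxE; ring.
Qed.

Let Dp : posdefmx D.
Proof.
apply: (posdef_ge Hp); first by rewrite /D linearB /= Ys Gts.
by move=> z; rewrite /D /H (quadB Y G) (quadB Y (Gt t)) lerD2l lerN2; exact: Gt_le.
Qed.
Let Du : D \in unitmx. Proof. exact: posdef_unit. Qed.

Let Binv : invmx B = e t *m invmx D *m (e t)^T.
Proof.
apply: invmx_eq; rewrite BE -!mulmxA (mulmxA (expmx ((- t) *: M)) (e t)) expmxVl mul1mx.
by rewrite (mulmxA D) mulmxV// mul1mx -trmx_mul expmxVr trmx1.
Qed.

Let cov0E : cov 0 = Pinf - invmx B.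
Proof.
have p0 : psdmx (0 : 'M[K]_n.+1).
  by split=> [|z]; rewrite ?trmx0// quadE mul0mx cdot0r.
rewrite /cov riccati_covE// Binv.
have -> : - (e t *m invmx D *m (e t)^T) = e t *m - invmx D *m (e t)^T.
  by rewrite mulmxN mulNmx.
congr (_ + _); congr (_ *m _); congr (_ *m _).
have -> : Z t 0 = Y *m invmx D *m Gt t.
  apply: invmx_eq; rewrite addr0.
  have -> : Th t = g t *m D *m Pinf.
    by rewrite /D mulmxBr mulmxBl mulVmx// mul1mx -mulmxA mulVmx// mulmx1.
  rewrite -!mulmxA mulKVmx// (mulmxA D) mulmxV// mul1mx.
  exact: mulVmx.
rewrite -!mulmxA mulmxV// mulmx1.
have -> : Y = D + Gt t by rewrite /D subrK.
by rewrite mulmxDl mulmxV// mulmxDr mulmx1 mulKmx// opprD addrA addrN add0r.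
Qed.

(** [Y + J] is the value of [B] at time 1, and [J] is positive definite because [Kt 1] is. *)
Let J := (expmx ((- 1) *: M))^T *m Kt 1 *m expmx ((- 1) *: M).

Let JE : lyap_gap M H (- 1) = - J.
Proof.
rewrite /J /Kt /lyap_gap; move: (H) => X.
rewrite mulmxBr mulmxBl !mulmxA -trmx_mul expmxVr trmx1 mul1mx.
by rewrite -[X *m _ *m _]mulmxA expmxVr mulmx1 opprB.
Qed.

Let Jp : posdefmx J.
Proof.
have Ks : (Kt 1)^T = Kt 1 by case: K1p.
split=> [|z z0]; first by rewrite /J !trmx_mul trmxK Ks mulmxA.
rewrite quad_expmx; apply: K1p.2; apply: contraNneq z0 => h.
by rewrite -[z]mul1mx -(expmxVr M 1) -mulmxA h mulmx0.
Qed.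

Let Bp : posdefmx B.
Proof.
split=> [|z z0]; first by rewrite BE !trmx_mul trmxK Dp.1 mulmxA.
rewrite BE quad_expmx; apply: Dp.2; apply: contraNneq z0 => h.
by rewrite -[z]mul1mx -(expmxVr M t) -mulmxA h mulmx0.
Qed.

(** Two comparisons: the covariance increases with P, hence dominates the one started from 0, and
    the latter increases with time, hence dominates its value at time 1. *)
Lemma riccati_cov_lower P z : psdmx P ->
  quad (Pinf - invmx (Y + J)) z <= quad (cov P) z.
Proof.
move=> Pps.
have p0 : psdmx (0 : 'M[K]_n.+1).
  by split=> [|v]; rewrite ?trmx0// quadE mul0mx cdot0r.
apply: (@le_trans _ _ (quad (cov 0) z)).
  rewrite cov0E !quadB lerD2l lerN2.
  apply: (inv_antitone (posdefD Yp (posdef_psd Jp)) Bp) => v.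
  rewrite /B (quadD Y J) (quadB Y (lyap_gap M H (- t))) lerD2l lerNr -(quadN J) -JE.
  by apply: (lyap_gap_mono v YRYp HL); rewrite lerN2.
rewrite /cov (riccati_covE Pps) (riccati_covE p0) !(quadD Pinf) lerD2l !quad_conj.
rewrite !(quadB (g t)) lerD2l lerN2.
have gE Q v : quad (g t *m Q *m g t) v = quad Q (g t *m v).
  by have := quad_conj Q (g t) v; rewrite gs.
rewrite !gE; case: Thi => e0 h.
have tp Q : psdmx Q -> posdefmx (Th t + Q).
  move=> Qp; apply: ldb_posdef (h t Q t1 Qp).
  by rewrite linearD /= linearB /= gs Ps Qp.1.
apply: (inv_antitone (tp _ p0) (tp _ Pps)) => v.
rewrite (quadD (Th t) P) (quadD (Th t) 0) lerD2l [leLHS]quadE mul0mx cdot0r.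
exact: Pps.2.
Qed.

End time.

Lemma riccati_flow_bounds : exists c lo hi : K, [/\ 0 <= c, 0 < lo &
  forall t P, 1 <= t -> psdmx P -> let C Q := V t Q *m invmx (U t Q) in
  [/\ U t P \in unitmx, (C P)^T = C P, ldb (C P) lo, opb (C P) hi &
   forall Q, psdmx Q -> opb (C P - C Q) (c * expR (- (2 * b * t)) * spnorm (P - Q)) /\
    forall x y, enorm ((invmx (U t P))^T *m x - (invmx (U t Q))^T *m y) <=
     c * expR (- b * t) * (enorm (x - y) + spnorm (P - Q) * enorm x)]].
Proof.
case: Thi => e0 He0; have [g1 Hg1] := posdef_ldb G1p.
set J := (expmx ((- 1) *: M))^T *m Kt 1 *m expmx ((- 1) *: M).
have Jp : posdefmx J.
  have Ks : (Kt 1)^T = Kt 1 by case: K1p.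
  split=> [|z z0]; first by rewrite /J !trmx_mul trmxK Ks mulmxA.
  rewrite quad_expmx; apply: K1p.2; apply: contraNneq z0 => h.
  by rewrite -[z]mul1mx -(expmxVr M 1) -mulmxA h mulmx0.
have : posdefmx (Pinf - invmx (Y + J)).
  rewrite {1}PinfE; apply: (inv_antitone_strict Yp (posdefD Yp (posdef_psd Jp))).
  by rewrite addrAC addrN add0r.
move=> /posdef_ldb[lo [lo0 hlo]].
have p0 : psdmx (0 : 'M[K]_n.+1).
  by split=> [|v]; rewrite ?trmx0// quadE mul0mx cdot0r.
have e00 : 0 < e0 by case: (He0 1 0 (lexx _) p0).
have g10 : 0 < g1 by case: Hg1.
have a0 : 0 < a by case: dec.
pose k := a * g1^-1 * e0^-1.
have k0 : 0 <= k by rewrite !mulr_ge0 ?invr_ge0 ?(ltW a0) ?(ltW g10) ?(ltW e00).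
have e0i : 0 <= e0^-1 by rewrite invr_ge0 ltW.
(* One constant for two estimates: k^2 serves the covariances, which contain two gains, and k (1 +
   1/e0) serves the means. *)
pose c := k ^+ 2 + k * (1 + e0^-1).
have ck : k ^+ 2 <= c by rewrite lerDl mulr_ge0 ?addr_ge0.
have ck2 : k * (1 + e0^-1) <= c by rewrite lerDr sqr_ge0.
exists c, lo, (frob Pinf + a ^+ 2 * (g1^-1 + g1^-1 ^+ 2 * e0^-1)).
split=> //; first by rewrite (le_trans _ ck)// sqr_ge0.
move=> t P t1 Pps C; split.
- exact: riccati_den_unit.
- exact: riccati_cov_sym.
- split=> [|z]; [exact: lo0|apply: le_trans (hlo z) _]; exact: (riccati_cov_lower t1).
- by apply: riccati_cov_upper.
- move=> Q Qps; split.
    have [c0 h] := riccati_cov_bound t1 He0 Hg1 Pps Qps.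
    have le : (a * g1^-1 * e0^-1) ^+ 2 * expR (- (2 * b * t)) * spnorm (P - Q) <=
        c * expR (- (2 * b * t)) * spnorm (P - Q).
      by rewrite ler_wpM2r ?spnorm_ge0// ler_wpM2r ?expR_ge0.
    by split=> [|z]; [exact: le_trans c0 le|apply: le_trans (h z) _; apply: ler_wpM2r; [exact: enorm_ge0|exact: le]].
  move=> x y; rewrite (le_trans (riccati_mean_diff t1 He0 Hg1 x y Pps Qps))//.
  rewrite -/k; set u := expR _; set d := enorm (x - y); set s := spnorm _ * _.
  have u0 : 0 <= u by exact: expR_ge0.
  have d0 : 0 <= d by exact: enorm_ge0.
  have s0 : 0 <= s by apply: mulr_ge0; [exact: spnorm_ge0|exact: enorm_ge0].
  apply: (@le_trans _ _ (k * (1 + e0^-1) * u * (d + s))); last first.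
    by apply: ler_wpM2r; [exact: addr_ge0|apply: ler_wpM2r].
  rewrite -subr_ge0 (_ : _ - _ = k * u * (e0^-1 * d + s)); last by ring.
  exact: mulr_ge0 (mulr_ge0 k0 u0) (addr_ge0 (mulr_ge0 e0i d0) s0).
Qed.

End riccati_flow.

(** * Discrete Gronwall, Riemann sums and the Euler scheme for additive noise *)

Section real_functions.
Context {K : realType}.

Lemma gronwall (u : nat -> K) (q e : K) (m : nat) : 0 <= q -> 0 <= e -> 0 <= u 0%N ->
  (forall k, (k < m)%N -> u k.+1 <= (1 + q) * u k + e) ->
  forall k, (k <= m)%N -> u k <= expR (q * k%:R) * (u 0%N + k%:R * e).
Proof.
move=> q0 e0 u0 h; elim=> [_|k IH km]; first by rewrite mulr0 expR0 mul1r mul0r addr0.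
have {IH} IH := IH (ltnW km); rewrite (le_trans (h _ km))//.
set x := u 0%N + k%:R * e in IH; have x0 : 0 <= x by rewrite addr_ge0 ?mulr_ge0.
have -> : u 0%N + k.+1%:R * e = x + e by rewrite /x -natr1; ring.
have -> : q * k.+1%:R = q + q * k%:R :> K by rewrite -natr1; ring.
rewrite expRD; set E := expR (q * k%:R) in IH *.
have E1 : 1 <= E by rewrite /E -expR0 ler_expR mulr_ge0.
have E2 := expR_ge1Dx q; set Q := expR q in E2 *.
have Q1 : 1 <= Q by apply: le_trans E2; rewrite lerDl.
rewrite mulrDr lerD//.
  rewrite (le_trans (ler_wpM2l _ IH)) ?addr_ge0// mulrA ler_wpM2r// ler_wpM2r//.
  exact: le_trans E1.
by rewrite -[leLHS]mul1r ler_wpM2r// mulr_ege1.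
Qed.

Lemma unif_cont (f : K -> K) (T e : K) : continuous f -> 0 < e ->
  exists2 d, 0 < d & forall s s', 0 <= s -> s <= s' -> s' <= T -> s' - s <= d ->
    `|f s' - f s| <= e.
Proof.
move=> cf e0.
have /compact_near_coveringP cpt := @segment_compact K 0 T.
have := cpt K (0 : K)^'+ (fun d s => forall s', `|s' - s| <= d -> `|f s' - f s| <= e) _.
move=> /(_ _)[].
  move=> x _.
  have /cvgrPdist_le/(_ (e / 2)) := cf x.
  rewrite divr_gt0// => /(_ isT)[r /= r0 hr].
  exists (ball x (r / 2), [set d | d < r / 2]); first split.
  - by exists (r / 2) => //=; rewrite divr_gt0.
  - by apply: nbhs_right_lt; rewrite divr_gt0.
  move=> [x' d] [/= bx dr] s' s'd.
  have h1 := hr x'; have h2 := hr s'.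
  have r2 : r / 2 < r by lra.
  have : `|x - x'| < r by exact: lt_trans bx r2.
  move=> /h1 {}h1.
  have : `|x - s'| < r.
    rewrite -[x](subrK x') -addrA (le_lt_trans (ler_normD _ _))//.
    by rewrite [ltRHS]splitr ltrD// distrC (le_lt_trans s'd).
  move=> /h2 {}h2.
  rewrite -[f s'](subrK (f x)) -addrA (le_trans (ler_normD _ _))//.
  by rewrite [leRHS]splitr lerD// distrC.
move=> r /= r0 hr; exists (r / 2); first by rewrite divr_gt0.
move=> s s' s0 ss sT sd.
apply: (hr (r / 2)) => /=.
- by rewrite sub0r normrN gtr0_norm ?divr_gt0//; lra.
- by rewrite divr_gt0.
- by rewrite in_itv /= s0 (le_trans ss).
- by rewrite ger0_norm ?subr_ge0.
Qed.

Lemma continuous_integrable (f : K -> K) (a b : K) : continuous f ->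
  lebesgue_measure.-integrable `[a, b] (EFin \o f).
Proof.
move=> cf; apply: continuous_compact_integrable; first exact: segment_compact.
exact: continuous_subspaceT.
Qed.

Lemma local_integral (f : K -> K) (T e : K) : continuous f -> 0 < e ->
  exists2 d, 0 < d & forall s s', 0 <= s -> s <= s' -> s' <= T -> s' - s <= d ->
    `|\int[lebesgue_measure]_(u in `[0, s']) f u - \int[lebesgue_measure]_(u in `[0, s]) f u
      - (s' - s) * f s| <= e * (s' - s).
Proof.
move=> cf e0; have [d d0 hd] := unif_cont T cf e0.
exists d => // s s' s0 ss sT sd.
have sub : (`]s, s'] : set K) `<=` `[s, s'] by apply: subset_itvr; rewrite bnd_simp.
have mI : measurable (`]s, s'] : set (measurableTypeR K)) by exact: measurable_itv.
have mE : measurable (`[s, s'] : set (measurableTypeR K)) by exact: measurable_itv.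
have intf : lebesgue_measure.-integrable `]s, s'] (EFin \o f).
  exact: integrableS mE mI sub (continuous_integrable s s' cf).
have intc r : lebesgue_measure.-integrable `]s, s'] (EFin \o (cst r : K -> K)).
  exact: integrableS mE mI sub (continuous_integrable s s' (@cst_continuous _ _ r)).
have cstE r : \int[lebesgue_measure]_(u in `]s, s']) r = r * (s' - s).
  have muE : fine (lebesgue_measure (`]s, s'] : set K)) = s' - s.
    rewrite lebesgue_measure_itv/= lte_fin; case: ltP => [//|ss'].
    by have -> : s = s' by [apply/eqP; rewrite eq_le ss ss']; rewrite subrr.
  by rewrite -muE; exact: Rintegral_cst.
rewrite Rintegral_itvB ?bnd_simp//; last exact: continuous_integrable.
rewrite [X in _ - X](mulrC _ (f s)) -(cstE (f s)) -(RintegralB mI intf (intc (f s))).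
have intd : lebesgue_measure.-integrable `]s, s'] (EFin \o (fun u => f u - f s)).
  have := integrableB mI intf (intc (f s)).
  by apply: eq_integrable => // u _ /=; rewrite EFinB.
apply: le_trans (le_normr_Rintegral mI intd) _.
rewrite -(cstE e); apply: (le_Rintegral mI _ (intc e)).
  by have := integrable_abse intd; apply: eq_integrable => // u _.
move=> u /=; rewrite in_itv /= => /andP[su us]; apply: hd => //.
- exact: ltW.
- exact: le_trans sT.
- by apply: le_trans sd; rewrite lerB.
Qed.

Lemma riemann_sum (f : K -> K) (T e : K) : continuous f -> 0 <= T -> 0 < e ->
  \forall m \near \oo, `|\int[lebesgue_measure]_(u in `[0, T]) f u -
     \sum_(k < m) T / m%:R * f (k%:R * (T / m%:R))| <= e.
Proof.
move=> cf T0 e0; have T1 : 0 < T + 1 by lra.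
have [d d0 hd] := local_integral T cf (divr_gt0 e0 T1).
near=> m.
have m0 : 0 < m%:R :> K by rewrite ltr0n; near: m; exact: nbhs_infty_gt.
set h := T / m%:R; have h0 : 0 <= h by rewrite divr_ge0// ltW.
have hdle : h <= d.
  by rewrite ler_pdivrMr// mulrC -ler_pdivrMr//; near: m; exact: nbhs_infty_ger.
pose F s := \int[lebesgue_measure]_(u in `[0, s]) f u.
have mh : m%:R * h = T by rewrite /h mulrCA divff ?mulr1// gt_eqF.
suff H k : (k <= m)%N -> `|F (k%:R * h) - \sum_(i < k) h * f (i%:R * h)| <= e / (T + 1) * (k%:R * h).
  have := H _ (leqnn m); rewrite mh => /le_trans; apply.
  by rewrite mulrAC ler_pdivrMr// ler_wpM2l ?(ltW e0)//; lra.
elim: k => [_|k IH km].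
  by rewrite big_ord0 mul0r /F set_itv1 Rintegral_set1 subr0 normr0 mulr0.
have -> : F (k.+1%:R * h) - \sum_(i < k.+1) h * f (i%:R * h) =
  (F (k.+1%:R * h) - F (k%:R * h) - h * f (k%:R * h)) +
  (F (k%:R * h) - \sum_(i < k) h * f (i%:R * h)).
  by rewrite big_ord_recr /=; ring.
have kh : k.+1%:R * h - k%:R * h = h by rewrite -natr1; ring.
have := hd (k%:R * h) (k.+1%:R * h); rewrite kh => hk.
rewrite (le_trans (ler_normD _ _))//.
have -> : e / (T + 1) * (k.+1%:R * h) = e / (T + 1) * h + e / (T + 1) * (k%:R * h).
  by rewrite -natr1; ring.
apply: lerD; last by apply: IH; exact: ltnW.
apply: hk => //.
- by rewrite mulr_ge0.
- by rewrite ler_wpM2r// ler_nat.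
- by rewrite -mh ler_wpM2r// ler_nat.
Unshelve. all: by end_near. Qed.

(** (u + |u|)/2 is the positive part of u. Composing with it extends a path constrained on [0, +oo[
    to a continuous function on the line, as the integration lemmas expect. *)
Lemma within_half_line m n (f : K -> 'M[K]_(m, n)) :
  {within `[0, +oo[, continuous f} -> continuous (fun u : K => f ((u + `|u|) / 2)).
Proof.
move=> /subspace_continuousP h u.
pose g (u : K) := (u + `|u|) / 2.
have g0 v : g v \in `[0, +oo[.
  by rewrite /g in_itv /= andbT; have := ler_norm (- v); rewrite normrN; lra.
have gc : {for u, continuous g}.
  have h1 : (fun v : K => v + `|v|) @ u --> u + `|u|.
    by apply: cvgD; [exact: cvg_id|exact: (@norm_continuous _ K u)].
  rewrite /prop_for /continuous_at /g.
  apply: (@cvgM _ _ (nbhs u) _ (fun v => v + `|v|) (fun=> 2^-1)); [exact: h1|exact: cvg_cst].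
move=> W /(h _ (g0 u)) hW.
have h2 : nbhs u (fun v => g v \in `[0, +oo[ -> W (f (g v))) := gc _ hW.
by apply: filterS h2 => v; apply; exact: g0.
Qed.

Lemma half_lineE (u : K) : 0 <= u -> (u + `|u|) / 2 = u.
Proof. by move=> u0; rewrite ger0_norm//; lra. Qed.

End real_functions.

Section euler.
Context {K : realType} {n : nat}.
Implicit Types (A : 'M[K]_n) (Y N : K -> 'cV[K]_n).

(** One-step consistency, uniform on [0, T], with dY = AY dt + dN for an arbitrary path N. It is
    additive in (Y, N), holds for the exponential flow and for the diffusion, and suffices for Euler
    convergence and uniqueness. *)
Definition approx_solution A Y N (T : K) := forall e, 0 < e ->
  exists2 d, 0 < d & forall s s', 0 <= s -> s <= s' -> s' <= T -> s' - s <= d ->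
    enorm (Y s' - Y s - (s' - s) *: (A *m Y s) - (N s' - N s)) <= e * (s' - s).

Lemma approx_solutionD A Y N Y' N' T : approx_solution A Y N T -> approx_solution A Y' N' T ->
  approx_solution A (fun t => Y t + Y' t) (fun t => N t + N' t) T.
Proof.
move=> h h' e e0; have e2 : 0 < e / 2 by rewrite divr_gt0.
have [d d0 hd] := h _ e2; have [d' d'0 hd'] := h' _ e2.
exists (Num.min d d'); first by rewrite lt_min d0.
move=> s s' s0 ss sT; rewrite le_min => /andP[sd sd'].
rewrite mulmxDr scalerDr [e]splitr mulrDl.
apply: le_trans (lerD (hd s s' s0 ss sT sd) (hd' s s' s0 ss sT sd')).
apply: le_trans _ (enormD _ _); rewrite le_eqVlt; apply/orP; left; apply/eqP; congr enorm.
by move: (_ *: _) (_ *: _) => x y; apply/matrixP => i j; rewrite !mxE; ring.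
Qed.

Lemma enorm_le_coord (v : 'cV[K]_n) e : 0 <= e -> (forall i, `|v i 0| <= e) ->
  enorm v <= n%:R * e.
Proof.
move=> e0 h; rewrite -ler_sqr ?nnegrE ?enorm_ge0 ?mulr_ge0// enorm_sqr cdotE.
apply: (@le_trans _ _ (\sum_(i < n) e ^+ 2)).
  by apply: ler_sum => i _; rewrite -expr2 -real_normK ?num_real// lerXn2r ?nnegrE.
rewrite sumr_const card_ord -[_ *+ n]mulr_natl exprMn ler_wpM2r ?sqr_ge0//.
by rewrite -natrX ler_nat; case: (n) => // k; rewrite expnS leq_pmulr.
Qed.

(** The step size is the minimum of those found for the coordinates at precision e/(n + 1); the + 1
    covers dimension 0. *)
Lemma uniform_coord (G : K -> K -> 'cV[K]_n) (c : K -> K -> K) T :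
  (forall s s', s <= s' -> 0 <= c s s') ->
  (forall i e, 0 < e -> exists2 d, 0 < d & forall s s', 0 <= s -> s <= s' -> s' <= T ->
    s' - s <= d -> `|G s s' i 0| <= e * c s s') ->
  forall e, 0 < e -> exists2 d, 0 < d & forall s s', 0 <= s -> s <= s' -> s' <= T ->
    s' - s <= d -> enorm (G s s') <= e * c s s'.
Proof.
move=> c0 h e e0; pose e' := e / (n%:R + 1).
have e'0 : 0 < e' by rewrite divr_gt0// ltr_wpDl.
pose ok i (d : K) := 0 < d /\ forall s s', 0 <= s -> s <= s' -> s' <= T -> s' - s <= d ->
    `|G s s' i 0| <= e' * c s s'.
have ex i : exists d, ok i d by have [d d0 hd] := h i e' e'0; exists d.
have [d hd] := choice ex.
exists (\big[Num.min/1]_i d i).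
  by apply: lt_bigmin => // i _; case: (hd i).
move=> s s' s0 ss sT sd.
apply: (@le_trans _ _ (n%:R * (e' * c s s'))); last first.
  rewrite mulrA; apply: ler_wpM2r; first exact: c0.
  rewrite /e' mulrA ler_pdivrMr ?ltr_wpDl//.
  by rewrite mulrDr mulr1 mulrC lerDl ltW.
apply: enorm_le_coord => [|i]; first by rewrite mulr_ge0 ?c0// ltW.
case: (hd i) => di; apply => //; apply: (le_trans sd).
exact: bigmin_le_cond.
Qed.

Lemma approx_solution_coord A Y N T :
  (forall i e, 0 < e -> exists2 d, 0 < d & forall s s', 0 <= s -> s <= s' -> s' <= T -> s' - s <= d ->
    `|(Y s' - Y s - (s' - s) *: (A *m Y s) - (N s' - N s)) i 0| <= e * (s' - s)) ->
  approx_solution A Y N T.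
Proof. by move=> h; apply: uniform_coord h => s s'; rewrite subr_ge0. Qed.

Lemma integral_approx_solution A Y N x T :
  {within `[0, +oo[, continuous Y} ->
  (forall t, 0 <= t -> Y t =
    x + \col_i (\int[lebesgue_measure]_(u in `[0, t]) (A *m Y u) i 0) + N t) ->
  approx_solution A Y N T.
Proof.
move=> /within_half_line cY h; apply: approx_solution_coord => i e e0.
pose f (u : K) := (A *m Y ((u + `|u|) / 2)) i 0.
have cf : continuous f.
  move=> u; apply: (@cvg_mx_coord K _ _ _ _ _ (fun u => A *m Y ((u + `|u|) / 2))).
  by apply: cvg_mulmx; [exact: cvg_cst|exact: cY].
have [d d0 hd] := local_integral T cf e0; exists d => // s s' s0 ss sT sd.
have s'0 := le_trans s0 ss.
have fE t : \int[lebesgue_measure]_(u in `[0, t]) (A *m Y u) i 0 =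
    \int[lebesgue_measure]_(u in `[0, t]) f u.
  by apply: eq_Rintegral => u; rewrite inE/= in_itv/= => /andP[u0 _]; rewrite /f half_lineE.
have := hd s s' s0 ss sT sd; rewrite -!fE /f half_lineE// => /(le_trans _); apply.
rewrite le_eqVlt; apply/orP; left; apply/eqP; congr `|_|.
have c t t0 := congr1 (fun M : 'cV[K]_n => M i 0) (h t t0).
have := c s s0; have := c s' s'0; move: (A *m Y s) => v.
rewrite !mxE => -> ->; ring.
Qed.

Fixpoint euler A (h : K) (x : 'cV[K]_n) (dN : nat -> 'cV[K]_n) k :=
  if k is k'.+1 then
    let z := euler A h x dN k' in z + h *: (A *m z) + dN k' else x.

Lemma euler_cvg A Y N T e : 0 <= T -> approx_solution A Y N T -> 0 < e ->
  \forall m \near \oo, forall k, (k <= m)%N ->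
    enorm (Y (k%:R * (T / m%:R)) - euler A (T / m%:R) (Y 0)
      (fun k => N (k.+1%:R * (T / m%:R)) - N (k%:R * (T / m%:R))) k) <= e.
Proof.
move=> T0 hs e0; set a := frob A.
have a0 : 0 <= a by exact: frob_ge0.
have E0 : 0 < expR (a * T) by exact: expR_gt0.
have T1 : 0 < T + 1 by lra.
(* The local precision is chosen so that, after accumulation over time T and amplification by the
   Gronwall factor e^{aT}, the error is at most e; T + 1 avoids dividing by zero when T = 0. *)
have [d d0 hd] := hs (e / (expR (a * T) * (T + 1))) (divr_gt0 e0 (mulr_gt0 E0 T1)).
set e' := e / _ in hd.
have e'0 : 0 <= e' by rewrite divr_ge0 ?(ltW e0) ?mulr_ge0 ?(ltW E0) ?(ltW T1).
near=> m; set h := T / m%:R.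
have m0 : 0 < m%:R :> K by rewrite ltr0n; near: m; exact: nbhs_infty_gt.
have h0 : 0 <= h by rewrite divr_ge0// ltW.
have hdle : h <= d.
  by rewrite ler_pdivrMr// mulrC -ler_pdivrMr//; near: m; exact: nbhs_infty_ger.
have mh : m%:R * h = T by rewrite /h mulrCA divff ?mulr1// gt_eqF.
set Z := euler _ _ _ _.
pose u k := enorm (Y (k%:R * h) - Z k).
have ah0 : 0 <= a * h by rewrite mulr_ge0.
have eh0 : 0 <= e' * h by rewrite mulr_ge0.
have u0 : u 0%N = 0 by rewrite /u /Z /= mul0r subrr enorm0.
have step k : (k < m)%N -> u k.+1 <= (1 + a * h) * u k + e' * h.
  move=> km; have kh : k.+1%:R * h - k%:R * h = h by rewrite -natr1; ring.
  have := hd (k%:R * h) (k.+1%:R * h); rewrite kh => hk.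
  have {}hk : enorm (Y (k.+1%:R * h) - Y (k%:R * h) - h *: (A *m Y (k%:R * h)) -
      (N (k.+1%:R * h) - N (k%:R * h))) <= e' * h.
    apply: hk => //; first by rewrite mulr_ge0.
      by rewrite ler_wpM2r// ler_nat.
    by rewrite -mh ler_wpM2r// ler_nat.
  set D := Y (k%:R * h) - Z k.
  have -> : u k.+1 = enorm (D + h *: (A *m D) + (Y (k.+1%:R * h) - Y (k%:R * h) -
      h *: (A *m Y (k%:R * h)) - (N (k.+1%:R * h) - N (k%:R * h)))).
    rewrite /u /D mulmxBr scalerBr; congr enorm.
    rewrite /Z [euler _ _ _ _ _]/= -/Z.
    move: (h *: (A *m Y _)) (h *: (A *m Z k)) => v1 v2.
    by apply/matrixP => i j; rewrite !mxE; ring.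
  rewrite (le_trans (enormD _ _))// lerD//.
  rewrite (le_trans (enormD _ _))// mulrDl mul1r lerD// enormZ ger0_norm//.
  rewrite (_ : a * h * u k = h * (a * u k)); last by ring.
  apply: ler_wpM2l; [exact: h0|exact: (opb_frob A).2].
move=> k km; have := gronwall ah0 eh0 _ step km; rewrite u0 lexx => /(_ isT) /le_trans; apply.
have kT : k%:R * h <= T by rewrite -mh ler_wpM2r// ler_nat.
rewrite add0r (_ : a * h * k%:R = a * (k%:R * h)); last by ring.
rewrite (_ : k%:R * (e' * h) = e' * (k%:R * h)); last by ring.
apply: (@le_trans _ _ (expR (a * T) * (e' * (T + 1)))).
  apply: ler_pM.
  - exact: expR_ge0.
  - by rewrite mulr_ge0// mulr_ge0.
  - by rewrite ler_expR ler_wpM2l.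
  - by apply: ler_wpM2l => //; lra.
by rewrite /e' le_eqVlt; apply/orP; left; apply/eqP; field; rewrite !gt_eqF.
Unshelve. all: by end_near. Qed.

(** Both solutions are approximated by the same Euler scheme, which depends only on the common
    initial value and driving path. *)
Lemma approx_solution_uniq A Y Y' N T : 0 <= T ->
  approx_solution A Y N T -> approx_solution A Y' N T -> Y 0 = Y' 0 -> Y T = Y' T.
Proof.
move=> T0 h h' YY; apply/eqP; rewrite -subr_eq0; apply/eqP/enorm_eq0/eqP.
rewrite eq_le enorm_ge0 andbT; apply/ler_addgt0Pr => e e0; rewrite add0r.
have e2 : 0 < e / 2 by rewrite divr_gt0.
have [m [/= mgt [h1 h2]]] := filter_ex (filterI (nbhs_infty_gt 0%N)
  (filterI (euler_cvg T0 h e2) (euler_cvg T0 h' e2))).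
have m0 : 0 < m%:R :> K by rewrite ltr0n.
have mh : m%:R * (T / m%:R) = T by rewrite mulrCA divff ?mulr1// gt_eqF.
have := h1 m (leqnn m); have := h2 m (leqnn m); rewrite mh -YY.
set Z := euler _ _ _ _ _ => k2 k1.
have -> : Y T - Y' T = (Y T - Z) - (Y' T - Z) by rewrite opprB addrA subrK.
by rewrite (le_trans (enormB _ _))// [e]splitr lerD.
Qed.

End euler.

Lemma derivative_approx (K : realType) n (g D : K -> 'cV[K]_n) (T e : K) :
  (forall t, misd g t (D t)) -> continuous D -> 0 < e ->
  exists2 d, 0 < d & forall s s', 0 <= s -> s <= s' -> s' <= T -> s' - s <= d ->
    enorm (g s' - g s - (s' - s) *: D s) <= e * (s' - s) /\ enorm (g s' - g s) <= e.
Proof.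
move=> hg cD e0.
have cDi i : continuous (fun t => D t i 0).
  by move=> u; apply: cvg_mx_coord; exact: cD.
have cgi i : continuous (fun t => g t i 0).
  by move=> u; apply: cvg_mx_coord; exact: misd_continuous (hg u).
have c0 (s s' : K) : s <= s' -> 0 <= s' - s by rewrite subr_ge0.
case: (@uniform_coord K n (fun s s' => g s' - g s - (s' - s) *: D s)
    (fun s s' => s' - s) T c0 _ e e0) => [|d1 d10 h1].
  move=> i e1 e10; have [d d0 hd] := unif_cont T (cDi i) e10; exists d => // s s' s0 ss sT sd.
  have [c /andP[sc cs] hc] := isd_mvt ss (fun u _ => hg u i 0).
  rewrite !mxE hc [X in X - _]mulrC -mulrBr normrM (ger0_norm (c0 _ _ ss)) mulrC.
  apply: ler_wpM2r; [exact: c0|apply: hd => //]; first exact: le_trans sT.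
  by apply: le_trans sd; rewrite lerD2r.
case: (@uniform_coord K n (fun s s' => g s' - g s) (fun _ _ => 1) T (fun _ _ _ => ler01) _ e e0)
  => [|d2 d20 h2].
  move=> i e1 e10; have [d d0 hd] := unif_cont T (cgi i) e10; exists d => // s s' *.
  by rewrite !mxE mulr1; exact: hd.
exists (Num.min d1 d2); first by rewrite lt_min d10.
move=> s s' s0 ss sT; rewrite le_min => /andP[sd1 sd2]; split; first exact: h1.
by have := h2 s s' s0 ss sT sd2; rewrite mulr1.
Qed.

Lemma expmx_approx_solution (K : realType) n (A : 'M[K]_n.+1) (x : 'cV[K]_n.+1) T :
  approx_solution A (fun t => expmx (t *: A) *m x) (fun=> 0) T.
Proof.
move=> e e0.
have dY u : misd (fun t => expmx (t *: A) *m x) u (A *m (expmx (u *: A) *m x)).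
  by rewrite mulmxA; exact: misdMr (@expmx_misd K n A u).
have cD : continuous (fun u : K => A *m (expmx (u *: A) *m x)).
  by move=> u; exact: misd_continuous (misdMl A (dY u)).
have [d d0 hd] := derivative_approx T dY cD e0; exists d => // s s' s0 ss sT sd.
by rewrite subr0 subr0; case: (hd s s' s0 ss sT sd).
Qed.

(** * Kalman updates and convergence of the discrete linear system *)

Section update_algebra.
Context {K : realType} {n : nat}.
Implicit Types (P : 'M[K]_n) (l m v : 'cV[K]_n).

Lemma mul_outer p (a : 'M[K]_(p, 1)) l v : a *m l^T *m v = cdot l v *: a.
Proof. by rewrite -mulmxA [X in _ *m X]mx11_scalar mul_mx_scalar. Qed.

Lemma update_cov_psd P l : psdmx P -> psdmx (update_cov P l).
Proof.
move=> Pp; have [Ps P0] := Pp; split.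
  by rewrite /update_cov linearB /= linearZ /= trmx_mul trmxK Ps.
move=> u; rewrite quad_update subr_ge0 ler_pdivrMr ?ltr_wpDr ?P0//.
apply: le_trans (psd_CS u l Pp) _; rewrite ler_wpM2l ?P0// lerDr.
exact: ler01.
Qed.

(** The relation P_new^-1 = P^-1 + l l' cleared of the inverses of both covariances; in this form
    updates compose by multiplication. *)
Lemma update_covE P l : psdmx P -> update_cov P l *m (1%:M + l *m l^T *m P) = P.
Proof.
move=> [Ps P0]; rewrite /update_cov; set a := P *m l.
have aT : a^T = l^T *m P by rewrite /a trmx_mul Ps.
have c0 : 1 + quad P l != 0 by rewrite gt_eqF// ltr_wpDr.
rewrite -[l *m l^T *m P]mulmxA -aT mulmxBl !mulmxDr !mulmx1 mulmxA -/a.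
rewrite -scalemxAl mulmxA mul_outer -scalemxAl scalerA.
have -> : cdot a l = quad P l by rewrite cdotC -quadE.
move: (a *m a^T) c0 => x; set q := quad P l => c0.
apply/matrixP => i j; rewrite !mxE; field.
by rewrite -/q; exact: c0.
Qed.

Lemma update_meanE m P l : psdmx P -> (1%:M + P *m (l *m l^T)) *m update_mean m P l 0 = m.
Proof.
move=> [Ps P0]; rewrite /update_mean subr0.
have c0 : 1 + quad P l != 0 by rewrite gt_eqF// ltr_wpDr.
rewrite mulmxDl mul1mx mulmxA mul_outer cdotBr cdotZr -quadE.
move: (P *m l) c0 => x; set q := quad P l => c0; set k := cdot l m.
apply/matrixP => i j; rewrite !mxE; field.
by rewrite -/q; exact: c0.
Qed.

End update_algebra.

Section kalman.
Context {K : realType} {n : nat}.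
Variables (A R S P : 'M[K]_n.+1).

(* The pair [(U_k, V_k)] linearises the discrete Kalman filter with time step
   [h]: its covariances and means satisfy [P_k U_k = V_k] and [U_k^T m_k = m_0]. *)
Fixpoint kalman (h : K) (k : nat) : 'M[K]_n.+1 * 'M[K]_n.+1 :=
  if k is k'.+1 then
    let UV := kalman h k' in
    let U := invmx (1%:M + h *: A)^T *m (UV.1 + h *: (S *m UV.2)) in
    (U, (1%:M + h *: A) *m UV.2 + h *: (R *m U))
  else (1%:M, P).

Lemma euler_step_unit h : 0 <= h -> h * frob A <= 2^-1 -> (1%:M + h *: A) \in unitmx.
Proof.
move=> h0 hA; apply: (@ldb_unit _ _ _ 2^-1); split=> [|z]; first by rewrite invr_gt0.
rewrite quadD quad1 quadZ.
have := quad_opb z (opb_frob A); rewrite ler_norml => /andP[q _].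
have cz := cdot_ge0 z; move: q hA cz; set c := cdot z z; set q := quad A z; set f := frob A.
move=> hq hA cz; have h1 : h * - (f * c) <= h * q by rewrite ler_wpM2l.
have h2 : h * f * c <= 2^-1 * c by rewrite ler_wpM2r.
lra.
Qed.

Variables (U V : K -> 'M[K]_n.+1) (T : K).
Hypothesis T0 : 0 <= T.
Hypotheses (dU : forall t, misd U t (- A^T *m U t + S *m V t))
  (dV : forall t, misd V t (R *m U t + A *m V t)) (U0 : U 0 = 1%:M) (V0 : V 0 = P).

(** The recursion is a semi-implicit Euler scheme for (U, V): multiplied by (1 + hA)', its first
    line contains A' applied to the new U, and the second line uses the new U. Acting on a fixed
    vector [y], the errors obey an implicit linear recursion, solved for small h and closed by
    [gronwall]. *)
Let kalman_col_cvg (y : 'cV[K]_n.+1) e : 0 < e -> \forall m \near \oo,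
  enorm ((U T - (kalman (T / m%:R) m).1) *m y) + enorm ((V T - (kalman (T / m%:R) m).2) *m y) <= e.
Proof.
move=> e0; set a := frob A; set s := frob S; set r := frob R.
have a0 : 0 <= a by exact: frob_ge0.
have s0 : 0 <= s by exact: frob_ge0.
have r0 : 0 <= r by exact: frob_ge0.
pose c := a + r + s; have c0 : 0 <= c by rewrite !addr_ge0.
(* The total amplification of a local error: (1 + a) + (1 + r) from the two components, 2 from
   solving the implicit inequality, then the Gronwall factor and the total time. *)
pose L := 2 * (2 + a + r) * expR (4 * c * T) * (T + 1).
have ar : 0 < 2 + a + r by rewrite -addrA ltr_wpDr// addr_ge0.
have T1 : 0 < T + 1 by rewrite ltr_wpDl.
have L0 : 0 < L by rewrite !mulr_gt0 ?expR_gt0.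
have e'0 : 0 < e / L by rewrite divr_gt0.
set e' := e / L in e'0.
pose al t := U t *m y; pose be t := V t *m y.
pose dal t := - A^T *m al t + S *m be t; pose dbe t := R *m al t + A *m be t.
have hal t : misd al t (dal t).
  by rewrite /dal /al /be !mulmxA -mulmxDl; exact: misdMr (dU t).
have hbe t : misd be t (dbe t).
  by rewrite /dbe /al /be !mulmxA -mulmxDl; exact: misdMr (dV t).
have cdal : continuous dal.
  by move=> t; exact: misd_continuous (misdD (misdMl _ (hal t)) (misdMl _ (hbe t))).
have cdbe : continuous dbe.
  by move=> t; exact: misd_continuous (misdD (misdMl _ (hal t)) (misdMl _ (hbe t))).
have [d1 d10 hd1] := derivative_approx T hal cdal e'0.
have [d2 d20 hd2] := derivative_approx T hbe cdbe e'0.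
near=> m.
have m0 : 0 < m%:R :> K by rewrite ltr0n; near: m; exact: nbhs_infty_gt.
set h := T / m%:R; have h0 : 0 <= h by rewrite divr_ge0// ltW.
have hle d : 0 < d -> T / d <= m%:R -> h <= d.
  by move=> dp; rewrite ler_pdivrMr// => le; rewrite ler_pdivrMr// mulrC.
have hd1le : h <= d1 by apply: (hle _ d10); near: m; exact: nbhs_infty_ger.
have hd2le : h <= d2 by apply: (hle _ d20); near: m; exact: nbhs_infty_ger.
have hc : h * c <= 2^-1.
  rewrite /h mulrAC ler_pdivrMr// [leRHS]mulrC -ler_pdivrMr ?invr_gt0//.
  by near: m; exact: nbhs_infty_ger.
have mh : m%:R * h = T by rewrite /h mulrCA divff ?mulr1// gt_eqF.
have ha : h * a <= 2^-1.
  by apply: le_trans hc; rewrite ler_wpM2l// /c -addrA lerDl addr_ge0.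
pose F := 1%:M + h *: A.
have FTu : F^T \in unitmx by rewrite unitmx_tr; exact: euler_step_unit.
pose u k := enorm (al (k%:R * h) - (kalman h k).1 *m y) + enorm (be (k%:R * h) - (kalman h k).2 *m y).
have u0 : u 0%N = 0.
  by rewrite /u /al /be mul0r U0 V0 /= mul1mx !subrr !enorm0 addr0.
have step k : (k < m)%N -> u k.+1 <= (1 + 4 * (h * c)) * u k + 2 * ((2 + a + r) * (e' * h)).
  move=> km; have kh : k.+1%:R * h - k%:R * h = h by rewrite -natr1; ring.
  have pre : [/\ 0 <= k%:R * h, k%:R * h <= k.+1%:R * h & k.+1%:R * h <= T].
    split; first by rewrite mulr_ge0.
      by rewrite ler_wpM2r// ler_nat.
    by rewrite -mh ler_wpM2r// ler_nat.
  case: pre => p1 p2 p3.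
  have := hd1 _ _ p1 p2 p3; have := hd2 _ _ p1 p2 p3; rewrite kh.
  move=> /(_ hd2le)[b1 _] /(_ hd1le)[a1 a2].
  move: b1 a1 a2; rewrite /u /=; set Uk := (kalman h k).1; set Vk := (kalman h k).2.
  set U1 := invmx _ *m _; set A0 := al (k%:R * h); set A1 := al (k.+1%:R * h).
  set B0 := be (k%:R * h); set B1 := be (k.+1%:R * h) => b1 a1 a2.
  have FU : F^T *m U1 = Uk + h *: (S *m Vk) by rewrite /U1 -/F mulKVmx.
  have FTE (z : 'cV[K]_n.+1) : F^T *m z = z + h *: (A^T *m z).
    by rewrite /F linearD /= linearZ /= trmx1 mulmxDl mul1mx scalemxAl.
  have U1y : U1 *m y = Uk *m y + h *: (S *m (Vk *m y)) - h *: (A^T *m (U1 *m y)).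
    have := congr1 (mulmx^~ y) FU; rewrite -mulmxA FTE mulmxDl -scalemxAl -!mulmxA => <-.
    by rewrite addrK.
  pose x := enorm (A0 - Uk *m y); pose z := enorm (B0 - Vk *m y).
  pose x' := enorm (A1 - U1 *m y).
  set z' := enorm (B1 - _).
  have x'le : x' <= x + h * s * z + h * a * x' + (1 + a) * (e' * h).
    have xE : x' = enorm ((A0 - Uk *m y) + h *: (S *m (B0 - Vk *m y)) - h *: (A^T *m (A1 - U1 *m y))
       + ((A1 - A0 - h *: dal (k%:R * h)) + h *: (A^T *m (A1 - A0)))).
      rewrite /x' {1}U1y /dal -/A0 -/B0 !mulmxBr mulNmx; congr enorm.
      move: (A^T *m A0) (A^T *m A1) (S *m B0) (S *m (Vk *m y)) (A^T *m (U1 *m y)) (Uk *m y).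
      by move=> *; apply/matrixP => i j; rewrite !mxE; ring.
    rewrite [leLHS]xE (le_trans (enormD _ _))// lerD//.
      rewrite (le_trans (enormB _ _))// lerD//.
        rewrite (le_trans (enormD _ _))// lerD// enormZ ger0_norm// -mulrA ler_wpM2l//.
        exact: (opb_frob S).2.
      rewrite enormZ ger0_norm// -mulrA ler_wpM2l//.
      exact: (opb_tr (opb_frob A)).2.
    rewrite (le_trans (enormD _ _))// mulrDl mul1r lerD// enormZ ger0_norm//.
    rewrite (_ : a * (e' * h) = h * (a * e')); last by ring.
    rewrite ler_wpM2l// (le_trans ((opb_tr (opb_frob A)).2 _))// ler_wpM2l//.
  have z'le : z' <= z + h * a * z + h * r * x' + (1 + r) * (e' * h).
    have -> : z' = enorm ((B0 - Vk *m y) + h *: (A *m (B0 - Vk *m y)) + h *: (R *m (A1 - U1 *m y))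
       + ((B1 - B0 - h *: dbe (k%:R * h)) - h *: (R *m (A1 - A0)))).
      rewrite /z' /dbe -/A0 -/B0 !mulmxBr !mulmxDl mul1mx -!scalemxAl -!mulmxA; congr enorm.
      move: (A *m B0) (R *m A0) (R *m A1) (A *m (Vk *m y)) (R *m (U1 *m y)) (Vk *m y).
      by move=> *; apply/matrixP => i j; rewrite !mxE; ring.
    rewrite (le_trans (enormD _ _))// lerD//.
      rewrite (le_trans (enormD _ _))// lerD//.
        rewrite (le_trans (enormD _ _))// lerD// enormZ ger0_norm// -mulrA ler_wpM2l//.
        exact: (opb_frob A).2.
      rewrite enormZ ger0_norm// -mulrA ler_wpM2l//.
      exact: (opb_frob R).2.
    rewrite (le_trans (enormB _ _))// mulrDl mul1r lerD// enormZ ger0_norm//.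
    rewrite (_ : r * (e' * h) = h * (r * e')); last by ring.
    rewrite ler_wpM2l// (le_trans ((opb_frob R).2 _))// ler_wpM2l//.
  have x0 : 0 <= x by exact: enorm_ge0.
  have z0 : 0 <= z by exact: enorm_ge0.
  have x'0 : 0 <= x' by exact: enorm_ge0.
  have z'0 : 0 <= z' by exact: enorm_ge0.
  have rho0 : 0 <= (2 + a + r) * (e' * h) := mulr_ge0 (ltW ar) (mulr_ge0 (ltW e'0) h0).
  pose X := h * c; have X0 : 0 <= X by rewrite mulr_ge0.
  have hX : h * a + h * r + h * s = X by rewrite /X /c; ring.
  have q1 : 0 <= h * a by rewrite mulr_ge0.
  have q2 : 0 <= h * r by rewrite mulr_ge0.
  have q3 : 0 <= h * s by rewrite mulr_ge0.
  move: x'le z'le rho0; rewrite -/x -/z -/x' -/X.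
  rewrite (_ : (1 + a) * (e' * h) = (2 + a + r) * (e' * h) - (1 + r) * (e' * h)); last by ring.
  move: ((1 + r) * (e' * h)) ((2 + a + r) * (e' * h)) => w rho.
  move: (hc) q1 q2 q3 hX X0; rewrite -/X; move: (h * a) (h * r) (h * s) X => ea er es X Xh ea0 er0 es0 EX X0 i1 i2 rho0.
  (* The new errors occur on both sides. Since X <= 1/2, multiplying by 1 + 2X makes the left factor
     at least 1 and the right one at most 1 + 4X. *)
  have main : (1 - X) * (x' + z') <= (1 + X) * (x + z) + rho.
    have t1 : 0 <= es * x' by rewrite mulr_ge0.
    have t2 : 0 <= X * z' by rewrite mulr_ge0.
    have t3 : 0 <= (er + es) * x by rewrite mulr_ge0 ?addr_ge0.
    have t4 : 0 <= ea * x by rewrite mulr_ge0.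
    have t5 : 0 <= er * z by rewrite mulr_ge0.
    rewrite -EX in t2 *; lra.
  have y0 : 0 <= 1 - 2 * X by lra.
  have main2 : (1 + 2 * X) * ((1 - X) * (x' + z')) <= (1 + 2 * X) * ((1 + X) * (x + z) + rho).
    by rewrite ler_wpM2l//; lra.
  have m3 : x' + z' <= (1 + 2 * X) * ((1 - X) * (x' + z')).
    have := mulr_ge0 (mulr_ge0 X0 y0) (addr_ge0 x'0 z'0).
    by move=> hh; rewrite -subr_ge0 (_ : _ - _ = X * (1 - 2 * X) * (x' + z'))//; ring.
  have m4 : (1 + 2 * X) * ((1 + X) * (x + z)) <= (1 + 4 * X) * (x + z).
    have := mulr_ge0 (mulr_ge0 X0 y0) (addr_ge0 x0 z0).
    by move=> hh; rewrite -subr_ge0 (_ : _ - _ = X * (1 - 2 * X) * (x + z))//; ring.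
  have m5 : (1 + 2 * X) * rho <= 2 * rho by rewrite ler_wpM2r//; lra.
  rewrite (le_trans m3)// (le_trans main2)// mulrDr; exact: lerD.
have g1 : 0 <= 4 * (h * c) by rewrite !mulr_ge0.
have g2 : 0 <= 2 * ((2 + a + r) * (e' * h)) := mulr_ge0 (ler0n _ 2) (mulr_ge0 (ltW ar) (mulr_ge0 (ltW e'0) h0)).
have := gronwall g1 g2 _ step (leqnn m); rewrite u0 lexx => /(_ isT).
rewrite /u mh add0r !mulmxBl => /le_trans; apply.
rewrite (_ : 4 * (h * c) * m%:R = 4 * c * (m%:R * h)); last by ring.
rewrite (_ : m%:R * (2 * ((2 + a + r) * (e' * h))) = 2 * (2 + a + r) * e' * (m%:R * h)); last by ring.
rewrite mh; apply: (@le_trans _ _ (expR (4 * c * T) * (2 * (2 + a + r) * e' * (T + 1)))).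
  apply: ler_wpM2l; first exact: expR_ge0.
  apply: ler_wpM2l; last by rewrite lerDl.
  exact: mulr_ge0 (mulr_ge0 (ler0n _ 2) (ltW ar)) (ltW e'0).
rewrite le_eqVlt; apply/orP; left; apply/eqP.
rewrite (_ : expR (4 * c * T) * (2 * (2 + a + r) * e' * (T + 1)) = e' * L); last by rewrite /L; ring.
by rewrite /e' divfK// gt_eqF.
Unshelve. all: by end_near. Qed.

Lemma kalman_cvg : (fun m => (kalman (T / m%:R) m).1) @ \oo --> U T /\
  (fun m => (kalman (T / m%:R) m).2) @ \oo --> V T.
Proof.
have coord (M : 'M[K]_n.+1) i j : `|M i j| <= enorm (M *m delta_mx j 0).
  by rewrite -colE; have := coord_le_enorm (col j M) i; rewrite mxE.
have h j e e0 := kalman_col_cvg (delta_mx j 0 : 'cV_n.+1) (e0 : 0 < e).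
split; apply: cvg_mx => i j; apply/cvgrPdist_le => e e0; move: (h j e e0); apply: filterS => m;
  apply: le_trans.
  rewrite -[leLHS]addr0; apply: lerD; last exact: enorm_ge0.
  by have := coord (U T - (kalman (T / m%:R) m).1) i j; rewrite !mxE.
rewrite -[leLHS]add0r; apply: lerD; first exact: enorm_ge0.
by have := coord (V T - (kalman (T / m%:R) m).2) i j; rewrite !mxE.
Qed.

End kalman.

(** * Independent increments and the discrete-time filter *)

Section bounded_measurable.
Context {K : realType} d (T : measurableType d).

Lemma bmf_bigprod (I : Type) (s : seq I) (f : I -> T -> K) :
  (forall i, bmf (f i)) -> bmf (fun x => \prod_(i <- s) f i x).
Proof.
move=> h; elim: s => [|i s IH].
  rewrite (_ : (fun=> _) = cst 1); first exact: bmf_cst.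
  by apply/funext => x; rewrite big_nil.
rewrite (_ : (fun=> _) = fun x => f i x * \prod_(j <- s) f j x); first exact: bmfM.
by apply/funext => x; rewrite big_cons.
Qed.

Lemma measurable_fun_bigsum (I : Type) (s : seq I) (f : I -> T -> K) :
  (forall i, measurable_fun setT (f i)) -> measurable_fun setT (fun x => \sum_(i <- s) f i x).
Proof.
move=> h; elim: s => [|i s IH].
  rewrite (_ : (fun=> _) = cst 0); first exact: measurable_cst.
  by apply/funext => x; rewrite big_nil.
rewrite (_ : (fun=> _) = fun x => f i x + \sum_(j <- s) f j x); first exact: measurable_funD.
by apply/funext => x; rewrite big_cons.
Qed.

End bounded_measurable.

Lemma indep_weight (K : realType) d (T : measurableType d) (Pr : probability T K)
    d' (T' : measurableType d') (Y : T -> T') (w : T -> K) (C : K) :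
  measurable_fun setT Y -> bmf w ->
  (forall D, measurable D -> \int[Pr]_x (\1_D (Y x) * w x) = C * \int[Pr]_x \1_D (Y x)) ->
  forall f, bmf f -> \int[Pr]_x (f (Y x) * w x) = C * \int[Pr]_x f (Y x).
Proof.
move=> mY bw h f bf.
pose X : {mfun T >-> T'} := HB.pack Y (isMeasurableFun.Build _ _ _ _ Y mY).
pose mu := distribution Pr X : probability _ _.
have lawE g : bmf g -> \int[Pr]_x g (Y x) = \int[mu]_x g x.
  by apply: (law_int (mu1 := Pr) (mu2 := mu)).
transitivity (\int[mu]_x (f x * cst C x)).
  apply: (weighted_law_int (mu1 := Pr) (mu2 := mu)) => //; first exact: bmf_cst.
  move=> D mD; rewrite h// lawE; last exact: bmf_indic.
  rewrite -int_bmfZ; last exact: bmf_indic.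
  by apply: eq_Rintegral => x _; rewrite mulrC.
rewrite lawE// -int_bmfZ//.
by apply: eq_Rintegral => x _; rewrite mulrC.
Qed.

Section independent_cosines.
Context {K : realType} {d} {T : measurableType d} (Pr : probability T K) {q : nat}.
Variables (Y : nat -> T -> 'cV[K]_q) (v : K) (M : nat).
Hypothesis mY : forall i, measurable_fun setT (Y i).
Hypothesis cosY : forall i, (i < M)%N -> forall u b,
  \int[Pr]_w cos (cdot u (Y i w) + b) = expR (- (v * cdot u u) / 2) * cos b.
Hypothesis indep : forall (D : nat -> set 'cV[K]_q), (forall i, measurable (D i)) ->
  Pr (\bigcap_(i < M) [set w | D i (Y i w)]) = (\prod_(i < M) Pr [set w | D i (Y i w)])%E.

Let mD i D : measurable D -> measurable [set w | D (Y i w)].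
Proof. by move=> mD; rewrite -[X in measurable X]setTI; exact: mY. Qed.

Let p i D := fine (Pr [set w | D (Y i w)]).

Let indE i D : measurable D -> \int[Pr]_w \1_D (Y i w) = p i D.
Proof. by move=> hD; rewrite /p -int_indic; [exact: eq_Rintegral|exact: mD]. Qed.

Let indep_ind (D : nat -> set 'cV[K]_q) : (forall i, measurable (D i)) ->
  \int[Pr]_w (\prod_(0 <= i < M) \1_(D i) (Y i w)) = \prod_(0 <= i < M) p i (D i).
Proof.
move=> hD.
have e w : \prod_(0 <= i < M) \1_(D i) (Y i w) =
    \1_(\bigcap_(i < M) [set w | D i (Y i w)]) w :> K.
  rewrite indicE; case: (boolP (w \in _)) => h.
    rewrite big_seq big1// => i; rewrite mem_index_iota => /andP[_ iM].
    move: h; rewrite inE => /(_ i iM) /= Di; rewrite indicE.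
    by have -> : (Y i w \in D i) = true by apply/idP; rewrite inE.
  have [i [iM Di]] : exists i, (i < M)%N /\ ~ D i (Y i w).
    apply: contrapT => nex; move/negP: h; apply; rewrite inE => i /= iM.
    by apply: contrapT => Di; apply: nex; exists i.
  rewrite (bigD1_seq i) ?mem_index_iota ?iota_uniq//= indicE.
  have -> : (Y i w \in D i) = false by apply/negP; rewrite inE.
  by rewrite mul0r.
under eq_Rintegral do rewrite e.
transitivity (fine (\prod_(i < M) Pr [set w | D i (Y i w)])%E).
  rewrite -(indep hD); apply: int_indic.
  by apply: fin_bigcap_measurable => [|i _]; [exact: finite_II|exact: mD].
rewrite big_mkord (_ : (\prod_(i < M) _)%E = (\prod_(i < M) p i (D i))%:E)//.
elim/big_rec2 : _ => [//|i x y _ ->].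
by rewrite EFinM /p fineK// fin_num_measure//; exact: mD.
Qed.

Let E j (u : nat -> 'cV[K]_q) b w := cos (\sum_(0 <= i < j) cdot (u i) (Y i w) + b).
Let Pi j (D : nat -> set 'cV[K]_q) w : K := \prod_(j <= i < M) \1_(D i) (Y i w).

Let bE j u b : bmf (E j u b).
Proof.
apply: bmf_cos; apply: measurable_funD; last exact: measurable_cst.
apply: measurable_fun_bigsum => i; apply: measurable_fun_cdot; last exact: mY.
exact: measurable_cst.
Qed.

Let bPi j D : (forall i, measurable (D i)) -> bmf (Pi j D).
Proof. by move=> hD; apply: bmf_bigprod => i; apply: bmf_comp (mY i); exact: bmf_indic. Qed.

Let cos_shift (x : K) : cos (x - pi / 2) = sin x.
Proof. by rewrite cosB cos_pihalf sin_pihalf mulr0 add0r mulr1. Qed.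

(** Independence is given on events only. By induction the indicators are replaced by cosines one
    increment at a time: the first j variables enter through the cosine of a sum, the others through
    indicators. *)
Let joint j : (j <= M)%N -> forall u b D, (forall i, measurable (D i)) ->
  \int[Pr]_w (E j u b w * Pi j D w) =
  expR (- (v * \sum_(0 <= i < j) cdot (u i) (u i)) / 2) * cos b *
    \prod_(j <= i < M) p i (D i).
Proof.
elim: j => [_|j IH jM] u b D hD.
  rewrite [X in v * X]big_geq// mulr0 oppr0 mul0r expR0 mul1r -indep_ind// -int_bmfZ; last exact: bPi.
  by apply: eq_Rintegral => w _; rewrite /E [X in cos (X + _)]big_geq// add0r.
have {}IH := IH (ltnW jM).
set c := expR (- (v * \sum_(0 <= i < j) cdot (u i) (u i)) / 2) in IH *.
set Q := \prod_(j.+1 <= i < M) p i (D i).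
have step b' f : bmf f -> \int[Pr]_w (f (Y j w) * (E j u b' w * Pi j.+1 D w)) =
    c * cos b' * Q * \int[Pr]_w f (Y j w).
  apply: indep_weight => //; first exact: bmfM (bE _ _ _) (bPi _ hD).
  move=> D0 mD0; rewrite indE//.
  pose D' i := if i == j then D0 else D i.
  have hD' i : measurable (D' i) by rewrite /D'; case: eqP.
  have D'j i : (j < i)%N -> D' i = D i by move=> ji; rewrite /D' gtn_eqF.
  have D'0 : D' j = D0 by rewrite /D' eqxx.
  have := IH u b' D' hD'; rewrite -/c [X in _ = _ * X]big_ltn// D'0.
  rewrite (_ : \prod_(j.+1 <= i < M) p i (D' i) = Q); last first.
    by apply: eq_big_nat => i /andP[ji _]; rewrite D'j.
  rewrite (_ : c * cos b' * (p j D0 * Q) = c * cos b' * Q * p j D0) => [<-|]; last by ring.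
  apply: eq_Rintegral => w _; rewrite /Pi [in RHS]big_ltn// D'0.
  rewrite [in RHS](eq_big_nat _ _ (F2 := fun i => \1_(D i) (Y i w))); last first.
    by move=> i /andP[ji _]; rewrite D'j.
  by ring.
have cu b' : bmf (fun y : 'cV[K]_q => cos (cdot (u j) y + b')).
  by apply: bmf_cos; apply: measurable_funD; [exact: measurable_cdotl|exact: measurable_cst].
(* The addition formula, with sines written as cosines of phase shifted by -pi/2 so that the
   induction hypothesis applies to both terms; the second vanishes since the sine of a centred
   Gaussian integrates to 0. *)
have eE w : E j.+1 u b w * Pi j.+1 D w =
  cos (cdot (u j) (Y j w) + 0) * (E j u b w * Pi j.+1 D w) -
  cos (cdot (u j) (Y j w) + - (pi / 2)) * (E j u (b - pi / 2) w * Pi j.+1 D w).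
  rewrite /E big_nat_recr//=; move: (\sum_(0 <= i < j) _) (cdot _ _) (Pi _ _ _) => s t x.
  rewrite addr0 (_ : s + t + b = (s + b) + t); last by ring.
  by rewrite (addrA s b) !cos_shift cosD; ring.
under eq_Rintegral do rewrite eE.
have bb b1 b2 : bmf (fun w => cos (cdot (u j) (Y j w) + b1) * (E j u b2 w * Pi j.+1 D w)).
  by apply: bmfM (bmf_comp (cu b1) (mY j)) (bmfM (bE _ _ _) (bPi _ hD)).
rewrite int_bmfB// (step _ _ (cu 0)) (step _ _ (cu (- (pi / 2)))) !cosY//.
have -> : cos (- (pi / 2)) = 0 :> K by rewrite cosN cos_pihalf.
rewrite cos0 big_nat_recr//= mulr0 mulr0 subr0 mulr1.
rewrite mulrDr opprD mulrDl expRD -/c; ring.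
Qed.

Lemma independent_cos u b :
  \int[Pr]_w cos (\sum_(0 <= i < M) cdot (u i) (Y i w) + b) =
  expR (- (v * \sum_(0 <= i < M) cdot (u i) (u i)) / 2) * cos b.
Proof.
have := joint (leqnn M) u b (D := fun=> setT) (fun=> measurableT).
rewrite [\prod_(_ <= _ < _) p _ _]big_geq// mulr1 => <-.
by apply: eq_Rintegral => w _; rewrite /Pi big_geq// mulr1.
Qed.

End independent_cosines.

Section gaussian_updates.
Context {K : realType} {d} {T : measurableType d} (mu : {finite_measure set T -> \bar K}).
Context {n : nat} (X : T -> 'cV[K]_n).
Hypothesis mX : measurable_fun setT X.

(** The multiplicative relations for rank-one updates telescope over the list. The constant, mean
    and covariance are fixed before the phase E and the constant C, so the same update serves
    whatever future noise is carried in E. *)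
Lemma gaussian_updates (s : seq 'cV[K]_n) (w : T -> K) m P : bmf w -> psdmx P ->
  exists c m' P', [/\ 0 < c, psdmx P', P' *m (1%:M + (\sum_(l <- s) l *m l^T) *m P) = P,
    (1%:M + P *m (\sum_(l <- s) l *m l^T)) *m m' = m &
    forall (E : T -> K) C, measurable_fun setT E ->
    (forall u b, \int[mu]_x (cos (cdot u (X x) + E x + b) * w x) =
      C * (expR (- quad P u / 2) * cos (cdot u m + b))) ->
    forall u b, \int[mu]_x (cos (cdot u (X x) + E x + b) *
       (expR (- (\sum_(l <- s) cdot l (X x) ^+ 2) / 2) * w x)) =
      C * c * (expR (- quad P' u / 2) * cos (cdot u m' + b))].
Proof.
elim: s w m P => [|l s IH] w m P bw Pp.
  exists 1, m, P; rewrite !big_nil mul0mx mulmx0 addr0 mulmx1 mul1mx; split=> //.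
  move=> E C mE h u b; rewrite mulr1 -h; apply: eq_Rintegral => x _.
  by rewrite big_nil oppr0 mul0r expR0 mul1r.
pose w1 x := expR (- (cdot l (X x) - 0) ^+ 2 / 2) * w x.
have bw1 : bmf w1.
  apply: bmfM => //; split.
    apply: measurableT_comp; first exact: measurable_expR.
    apply: measurable_funM; last exact: measurable_cst.
    apply: measurableT_comp; first exact: oppr_measurable.
    apply: measurable_funX; apply: measurable_funB; last exact: measurable_cst.
    by apply: measurable_fun_cdot => //; exact: measurable_cst.
  exists 1 => x; rewrite ger0_norm ?expR_ge0// -expR0 ler_expR mulNr oppr_le0.
  by rewrite divr_ge0// sqr_ge0.
have P1p := update_cov_psd l Pp.
have [c [m' [P' [c0 P'p PE mE h]]]] := IH w1 (update_mean m P l 0) (update_cov P l) bw1 P1p.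
have PQ := update_covE l Pp; have mQ := update_meanE m l Pp.
move: PE mE; rewrite !big_cons; set Q := \sum_(l <- s) _ => PE mE.
have [Ps P0] := Pp.
have PQ' : P = (1%:M + P *m (l *m l^T)) *m update_cov P l.
  have T1 : (1%:M + l *m l^T *m P)^T = 1%:M + P *m (l *m l^T).
    by rewrite linearD /= trmx1 !trmx_mul trmxK Ps.
  by rewrite -{1}Ps -{1}PQ trmx_mul T1 P1p.1.
pose c1 := (Num.sqrt (1 + quad P l))^-1 * expR (- (cdot l m - 0) ^+ 2 / (1 + quad P l) / 2).
exists (c1 * c), m', P'; split=> //.
- by rewrite !mulr_gt0 ?expR_gt0// invr_gt0 sqrtr_gt0 ltr_wpDr.
- have -> : 1%:M + (l *m l^T + Q) *m P =
      (1%:M + Q *m update_cov P l) *m (1%:M + l *m l^T *m P).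
    by rewrite [in RHS]mulmxDl [in RHS]mul1mx -(mulmxA Q (update_cov P l)) PQ mulmxDl addrA.
  by rewrite mulmxA PE PQ.
- have -> : 1%:M + P *m (l *m l^T + Q) =
      (1%:M + P *m (l *m l^T)) *m (1%:M + update_cov P l *m Q).
    by rewrite [in RHS]mulmxDr [in RHS]mulmx1 (mulmxA _ (update_cov P l) Q) -PQ' mulmxDr addrA.
  by rewrite -mulmxA mE mQ.
move=> E C mE' hE u b.
have := h E (C * c1) mE' (gaussian_update l 0 mX mE' bw Pp hE) u b.
rewrite (mulrA C c1 c) => <-; apply: eq_Rintegral => x _.
rewrite big_cons /w1 subr0 (_ : - (_ + _) / 2 =
  - (\sum_(l0 <- s) cdot l0 (X x) ^+ 2) / 2 + - cdot l (X x) ^+ 2 / 2); last by ring.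
by rewrite expRD !mulrA.
Qed.

End gaussian_updates.

Section discrete_filter.
Context {K : realType} {n q : nat} {d} {Omega : measurableType d}.
Variables (Pr : probability Omega K) (eta : probability 'cV[K]_n.+1 K).
Variables (A R S : 'M[K]_n.+1) (B : 'M[K]_(n.+1, q)) (x0 : 'cV[K]_n.+1) (P : 'M[K]_n.+1).
Hypotheses (Sp : psdmx S) (Pp : psdmx P) (BR : B *m B^T = R) (etaP : cosdata eta x0 P).
Variables (h : K) (m : nat) (dW : nat -> Omega -> 'cV[K]_q).
Hypotheses (h0 : 0 <= h) (hA : h * frob A <= 2^-1).
Hypothesis mdW : forall i, measurable_fun setT (dW i).
Hypothesis cosW : forall (u : nat -> 'cV[K]_q) b,
  \int[Pr]_w cos (\sum_(0 <= i < m) cdot (u i) (dW i w) + b) =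
  expR (- (h * \sum_(0 <= i < m) cdot (u i) (u i)) / 2) * cos b.

Definition discrete_state (k : nat) (zw : 'cV[K]_n.+1 * Omega) : 'cV[K]_n.+1 :=
  euler A h zw.1 (fun i => B *m dW i zw.2) k.
Definition discrete_weight (k : nat) (zw : 'cV[K]_n.+1 * Omega) : K :=
  expR (- \sum_(0 <= i < k) h * potential S (discrete_state i zw)).
Let Z := discrete_state.
Let wt := discrete_weight.
Let mu := (eta \x Pr)%E : probability _ _.

Lemma measurable_discrete_state k : measurable_fun setT (Z k).
Proof.
elim: k => [|k IH]; first exact: measurable_fst.
rewrite (_ : Z k.+1 = fun zw => Z k zw + (h *: A) *m Z k zw + B *m dW k zw.2).
  apply: measurable_fun_mxD; last first.
    by apply: measurable_fun_mulmx; exact: measurableT_comp (mdW k) measurable_snd.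
  by apply: measurable_fun_mxD => //; exact: measurable_fun_mulmx.
by apply/funext => zw; rewrite /Z /discrete_state /= scalemxAl.
Qed.

Lemma bmf_discrete_weight k : bmf (wt k).
Proof.
split.
  apply: measurableT_comp; first exact: measurable_expR.
  apply: measurableT_comp; first exact: oppr_measurable.
  apply: measurable_fun_bigsum => i.
  apply: measurable_funM; first exact: measurable_cst.
  apply: measurable_funM; first exact: measurable_cst.
  by apply: measurable_fun_quad; exact: measurable_discrete_state.
exists 1 => zw; rewrite ger0_norm ?expR_ge0// -expR0 ler_expR oppr_le0.
by apply: sumr_ge0 => i _; rewrite mulr_ge0// mulr_ge0// Sp.2.
Qed.

(** The increments not yet consumed after k steps. Keeping them in the cosine expresses the joint
    law of the state and the future noise. *)
Let phase (k : nat) (u : nat -> 'cV[K]_q) (zw : 'cV[K]_n.+1 * Omega) :=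
  \sum_(k <= i < m) cdot (u i) (dW i zw.2).

Let mphase k u : measurable_fun setT (phase k u).
Proof.
apply: measurable_fun_bigsum => i; apply: measurable_fun_cdot; first exact: measurable_cst.
exact: measurableT_comp (mdW i) measurable_snd.
Qed.

Let F := 1%:M + h *: A.

(** Each step first conditions with the weight of the current state, then propagates by F = 1 + hA
    and adds noise of covariance hR. Independence of the future increments is encoded in the factor
    depending on u alone. *)
Let claim k : (k <= m)%N -> exists C mk Pk, [/\ 0 < C, psdmx Pk,
  Pk *m (kalman A R S P h k).1 = (kalman A R S P h k).2,
  ((kalman A R S P h k).1)^T *m mk = x0 &
  forall u v b, \int[mu]_zw (cos (cdot v (Z k zw) + phase k u zw + b) * wt k zw) =
    C * expR (- (h * \sum_(k <= i < m) cdot (u i) (u i)) / 2) *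
    (expR (- quad Pk v / 2) * cos (cdot v mk + b))].
Proof.
elim: k => [_|k IH km].
  exists 1, x0, P; split=> //; first by rewrite /= mulmx1.
    by rewrite /= trmx1 mul1mx.
  move=> u v b; rewrite mul1r.
  pose f zw := cos (cdot v zw.1 + phase 0 u zw + b).
  have bf : bmf f.
    apply: bmf_cos; apply: measurable_funD; last exact: measurable_cst.
    apply: measurable_funD; last exact: mphase.
    by apply: measurable_fun_cdot; [exact: measurable_cst|exact: measurable_fst].
  transitivity (\int[eta]_z \int[Pr]_w f (z, w)).
    rewrite bmf_fubini1// /Rintegral; congr fine; apply: eq_integral => zw _.
    by rewrite /wt /discrete_weight big_geq// oppr0 expR0 mulr1.
  set e := expR (- (h * _) / 2).
  transitivity (\int[eta]_z (e * cos (cdot v z + b))).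
    apply: eq_Rintegral => z _; rewrite -cosW; apply: eq_Rintegral => w _.
    by rewrite /f /phase /=; congr cos; ring.
  rewrite int_bmfZ ?etaP//; apply: bmf_cos; apply: measurable_funD; last exact: measurable_cst.
  exact: measurable_cdotl.
have [C [mk [Pk [C0 Pkp PU Um hk]]]] := IH (ltnW km).
have [N [[Ns Np] NN]] := psd_sqrt Sp.
(* The columns of this matrix split the one-step weight exp(-h (Sz, z)/2) into rank-one observations
   with value 0. *)
pose N' := Num.sqrt h *: N.
pose s := [seq col j N' | j <- index_enum 'I_n.+1].
have N'E : N' *m N'^T = h *: S.
  by rewrite /N' linearZ /= Ns -scalemxAl -scalemxAr scalerA -expr2 sqr_sqrtr// NN.
have sE : \sum_(l <- s) l *m l^T = h *: S by rewrite big_map sum_col_outer.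
have sE2 z : \sum_(l <- s) cdot l z ^+ 2 = h * quad S z.
  by rewrite big_map sum_col_sqr N'E quadZ.
have [c [m' [P' [c0 P'p PE mE hh]]]] :=
  gaussian_updates mu (measurable_discrete_state k) s mk (bmf_discrete_weight k) Pkp.
rewrite sE in PE mE.
have FTu : F^T \in unitmx by rewrite unitmx_tr; exact: euler_step_unit.
set Uk := (kalman A R S P h k).1 in PU Um *; set Vk := (kalman A R S P h k).2 in PU *.
set U1 := (kalman A R S P h k.+1).1.
have U1E : F^T *m U1 = Uk + h *: (S *m Vk) by rewrite /U1 /= mulKVmx.
have V1E : (kalman A R S P h k.+1).2 = F *m Vk + h *: (R *m U1) by [].
have UE : Uk + h *: (S *m Vk) = (1%:M + (h *: S) *m Pk) *m Uk.
  by rewrite mulmxDl mul1mx -mulmxA PU scalemxAl.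
have PUV : P' *m (Uk + h *: (S *m Vk)) = Vk by rewrite UE mulmxA PE PU.
have UTE : (Uk + h *: (S *m Vk))^T = Uk^T *m (1%:M + Pk *m (h *: S)).
  by rewrite UE trmx_mul linearD /= trmx1 trmx_mul linearZ /= Pkp.1 Sp.1.
exists (C * c), (F *m m'), (F *m P' *m F^T + h *: R); split.
- exact: mulr_gt0.
- apply: psdD; first exact: psd_conj.
  split=> [|z]; first by rewrite linearZ /= -BR trmx_mul trmxK.
  by rewrite quadZ -BR quadE -mulmxA cdot_mulmxr mulr_ge0 ?cdot_ge0.
- by rewrite V1E mulmxDl -scalemxAl -!mulmxA U1E PUV.
- have -> : U1^T *m (F *m m') = (F^T *m U1)^T *m m' by rewrite (trmx_mul F^T U1) trmxK mulmxA.
  by rewrite U1E UTE -mulmxA mE.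
move=> u v b.
(* Choosing B'v as the frequency of the k-th increment turns phase plus conditioned state into the
   next state tested against v. *)
pose u' i := if i == k then B^T *m v else u i.
have u'i i : (k < i)%N -> u' i = u i by move=> ki; rewrite /u' gtn_eqF.
have u'k : u' k = B^T *m v by rewrite /u' eqxx.
have := hh (phase k u') _ (mphase k u') (hk u') (F^T *m v) b.
rewrite big_ltn// u'k (eq_big_nat _ _ (F2 := fun i => cdot (u i) (u i))); last first.
  by move=> i /andP[ki _]; rewrite u'i.
set t := \sum_(_ <= i < m) cdot (u i) (u i).
have -> : cdot (B^T *m v) (B^T *m v) = quad R v.
  by rewrite -BR quadE cdot_mulmxl trmxK mulmxA.
move=> hx.
transitivity (C * expR (- (h * (quad R v + t)) / 2) * c *
   (expR (- quad P' (F^T *m v) / 2) * cos (cdot (F^T *m v) m' + b))).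
  rewrite -hx; apply: eq_Rintegral => zw _; rewrite sE2.
  congr (_ * _).
    congr (cos (_ + b)); rewrite /phase [in RHS]big_ltn// u'k.
    rewrite [in RHS](eq_big_nat _ _ (F2 := fun i => cdot (u i) (dW i zw.2))); last first.
      by move=> i /andP[ki _]; rewrite u'i.
    rewrite addrA; congr (_ + _); rewrite !cdot_mulmxl !trmxK -cdotDr; congr cdot.
    by rewrite /Z /discrete_state /= /F mulmxDl mul1mx scalemxAl.
  rewrite /wt /discrete_weight big_nat_recr//= -expRD; congr expR.
  by rewrite /potential -/Z; ring.
have -> : quad (F *m P' *m F^T + h *: R) v = quad P' (F^T *m v) + h * quad R v.
  by rewrite quadD quad_conj quadZ.
have -> : cdot v (F *m m') = cdot (F^T *m v) m' by rewrite cdot_mulmxl trmxK.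
have -> : - (h * (quad R v + t)) / 2 = - (h * t) / 2 + - (h * quad R v) / 2 by ring.
have -> : - (quad P' (F^T *m v) + h * quad R v) / 2 =
  - quad P' (F^T *m v) / 2 + - (h * quad R v) / 2 by ring.
by rewrite !expRD; ring.
Qed.

(** Testing against U y instead of y eliminates covariance and mean through P_m U = V and U' m = x0.
    The right side is then continuous in (U, V), so the limit needs no inverse of the discrete U. *)
Lemma discrete_filter : let UV := kalman A R S P h m in
  exists2 C, 0 < C & forall y b,
    \int[mu]_zw (cos (cdot (UV.1 *m y) (Z m zw) + b) * wt m zw) =
    C * (expR (- cdot (UV.1 *m y) (UV.2 *m y) / 2) * cos (cdot y x0 + b)).
Proof.
have [C [mk [Pk [C0 Pkp PU Um hk]]]] := claim (leqnn m).
move=> UV; exists C => // y b.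
have := hk (fun=> 0) (UV.1 *m y) b; rewrite -/UV in PU Um *.
rewrite [X in h * X]big_geq// mulr0 oppr0 mul0r expR0 mulr1.
rewrite quadE mulmxA PU (cdot_mulmxl _ y mk) Um => <-.
by apply: eq_Rintegral => zw _; rewrite /phase big_geq// addr0.
Qed.

End discrete_filter.

Lemma Rint_gt0 (K : realType) d (T : measurableType d) (mu : probability T K) (f : T -> K) :
  bmf f -> (forall x, 0 < f x) -> 0 < \int[mu]_x f x.
Proof.
move=> bf f0; have int0 : 0 <= \int[mu]_x f x by apply: Rintegral_ge0 => x _; exact: ltW.
rewrite lt_neqAle int0 andbT eq_sym; apply/eqP => I0.
have If := bmf_int mu bf.
have E0 : (\int[mu]_x `|(f x)%:E| = 0)%E.
  have -> : (\int[mu]_x `|(f x)%:E| = \int[mu]_x (f x)%:E)%E.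
    by apply: eq_integral => x _; rewrite gee0_abs// lee_fin ltW.
  by rewrite -[LHS]fineK ?integrable_fin_num//; congr (_%:E).
have mf : measurable_fun setT (EFin \o f) by case/integrableP: If.
have /(ae_eq_integral_abs mu measurableT mf) [N [mN N0 sub]] := E0.
have : mu setT = 0%E.
  apply/eqP; rewrite eq_le measure_ge0 andbT -N0 le_measure ?inE//.
  by move=> x _; apply: sub => /= /(_ I) [] /eqP; rewrite gt_eqF.
by rewrite probability_setT => /eqP; rewrite onee_eq0.
Qed.

(** * Weighted image laws and convergence along paths *)

Section weighted_law.
Context {K : realType} {d} {T : measurableType d} {d'} {T' : measurableType d'}.
Variables (mu : probability T K) (X : T -> T') (w : T -> K).
Hypotheses (mX : measurable_fun setT X) (bw : bmf w) (w0 : forall x, 0 <= w x).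
Hypothesis w1 : \int[mu]_x w x = 1.

Definition weighted_law (D : set T') : \bar K := (\int[mu]_(x in X @^-1` D) (w x)%:E)%E.

Let mXD D : measurable D -> measurable (X @^-1` D).
Proof. by move=> mD; rewrite -[X in measurable X]setTI; exact: mX. Qed.

Let weighted_law0 : weighted_law set0 = 0%E.
Proof. by rewrite /weighted_law preimage_set0 integral_set0. Qed.

Let weighted_law_ge0 D : (0 <= weighted_law D)%E.
Proof. by apply: integral_ge0 => x _; rewrite lee_fin. Qed.

Let weighted_law_sigma_additive : semi_sigma_additive weighted_law.
Proof.
move=> F mF tF mUF; rewrite /weighted_law preimage_bigcup ge0_integral_bigcup//; last first.
- apply/trivIsetP => i j _ _ ij; rewrite -preimage_setI.
  by move/trivIsetP : tF => /(_ i j Logic.I Logic.I ij) ->; rewrite preimage_set0.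
- by move=> x _; rewrite lee_fin.
- by apply: measurable_funTS; apply/measurable_EFinP; case: bw.
- by move=> k; exact: mXD.
by apply: is_cvg_ereal_nneg_natsum_cond => k _ _; exact: weighted_law_ge0.
Qed.

HB.instance Definition _ := isMeasure.Build _ _ _ weighted_law
  weighted_law0 weighted_law_ge0 weighted_law_sigma_additive.

Let weighted_law_setT : weighted_law setT = 1%E.
Proof.
rewrite /weighted_law preimage_setT -w1 /Rintegral fineK//.
by apply: integrable_fin_num => //; exact: bmf_int.
Qed.

HB.instance Definition _ := Measure_isProbability.Build _ _ _ weighted_law weighted_law_setT.

(** Needed to show that the set from which [fk_flow] picks its value is not empty. *)
Lemma weighted_law_ex : exists nu : probability T' K,
  forall f, bmf f -> \int[nu]_y f y = \int[mu]_x (f (X x) * w x).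
Proof.
exists weighted_law => f bf.
pose nu : probability T' K := weighted_law.
have b1 : bmf (cst 1 : T' -> K) by exact: bmf_cst.
have h : forall D, measurable D ->
    \int[mu]_x (\1_D (X x) * w x) = \int[nu]_y (\1_D y * cst 1 y).
  move=> D mD; transitivity (fine (weighted_law D)).
    rewrite /Rintegral /weighted_law [in RHS]integral_mkcond; congr fine.
    apply: eq_integral => x _; rewrite /patch indicE.
    have -> : (X x \in D) = (x \in X @^-1` D) by apply/idP/idP; rewrite !inE.
    by case: ifP; rewrite ?mul1r ?mul0r.
  rewrite -(int_indic nu mD); apply: eq_Rintegral => y _; by rewrite mulr1.
rewrite (weighted_law_int mX bw b1 h bf).
by apply: eq_Rintegral => y _; rewrite mulr1.
Qed.

End weighted_law.

Section path_integrals.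
Context {K : realType} {n : nat}.
Variables (S : 'M[K]_n) (T : K).
Hypotheses (Ss : S^T = S) (T0 : 0 <= T).

Lemma potential_continuous (y : K -> 'cV[K]_n) : {within `[0, +oo[, continuous y} ->
  continuous (fun u : K => potential S (y ((u + `|u|) / 2))).
Proof.
move=> /within_half_line cy u; rewrite /potential.
have h : (fun v : K => quad S (y ((v + `|v|) / 2))) @ u --> quad S (y ((u + `|u|) / 2)).
  apply: (@cvg_mx_coord K _ _ _ _ _ (fun v : K => (y ((v + `|v|) / 2))^T *m S *m y ((v + `|v|) / 2))).
  apply: cvg_mulmx; last exact: cy.
  apply: cvg_mulmx; last exact: cvg_cst.
  apply: cvg_mx => i j; rewrite mxE.
  have c1 := @cvg_mx_coord K _ (nbhs u) _ _ _ (fun v : K => y ((v + `|v|) / 2)) _ j i (cy u).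
  rewrite (_ : (fun v : K => _) = (fun v : K => y ((v + `|v|) / 2) j i)); first exact: c1.
  by apply/funext => v; rewrite mxE.
by apply: cvgM; [exact: cvg_cst|exact: h].
Qed.

Lemma potential_integralE (y : K -> 'cV[K]_n) :
  \int[lebesgue_measure]_(u in `[0, T]) potential S (y u) =
  \int[lebesgue_measure]_(u in `[0, T]) potential S (y ((u + `|u|) / 2)).
Proof.
by apply: eq_Rintegral => u; rewrite inE/= in_itv/= => /andP[u0 _]; rewrite half_lineE.
Qed.

Lemma potential_riemann (y : K -> 'cV[K]_n) : {within `[0, +oo[, continuous y} ->
  (fun m : nat => \sum_(0 <= k < m) T / m%:R * potential S (y (k%:R * (T / m%:R)))) @ \oo -->
  \int[lebesgue_measure]_(u in `[0, T]) potential S (y u).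
Proof.
move=> cy; apply/cvgrPdist_le => e e0; rewrite potential_integralE.
move: (riemann_sum (potential_continuous cy) T0 e0); apply: filterS => m; apply: le_trans.
rewrite le_eqVlt; apply/orP; left; apply/eqP; congr (`|_ - _|).
rewrite big_mkord; apply: eq_bigr => k _; rewrite half_lineE//.
by rewrite mulr_ge0// divr_ge0.
Qed.

Lemma measurable_potential_integral d (Omega : measurableType d) (Y : K -> Omega -> 'cV[K]_n) :
  (forall s, 0 <= s -> measurable_fun setT (Y s)) ->
  (forall w, {within `[0, +oo[, continuous (fun s => Y s w)}) ->
  measurable_fun setT (fun w => \int[lebesgue_measure]_(u in `[0, T]) potential S (Y u w)).
Proof.
move=> mY cY; apply: (@measurable_fun_cvg _ _ _ _
  (fun (m : nat) w => \sum_(0 <= k < m) T / m%:R * potential S (Y (k%:R * (T / m%:R)) w))).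
  move=> m.
  apply: measurable_sum => k.
  apply: measurable_funM; first exact: measurable_cst.
  apply: measurable_funM; first exact: measurable_cst.
  by apply: measurable_fun_quad; apply: mY; rewrite mulr_ge0// divr_ge0.
by move=> w _; exact: (potential_riemann (cY w)).
Qed.

Lemma potential_integral_ge0 (y : K -> 'cV[K]_n) : psdmx S ->
  0 <= \int[lebesgue_measure]_(u in `[0, T]) potential S (y u).
Proof.
by move=> [_ h]; apply: Rintegral_ge0 => u _; rewrite mulr_ge0.
Qed.

Lemma quad_lipschitz s (z x : 'cV[K]_n) r e : opb S s -> enorm x <= r -> e <= 1 ->
  enorm (x - z) <= e -> `|potential S x - potential S z| <= s * (r + 1) * e.
Proof.
move=> Sb xr e1 xz; have s0 := opb_ge0 Sb.
have r0 : 0 <= r := le_trans (enorm_ge0 _) xr.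
have e0 : 0 <= e := le_trans (enorm_ge0 _) xz.
have -> : potential S x - potential S z = cdot (x - z) (S *m x) - 2^-1 * quad S (x - z).
  set v := x - z.
  have qz : quad S z = quad S x - 2 * cdot v (S *m x) + quad S v.
    have -> : z = x + - v by rewrite /v opprB addrC subrK.
    rewrite quadcD// mulmxN cdotNr mulrN; congr (_ - _ * _ + _).
      by rewrite -(sym_cdot x v Ss) cdotC.
    by rewrite !quadE mulmxN cdotNr cdotNl opprK.
  by rewrite /potential qz; field.
rewrite (le_trans (ler_normB _ _))//.
have h1 : `|cdot (x - z) (S *m x)| <= e * (s * r).
  rewrite (le_trans (cdot_le _ _))// ler_pM ?enorm_ge0//.
  by rewrite (le_trans (Sb.2 _))// ler_wpM2l.
have h2 : `|2^-1 * quad S (x - z)| <= s * e.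
  rewrite normrM ger0_norm ?invr_ge0// (le_trans _ (_ : 1 * (s * e ^+ 2) <= _))//.
    apply: ler_pM; rewrite ?invr_ge0//; first by rewrite invf_le1 ?ler1n.
    rewrite (le_trans (quad_opb _ Sb))// ler_wpM2l// -enorm_sqr lerXn2r ?nnegrE ?enorm_ge0//.
  by rewrite mul1r ler_wpM2l// expr2 -[leRHS]mul1r ler_wpM2r.
rewrite (le_trans (lerD h1 h2))// le_eqVlt; apply/orP; left; apply/eqP; ring.
Qed.

Lemma path_bounded (y : K -> 'cV[K]_n) : {within `[0, +oo[, continuous y} ->
  exists2 r, 0 <= r & forall t, 0 <= t <= T -> enorm (y t) <= r.
Proof.
move=> /within_half_line cy.
have ex i : exists c, forall t, 0 <= t <= T -> `|y t i 0| <= c.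
  have ci : continuous (fun u : K => y ((u + `|u|) / 2) i 0).
    by move=> u; apply: cvg_mx_coord; exact: cy.
  have ci2 : {within `[0, T], continuous (fun u : K => y ((u + `|u|) / 2) i 0)}.
    exact: continuous_subspaceT.
  have [a _ ha] := @EVT_max K _ 0 T T0 ci2; have [b _ hb] := @EVT_min K _ 0 T T0 ci2.
  exists (`|y ((a + `|a|) / 2) i 0| + `|y ((b + `|b|) / 2) i 0|) => t /[dup] t01 /andP[t0 _].
  have := ha t; have := hb t; rewrite in_itv /= t01 (half_lineE t0) => /(_ isT) h1 /(_ isT) h2.
  rewrite ler_norml; apply/andP; split.
    rewrite opprD (le_trans _ h1)// -[leRHS]add0r; apply: lerD; first by rewrite oppr_le0.
    by rewrite lerNl (le_trans (ler_norm _))// normrN.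
  by rewrite (le_trans h2)// (le_trans (ler_norm _))// lerDl.
have [c hc] := choice ex.
exists (n%:R * \sum_i `|c i|); first by rewrite mulr_ge0// sumr_ge0.
move=> t t01; apply: enorm_le_coord => [|i]; first exact: sumr_ge0.
rewrite (le_trans (hc i t t01))// (le_trans (ler_norm _))// (bigD1 i)//= lerDl.
exact: sumr_ge0.
Qed.

(** The action of the Euler path is compared with the Riemann sum along the true path: the latter is
    bounded on [0, T], the potential is Lipschitz near a bounded set, and the scheme converges
    uniformly over the grid. *)
Lemma euler_action_cvg (A : 'M[K]_n) (y N : K -> 'cV[K]_n) :
  {within `[0, +oo[, continuous y} -> approx_solution A y N T ->
  let Z m := euler A (T / m%:R) (y 0)
      (fun k => N (k.+1%:R * (T / m%:R)) - N (k%:R * (T / m%:R))) in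
  (fun m => Z m m) @ \oo --> y T /\
  (fun m => \sum_(0 <= k < m) T / m%:R * potential S (Z m k)) @ \oo -->
    \int[lebesgue_measure]_(u in `[0, T]) potential S (y u).
Proof.
move=> cy sol Z; split.
  apply: cvg_mx => i j; apply/cvgrPdist_le => e e0; near=> m.
  have m0 : 0 < m%:R :> K by rewrite ltr0n; near: m; exact: nbhs_infty_gt.
  have mT : m%:R * (T / m%:R) = T by rewrite mulrCA divff ?mulr1// gt_eqF.
  have h : forall k, (k <= m)%N -> enorm (y (k%:R * (T / m%:R)) - Z m k) <= e.
    by near: m; exact: euler_cvg.
  have := h m (leqnn m); rewrite mT; apply: le_trans.
  by rewrite (ord1 j); have := coord_le_enorm (y T - Z m m) i; rewrite !mxE.
have [r r0 hr] := path_bounded cy.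
have Sb := opb_frob S; set s := frob S in Sb; have s0 := opb_ge0 Sb.
apply/cvgrPdist_le => e e0.
pose L := T * (s * (r + 1)) + 1.
have L0 : 0 < L by rewrite ltr_wpDl// !mulr_ge0// addr_ge0.
(* The cap at 1 is required by [quad_lipschitz]; the other entry makes the summed error at most e/2,
   the rest being left to the Riemann sum. *)
pose e' := Num.min 1 (e / 2 / L).
have e'0 : 0 < e' by rewrite lt_min ltr01 !divr_gt0.
have e'1 : e' <= 1 by rewrite ge_min lexx.
have e'L : e' <= e / 2 / L by rewrite ge_min lexx orbT.
have e20 : 0 < e / 2 by rewrite divr_gt0.
near=> m.
have m0 : 0 < m%:R :> K by rewrite ltr0n; near: m; exact: nbhs_infty_gt.
have h : forall k, (k <= m)%N -> enorm (y (k%:R * (T / m%:R)) - Z m k) <= e'.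
  by near: m; exact: euler_cvg.
have hR : `|\int[lebesgue_measure]_(u in `[0, T]) potential S (y u) -
    \sum_(0 <= k < m) T / m%:R * potential S (y (k%:R * (T / m%:R)))| <= e / 2.
  by near: m; have /cvgrPdist_le := potential_riemann cy; exact.
set I := \int[_]_(_ in _) _ in hR *.
rewrite -[I](subrK (\sum_(0 <= k < m) T / m%:R * potential S (y (k%:R * (T / m%:R))))) -addrA.
rewrite (le_trans (ler_normD _ _))// [leRHS]splitr lerD// -sumrB.
have hm : 0 <= T / m%:R by rewrite divr_ge0// ltW.
apply: (@le_trans _ _ (\sum_(0 <= k < m) T / m%:R * (s * (r + 1) * e'))).
  rewrite (le_trans (ler_norm_sum _ _ _))// big_seq [leRHS]big_seq; apply: ler_sum => k.
  rewrite mem_index_iota => /andP[_ km]; rewrite -mulrBr normrM (ger0_norm hm) ler_wpM2l//.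
  apply: (quad_lipschitz Sb) => //; last by apply: h; exact: ltnW.
  apply: hr; rewrite mulr_ge0//= -[leRHS](_ : m%:R * (T / m%:R) = T).
    by rewrite ler_wpM2r// ler_nat ltnW.
  by rewrite mulrCA divff ?mulr1// gt_eqF.
rewrite sumr_const_nat subn0 -[_ *+ m]mulr_natl mulrA (_ : m%:R * (T / m%:R) = T); last first.
  by rewrite mulrCA divff ?mulr1// gt_eqF.
apply: (@le_trans _ _ (L * e')); last by rewrite mulrC -ler_pdivlMr.
by rewrite mulrA ler_wpM2r ?(ltW e'0)// lerDl ler01.
Unshelve. all: by end_near. Qed.

End path_integrals.

Lemma ae_imp (K : realType) d (T : measurableType d) (mu : {measure set T -> \bar K})
    (P Q : T -> Prop) :
  {ae mu, forall x, P x} -> (forall x, P x -> Q x) -> {ae mu, forall x, Q x}.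
Proof. by move=> h PQ; exact: (filterS PQ h). Qed.

Lemma ae_and (K : realType) d (T : measurableType d) (mu : {measure set T -> \bar K})
    (P Q : T -> Prop) :
  {ae mu, forall x, P x} -> {ae mu, forall x, Q x} -> {ae mu, forall x, P x /\ Q x}.
Proof. by move=> h1 h2; exact: (filterI h1 h2). Qed.

Lemma ae_eq_Rintegral (K : realType) d (T : measurableType d) (mu : {measure set T -> \bar K})
    (f g : T -> K) : measurable_fun setT f -> measurable_fun setT g ->
  {ae mu, forall x, f x = g x} -> \int[mu]_x f x = \int[mu]_x g x.
Proof.
move=> mf mg fg; rewrite /Rintegral; congr fine; apply: ae_eq_integral => //.
- exact/measurable_EFinP.
- exact/measurable_EFinP.
- by apply: (ae_imp fg) => x -> _.
Qed.

(** The exceptional null set may depend on z. Convergence is therefore used first in w for fixed z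
    and then in z, by two dominated convergences. *)
Lemma Rint_prod_cvg (K : realType) d1 (T1 : measurableType d1) d2 (T2 : measurableType d2)
    (mu1 : probability T1 K) (mu2 : probability T2 K)
    (f_ : nat -> T1 * T2 -> K) (f : T1 * T2 -> K) (M : K) :
  (forall m, measurable_fun setT (f_ m)) -> bmf f -> (forall m x, `|f_ m x| <= M) ->
  (forall z, {ae mu2, forall w, (fun m => f_ m (z, w)) @ \oo --> f (z, w)}) ->
  (fun m => \int[(mu1 \x mu2)%E]_x f_ m x) @ \oo --> \int[mu1]_z \int[mu2]_w f (z, w).
Proof.
move=> mf_ bf fM cf.
have bf_ m : bmf (f_ m) by split; [exact: mf_|exists M].
rewrite (_ : (fun m => _) = fun m => \int[mu1]_z \int[mu2]_w f_ m (z, w)); last first.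
  by apply/funext => m; rewrite (bmf_fubini1 mu1 mu2 (bf_ m)).
apply: (@Rint_cvg _ _ _ mu1 _ _ M).
- by move=> m; have [] := bmf_int_section mu1 mu2 (bf_ m).
- by have [] := bmf_int_section mu1 mu2 bf.
- apply: aeW => z; apply: (@Rint_cvg _ _ _ mu2 _ _ M).
  + by move=> m; have [] := bmf_section1 (bf_ m) z.
  + by have [] := bmf_section1 bf z.
  + exact: cf.
  + by move=> m w.
- move=> m z; have bs := bmf_section1 (bf_ m) z.
  apply: le_trans (le_normr_Rintegral measurableT (bmf_int mu2 bs)) _.
  have := @le_Rintegral _ _ _ mu2 setT (fun w => `|f_ m (z, w)|) (cst M) measurableT.
  have -> : \int[mu2]_w cst M w = M.
    transitivity (M * fine (mu2 setT)); first exact: Rintegral_cst.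
    by rewrite probability_setT mulr1.
  apply => //.
  + by have := integrable_abse (bmf_int mu2 bs); apply: eq_integrable => // w _.
  + by apply: bmf_int; exact: bmf_cst.
Qed.

Lemma cvg_cdot (K : realType) n (u v : nat -> 'cV[K]_n) (a b : 'cV[K]_n) :
  u @ \oo --> a -> v @ \oo --> b -> (fun m => cdot (u m) (v m)) @ \oo --> cdot a b.
Proof.
move=> ua vb; rewrite cdotE.
have h i : (fun m => u m i 0 * v m i 0) @ \oo --> a i 0 * b i 0.
  apply: cvgM.
    exact: (@cvg_mx_coord K nat \oo _ n 1 u a i 0 ua).
  exact: (@cvg_mx_coord K nat \oo _ n 1 v b i 0 vb).
have hs := @cvg_bigsum K nat \oo _ n (fun i m => u m i 0 * v m i 0) _ h.
rewrite (_ : (fun m => cdot (u m) (v m)) = fun m => \sum_i u m i 0 * v m i 0); first exact: hs.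
by apply/funext => m; rewrite cdotE.
Qed.

(** * The Feynman-Kac flow of a Gaussian law *)

Section feynman_kac_gaussian.
Context {K : realType} {n q : nat} {d} {Omega : measurableType d}.
Variables (Pr : probability Omega K) (A R S : 'M[K]_n.+1) (B : 'M[K]_(n.+1, q.+1)).
Variables (W : K -> Omega -> 'cV[K]_q.+1) (X : 'cV[K]_n.+1 -> K -> Omega -> 'cV[K]_n.+1).
Hypotheses (Sp : psdmx S) (BR : B *m B^T = R).
Hypotheses (bW : brownian Pr W) (dX : linear_diffusion Pr A B W X).
Variables (T : K).
Hypothesis T0 : 0 < T.
Let T0' : 0 <= T := ltW T0.
Let Ss : S^T = S := Sp.1.

(** A jointly measurable version of the diffusion: the deterministic flow of the starting point plus
    the noise response started from 0. For each z it agrees with [X z] almost surely ([XY]), by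
    uniqueness for a common driving path. *)
Let Y (zw : 'cV[K]_n.+1 * Omega) (s : K) := expmx (s *: A) *m zw.1 + X 0 s zw.2.
Let action (y : K -> 'cV[K]_n.+1) := \int[lebesgue_measure]_(u in `[0, T]) potential S (y u).
Let wt zw := expR (- action (Y zw)).

Let mY s : 0 <= s -> measurable_fun setT (fun zw => Y zw s).
Proof.
move=> s0; apply: measurable_fun_mxD.
  by apply: measurable_fun_mulmx; exact: measurable_fst.
exact: measurableT_comp (diffusion_measurable dX 0 s0) measurable_snd.
Qed.

Let cY zw : {within `[0, +oo[, continuous (Y zw)}.
Proof.
have /subspace_continuousP h := diffusion_continuous dX (x := 0) (w := zw.2).
apply/subspace_continuousP => s s0; apply: cvgD; last exact: h.
have hc := misd_continuous (misdMr zw.1 (@expmx_misd K n A s)).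
by move=> V /hc hV; exact: (@filterS _ (nbhs s) _ _ _ (fun v hv _ => hv) hV).
Qed.

Let bwt : bmf wt.
Proof.
split.
  apply: measurableT_comp; first exact: measurable_expR.
  apply: measurableT_comp; first exact: oppr_measurable.
  exact: (@measurable_potential_integral K _ S T T0' _ _ (fun s zw => Y zw s)).
exists 1 => zw; rewrite ger0_norm ?expR_ge0// -expR0 ler_expR oppr_le0.
exact: potential_integral_ge0.
Qed.

Let sol_diffusion z : {ae Pr, forall w, approx_solution A (X z ^~ w) (fun s => B *m W s w) T /\
  X z 0 w = z}.
Proof.
have h1 := diffusion_eq dX z; have h2 := brownian0 bW.
apply: (ae_imp (ae_and h1 h2)) => w [e1 e2]; split.
  exact: integral_approx_solution (diffusion_continuous dX (x := z) (w := w)) e1.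
rewrite (e1 0 (lexx _)) e2 mulmx0 addr0 (_ : \col_i _ = 0) ?addr0//.
by apply/matrixP => i j; rewrite !mxE set_itv1 Rintegral_set1.
Qed.

Let sol_Y z : {ae Pr, forall w, approx_solution A (Y (z, w)) (fun s => B *m W s w) T /\
  Y (z, w) 0 = z}.
Proof.
apply: (ae_imp (sol_diffusion 0)) => w [h1 h2]; split; last first.
  by rewrite /Y /= expmx0 mul1mx h2 addr0.
have := approx_solutionD (@expmx_approx_solution K n A z T) h1.
have -> : (fun t => 0 + B *m W t w) = (fun t => B *m W t w).
  by apply/funext => t; rewrite add0r.
move=> hh; exact: hh.
Qed.

Let approx_le (A1 : 'M[K]_n.+1) y N t : 0 <= t <= T -> approx_solution A1 y N T ->
  approx_solution A1 y N t.
Proof.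
move=> /andP[_ tT] h e e0; have [d0 d00 hd] := h e e0; exists d0 => // s s' s0 ss st sd.
by apply: hd => //; exact: le_trans tT.
Qed.

Let XY z : {ae Pr, forall w, forall s, 0 <= s <= T -> X z s w = Y (z, w) s}.
Proof.
apply: (ae_imp (ae_and (sol_diffusion z) (sol_Y z))) => w [[h1 h2] [h3 h4]] s s01.
apply: (@approx_solution_uniq K n.+1 A (X z ^~ w) (Y (z, w)) (fun s => B *m W s w)).
- by case/andP: s01.
- exact: (approx_le s01 h1).
- exact: (approx_le s01 h3).
- by rewrite h2 h4.
Qed.

Let semigroupE f z : bmf f -> fk_semigroup Pr S X T f z = \int[Pr]_w (f (Y (z, w) T) * wt (z, w)).
Proof.
move=> bf.
have b1 : bmf (fun zw => f (Y zw T) * wt zw).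
  by apply: bmfM => //; apply: bmf_comp bf _; exact: mY.
apply: ae_eq_Rintegral.
- apply: measurable_funM.
    by apply: measurableT_comp; [case: bf|exact: (diffusion_measurable dX)].
  apply: measurableT_comp; first exact: measurable_expR.
  apply: measurableT_comp; first exact: oppr_measurable.
  apply: (@measurable_potential_integral K _ S T T0' _ _ (X z)).
    by move=> s s0; exact: (diffusion_measurable dX).
  by move=> w; exact: (diffusion_continuous dX).
- by have [] := bmf_section1 b1 z.
apply: (ae_imp (XY z)) => w h.
have hT := h T; rewrite lexx T0' in hT; rewrite (hT isT); congr (_ * expR (- _)).
by apply: eq_Rintegral => u; rewrite inE/= in_itv/= => u01; rewrite (h u u01).
Qed.

Let incr_independent (m : nat) : let h := T / m%:R in (0 < m)%N ->
  forall (u : nat -> 'cV[K]_q.+1) b,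
  \int[Pr]_w cos (\sum_(0 <= i < m) cdot (u i) (W (i.+1%:R * h) w - W (i%:R * h) w) + b) =
  expR (- (h * \sum_(0 <= i < m) cdot (u i) (u i)) / 2) * cos b.
Proof.
move=> h m0.
have h0 : 0 < h by rewrite divr_gt0 ?ltr0n.
have mW i : measurable_fun setT (fun w => W (i.+1%:R * h) w - W (i%:R * h) w).
  by apply: measurable_fun_mxB; apply: (brownian_measurable bW); rewrite mulr_ge0// ltW.
apply: (@independent_cos K _ _ Pr _ (fun i w => W (i.+1%:R * h) w - W (i%:R * h) w) h m mW).
  move=> i _ u b; have kh : i.+1%:R * h - i%:R * h = h by rewrite -natr1; ring.
  have g := brownian_gaussian bW (s := i%:R * h) (t := i.+1%:R * h).
  rewrite kh in g.
  have ps : psdmx (h%:M : 'M[K]_q.+1).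
    split=> [|z]; first by rewrite tr_scalar_mx.
    by rewrite -scalemx1 quadZ quad1 mulr_ge0 ?cdot_ge0// ltW.
  rewrite (gaussian_law_cos ps (mW i) (g _ _)).
  - by rewrite cdot0r add0r -scalemx1 quadZ quad1.
  - by rewrite mulr_ge0// ltW.
  - by rewrite ltr_pM2r// ltr_nat.
move=> D mD; have := brownian_independent bW m (s := fun i => i%:R * h) (D := D).
by apply => //; [rewrite mul0r|move=> i; rewrite ler_wpM2r ?(ltW h0)// ler_nat].
Qed.

Variables (eta : probability 'cV[K]_n.+1 K) (x0 : 'cV[K]_n.+1) (P : 'M[K]_n.+1).
Hypotheses (Pp : psdmx P) (etaP : cosdata eta x0 P).
Variables (U V : K -> 'M[K]_n.+1).
Hypotheses (dU : forall t, misd U t (- A^T *m U t + S *m V t))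
  (dV : forall t, misd V t (R *m U t + A *m V t)) (U0 : U 0 = 1%:M) (V0 : V 0 = P).
Hypothesis UT : U T \in unitmx.

Let mu := (eta \x Pr)%E : probability _ _.
Let incr (m i : nat) (w : Omega) := W (i.+1%:R * (T / m%:R)) w - W (i%:R * (T / m%:R)) w.
Let Zd (m k : nat) := discrete_state A B (T / m%:R) (incr m) k.
Let wd (m : nat) := discrete_weight A S B (T / m%:R) (incr m) m.
Let Um m := (kalman A R S P (T / m%:R) m).1.
Let Vm m := (kalman A R S P (T / m%:R) m).2.

Let h0 (m : nat) : 0 <= T / m%:R. Proof. by rewrite divr_ge0. Qed.

Let mincr m i : measurable_fun setT (incr m i).
Proof. by apply: measurable_fun_mxB; apply: (brownian_measurable bW); rewrite mulr_ge0. Qed.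

Let UVcvg := kalman_cvg T0' dU dV U0 V0.

Let f_ y b m zw := cos (cdot (Um m *m y) (Zd m m zw) + b) * wd m zw.
Let f y b zw := cos (cdot (U T *m y) (Y zw T) + b) * wt zw.

Let bf y b : bmf (f y b).
Proof.
apply: bmfM; last exact: bwt.
apply: bmf_cos; apply: measurable_funD; last exact: measurable_cst.
by apply: measurable_fun_cdot; [exact: measurable_cst|exact: mY].
Qed.

Let bf_ y b m : bmf (f_ y b m).
Proof.
apply: bmfM; last exact: bmf_discrete_weight.
apply: bmf_cos; apply: measurable_funD; last exact: measurable_cst.
by apply: measurable_fun_cdot; [exact: measurable_cst|exact: measurable_discrete_state].
Qed.

Let wd_le1 m zw : `|wd m zw| <= 1.
Proof.
rewrite ger0_norm ?expR_ge0// -expR0 ler_expR oppr_le0.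
by apply: sumr_ge0 => i _; rewrite mulr_ge0// mulr_ge0// Sp.2.
Qed.

Let integral_cvg y b : (fun m => \int[mu]_zw f_ y b m zw) @ \oo -->
  \int[eta]_z \int[Pr]_w f y b (z, w).
Proof.
apply: (@Rint_prod_cvg _ _ _ _ _ eta Pr (f_ y b) (f y b) 1).
- by move=> m; case: (bf_ y b m).
- exact: bf.
- move=> m zw; rewrite normrM -[leRHS]mulr1; apply: ler_pM => //.
  by rewrite ler_norml cos_geN1 cos_le1.
move=> z; apply: (ae_imp (sol_Y z)) => w [sol Y0].
have [c1 c2] := euler_action_cvg Ss T0' (@cY (z, w)) sol.
have ZE m k : Zd m k (z, w) = euler A (T / m%:R) (Y (z, w) 0)
    (fun k => B *m W (k.+1%:R * (T / m%:R)) w - B *m W (k%:R * (T / m%:R)) w) k.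
  rewrite Y0 /Zd /discrete_state /=; congr (euler _ _ _ _ _).
  by apply/funext => i; rewrite mulmxBr.
have e1 : (fun m => f_ y b m (z, w)) = (fun m => cos (cdot (Um m *m y)
    (euler A (T / m%:R) (Y (z, w) 0)
    (fun k => B *m W (k.+1%:R * (T / m%:R)) w - B *m W (k%:R * (T / m%:R)) w) m) + b) *
    expR (- \sum_(0 <= k < m) T / m%:R * potential S (euler A (T / m%:R) (Y (z, w) 0)
    (fun k => B *m W (k.+1%:R * (T / m%:R)) w - B *m W (k%:R * (T / m%:R)) w) k))).
  apply/funext => m; rewrite /f_ ZE; congr (_ * expR (- _)).
  by apply: eq_bigr => k _; rewrite -ZE.
rewrite e1; apply: cvgM.
  apply: (@continuous_cvg _ _ _ \oo _ _ (cos : K -> K)).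
    exact: continuous_cos.
  apply: cvgD; last exact: cvg_cst.
  by apply: cvg_cdot => //; apply: cvg_mulmx; [exact: UVcvg.1|exact: cvg_cst].
apply: (@continuous_cvg _ _ _ \oo _ _ (expR : K -> K)).
  exact: continuous_expR.
by apply: cvgN.
Qed.

Let J := \int[eta]_z \int[Pr]_w f 0 0 (z, w).

Let fE0 zw : f 0 0 zw = wt zw.
Proof. by rewrite /f mulmx0 cdot0l addr0 cos0 mul1r. Qed.

Let J0 : 0 < J.
Proof.
have -> : J = \int[mu]_zw f 0 0 zw by rewrite /J (bmf_fubini1 eta Pr (bf 0 0)).
by apply: Rint_gt0 => [|zw]; [exact: bf|rewrite fE0 expR_gt0].
Qed.

(** The unknown constant C of the discrete filter is its own integral at y = 0, b = 0, which
    converges to the total mass J. Thus numerator and normalisation pass to the limit together. *)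
Let limitE y b : \int[eta]_z \int[Pr]_w f y b (z, w) =
  J * (expR (- cdot (U T *m y) (V T *m y) / 2) * cos (cdot y x0 + b)).
Proof.
have c0 := @integral_cvg 0 0.
have cE : (fun m => expR (- cdot (Um m *m y) (Vm m *m y) / 2) * cos (cdot y x0 + b)) @ \oo -->
    expR (- cdot (U T *m y) (V T *m y) / 2) * cos (cdot y x0 + b).
  apply: cvgM; last exact: cvg_cst.
  apply: (@continuous_cvg _ _ _ \oo _ _ (expR : K -> K)).
    exact: continuous_expR.
  apply: cvgM; last exact: cvg_cst.
  apply: cvgN; apply: cvg_cdot; apply: cvg_mulmx; try exact: cvg_cst.
    exact: UVcvg.1.
  exact: UVcvg.2.
have c1 : (fun m => \int[mu]_zw f_ 0 0 m zw *
    (expR (- cdot (Um m *m y) (Vm m *m y) / 2) * cos (cdot y x0 + b))) @ \oo -->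
    J * (expR (- cdot (U T *m y) (V T *m y) / 2) * cos (cdot y x0 + b)).
  by apply: cvgM; [exact: c0|exact: cE].
suff nE : {near \oo, (fun m => \int[mu]_zw f_ 0 0 m zw *
    (expR (- cdot (Um m *m y) (Vm m *m y) / 2) * cos (cdot y x0 + b))) =1
    (fun m => \int[mu]_zw f_ y b m zw)}.
  have nE' : {near \oo, (fun m => \int[mu]_zw f_ y b m zw) =1 (fun m => \int[mu]_zw f_ 0 0 m zw *
    (expR (- cdot (Um m *m y) (Vm m *m y) / 2) * cos (cdot y x0 + b)))}.
    by move: nE; apply: filterS => m ->.
  have c2 : (fun m => \int[mu]_zw f_ y b m zw) @ \oo -->
     J * (expR (- cdot (U T *m y) (V T *m y) / 2) * cos (cdot y x0 + b)).
    first [exact: (cvg_trans (near_eq_cvg nE') c1)|exact: (cvg_trans (near_eq_cvg nE) c1)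
     |apply: cvg_trans c1; first [exact: near_eq_cvg nE|exact: near_eq_cvg nE'|apply: near_eq_cvg; exact: nE]].
  exact: (cvg_unique _ (@integral_cvg y b) c2).
near=> m.
have m0 : (0 < m)%N by near: m; exact: nbhs_infty_gt.
have hA : T / m%:R * frob A <= 2^-1.
  rewrite mulrAC ler_pdivrMr ?ltr0n// [leRHS]mulrC -ler_pdivrMr ?invr_gt0//.
  by near: m; exact: nbhs_infty_ger.
have [C C0 hC] := discrete_filter Sp Pp BR etaP (h0 m) hA (mincr m) (incr_independent m0).
have CE : \int[mu]_zw f_ 0 0 m zw = C.
  have e00 : expR (- cdot (Um m *m 0) (Vm m *m 0) / 2) * cos (cdot 0 x0 + 0) = 1 :> K.
    by rewrite !mulmx0 !cdot0l oppr0 mul0r expR0 addr0 cos0 mulr1.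
  by have := hC 0 0; rewrite /= -/(Um m) -/(Vm m) e00 mulr1 => <-.
by rewrite /= CE; have := hC y b.
Unshelve. all: by end_near. Qed.

(** Invertibility of U at time T lets any frequency v be written as U y, so [limitE] determines all
    cosine integrals; dividing by the total mass leaves the data of a Gaussian law. *)
Lemma fk_flow_cosdata :
  cosdata (fk_flow Pr S X T eta) ((invmx (U T))^T *m x0) (V T *m invmx (U T)).
Proof.
pose Z := \int[mu]_zw wt zw.
have JZ : J = Z.
  transitivity (\int[mu]_zw f 0 0 zw).
    by rewrite /J (bmf_fubini1 eta Pr (@bf 0 0)).
  by apply: eq_Rintegral => zw _; exact: fE0.
have Z0 : 0 < Z by rewrite -JZ.
have bw' : bmf (fun zw => Z^-1 * wt zw) by exact: bmfZ.
have semi g : bmf g -> \int[eta]_z fk_semigroup Pr S X T g z = \int[mu]_zw (g (Y zw T) * wt zw).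
  move=> bg; have b1 : bmf (fun zw => g (Y zw T) * wt zw).
    by apply: bmfM bwt; apply: bmf_comp bg _; exact: mY.
  transitivity (\int[eta]_z \int[Pr]_w (g (Y (z, w) T) * wt (z, w))).
    by apply: eq_Rintegral => z _; exact: semigroupE.
  exact: (bmf_fubini1 eta Pr b1).
have semi1 : \int[eta]_z fk_semigroup Pr S X T (cst 1) z = Z.
  rewrite semi; last exact: bmf_cst.
  by apply: eq_Rintegral => zw _; rewrite mul1r.
(* The witness for the choice in [fk_flow]: the image under Y at time T of the product law weighted
   by the normalised exponential. *)
have [nu hnu] : exists nu : probability 'cV[K]_n.+1 K, forall g, bmf g ->
    \int[nu]_y g y = \int[mu]_zw (g (Y zw T) * (Z^-1 * wt zw)).
  apply: weighted_law_ex => //; first exact: mY.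
    by move=> zw; rewrite mulr_ge0 ?expR_ge0// invr_ge0 ltW.
  by rewrite int_bmfZ// mulVf// gt_eqF.
have flowE g : bmf g -> \int[fk_flow Pr S X T eta]_y g y = \int[mu]_zw (g (Y zw T) * wt zw) / Z.
  move=> [mg bg]; rewrite -semi// -semi1.
  have ex : [set nu : probability 'cV[K]_n.+1 K |
      forall f : 'cV[K]_n.+1 -> K, measurable_fun setT f ->
      (exists M : K, forall x, `|f x| <= M) ->
      \int[nu]_x f x =
      (\int[eta]_x fk_semigroup Pr S X T f x) / (\int[eta]_x fk_semigroup Pr S X T (cst 1) x)] nu.
    move=> g' mg' bg'; rewrite semi1 semi// hnu//.
    rewrite mulrC -int_bmfZ; last by apply: bmfM bwt; apply: bmf_comp (conj mg' bg') _; exact: mY.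
    by apply: eq_Rintegral => zw _; ring.
  by have := getPex (ex_intro _ nu ex); apply.
move=> v b; rewrite flowE; last first.
  by apply: bmf_cos; apply: measurable_funD; [exact: measurable_cdotl|exact: measurable_cst].
pose y := invmx (U T) *m v.
have Uy : U T *m y = v by rewrite /y mulKVmx.
have := limitE y b; rewrite Uy => lim.
have -> : \int[mu]_zw (cos (cdot v (Y zw T) + b) * wt zw) =
    \int[eta]_z \int[Pr]_w f y b (z, w).
  transitivity (\int[mu]_zw f y b zw); last by rewrite (bmf_fubini1 eta Pr (@bf y b)).
  by apply: eq_Rintegral => zw _; rewrite /f Uy.
rewrite lim JZ mulrC mulKf ?gt_eqF// quadE -mulmxA -/y; congr (expR (- _ / 2) * cos (_ + _)).
by rewrite cdot_mulmxr trmxK.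
Qed.

End feynman_kac_gaussian.

Lemma spnorm0 (K : realType) m n : spnorm (0 : 'M[K]_(m, n)) = 0.
Proof.
apply/eqP; rewrite eq_le spnorm_ge0 andbT /spnorm; apply: ge_sup.
  exact: (spnorm_has_sup 0).1.
by move=> _ [z _ <-]; rewrite mul0mx enorm0.
Qed.

(** * From Riccati estimates to Wasserstein and entropy estimates *)

Section stability.
Context {K : realType} {n : nat}.
Implicit Types (P Q : 'M[K]_n.+1) (x y : 'cV[K]_n.+1).

Lemma riccati_flow_ex (A R S Pinf : 'M[K]_n.+1) (a b : K) :
  psdmx R -> psdmx S -> rank_condition A R S -> posdefmx Pinf -> riccati A R S Pinf = 0 ->
  decays (closed_loop A S Pinf) a b ->
  exists (U V : K -> 'M[K]_n.+1 -> 'M[K]_n.+1) (c lo hi : K),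
  [/\ 0 <= c, 0 < lo,
    forall P, [/\ forall t, misd (U^~ P) t (- A^T *m U t P + S *m V t P),
                 forall t, misd (V^~ P) t (R *m U t P + A *m V t P),
                 U 0 P = 1%:M & V 0 P = P] &
    forall t P, 1 <= t -> psdmx P -> let C Q := V t Q *m invmx (U t Q) in
    [/\ U t P \in unitmx, (C P)^T = C P, ldb (C P) lo, opb (C P) hi &
     forall Q, psdmx Q -> opb (C P - C Q) (c * expR (- (2 * b * t)) * spnorm (P - Q)) /\
      forall x y, enorm ((invmx (U t P))^T *m x - (invmx (U t Q))^T *m y) <=
       c * expR (- b * t) * (enorm (x - y) + spnorm (P - Q) * enorm x)]].
Proof.
move=> Rp Sp rk Pp ric dec.
have [G [Gs GL]] := lyap_ex dec Sp.1.
have [c [lo [hi [c0 lo0 H]]]] := riccati_flow_bounds Rp Sp rk Pp ric dec Gs GL.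
exists (riccati_den A S Pinf G), (riccati_num A S Pinf G), c, lo, hi; split.
- exact: c0.
- exact: lo0.
- move=> P; split.
  + by move=> t; exact: riccati_den_misd.
  + by move=> t; exact: riccati_num_misd.
  + exact: riccati_den0.
  + exact: riccati_num0.
exact: H.
Qed.

Variables (lo hi : K).
Hypothesis lo0 : 0 < lo.

(** Used with u = e^{-beta t} for the means and v = e^{-2 beta t} for the covariances; only the
    slower rate survives in the sum. *)
Lemma wasserstein_bound (nu1 nu2 : probability 'cV[K]_n.+1 K) m1 m2 C1 C2 k u v D s :
  C1^T = C1 -> C2^T = C2 -> ldb C1 lo -> ldb C2 lo -> opb C1 hi ->
  0 <= k -> 0 <= v <= u -> 0 <= s ->
  opb (C1 - C2) (k * v * s) -> enorm (m1 - m2) <= k * u * D ->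
  cosdata nu1 m1 C1 -> cosdata nu2 m2 C2 ->
  (wasserstein 2 nu1 nu2 <=
   (k * u * (D + n.+1%:R * (hi * (lo^-1 * Num.sqrt lo^-1)) * s))%:E)%E.
Proof.
move=> s1 s2 l1 l2 h1 k0 /andP[v0 vu] s0 hd hm d1 d2.
have p1 := posdef_psd (ldb_posdef s1 l1); have p2 := posdef_psd (ldb_posdef s2 l2).
apply: le_trans (wasserstein2_le p1 p2 l1 h1 hd d1 d2) _; rewrite lee_fin mulrDr lerD//.
set L := hi * _.
have L0 : 0 <= L.
  apply: mulr_ge0; first exact: opb_ge0 h1.
  by apply: mulr_ge0; [rewrite invr_ge0 ltW|exact: sqrtr_ge0].
rewrite (_ : n.+1%:R * (L * (k * v * s)) = (n.+1%:R * L * k * s) * v); last by ring.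
rewrite (_ : k * u * _ = (n.+1%:R * L * k * s) * u); last by ring.
by apply: ler_wpM2l; [exact: mulr_ge0 (mulr_ge0 (mulr_ge0 (ler0n _ _) L0) k0) s0|exact: vu].
Qed.

(** Covariance differences enter linearly and mean differences quadratically, so both decay like v =
    e^{-2 beta t}. The factor 2 in the hypothesis on the means anticipates (a + b)^2 <= 2 (a^2 +
    b^2). *)
Lemma entropy_bound (nu1 nu2 : probability 'cV[K]_n.+1 K) m1 m2 C1 C2 k v r D s :
  C1^T = C1 -> C2^T = C2 -> ldb C1 lo -> ldb C2 lo ->
  opb (C1 - C2) (k * v * s) -> 0 <= v -> enorm (m1 - m2) ^+ 2 <= k ^+ 2 * v * (2 * D) ->
  cosdata nu1 m1 C1 -> cosdata nu2 m2 C2 ->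
  n.+1%:R ^+ 2 * lo^-1 * k <= r -> 2 * lo^-1 * k ^+ 2 <= r -> 0 <= s -> 0 <= D ->
  (relative_entropy nu1 nu2 <= (r * (s + D) * v)%:E)%E.
Proof.
move=> s1 s2 l1 l2 hd v0 hm d1 d2 r1 r2 s0 D0.
have p1 := ldb_posdef s1 l1; have p2 := ldb_posdef s2 l2.
apply: le_trans (gaussian_entropy p1 p2 d1 d2) _; rewrite lee_fin.
have i1 := ldb_inv l1; have i2 := ldb_inv l2.
have q1 := mdot_le (opbD i2 (opbN i1)) hd.
have q2 := quad_opb (m1 - m2) (opbD i1 i2).
rewrite -enorm_sqr in q2.
have q3 : (lo^-1 + lo^-1) * enorm (m1 - m2) ^+ 2 <= (lo^-1 + lo^-1) * (k ^+ 2 * v * (2 * D)).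
  by apply: ler_wpM2l hm; rewrite addr_ge0// invr_ge0 ltW.
have q4 := le_trans (ler_norm _) q1; have q5 := le_trans (ler_norm _) (le_trans q2 q3).
apply: (@le_trans _ _ (n.+1%:R ^+ 2 * lo^-1 * k * (v * s) + 2 * lo^-1 * k ^+ 2 * (v * D))).
  have -> : n.+1%:R ^+ 2 * lo^-1 * k * (v * s) + 2 * lo^-1 * k ^+ 2 * (v * D) =
     2^-1 * (n.+1%:R ^+ 2 * ((lo^-1 + lo^-1) * (k * v * s)) +
       (lo^-1 + lo^-1) * (k ^+ 2 * v * (2 * D))) by field; rewrite gt_eqF.
  by apply: ler_wpM2l; [rewrite invr_ge0|apply: lerD].
have -> : r * (s + D) * v = r * (v * s) + r * (v * D) by ring.
by apply: lerD; apply: ler_wpM2r => //; exact: mulr_ge0.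
Qed.

End stability.

Theorem theorem3p4 (K : realType) (n : nat) (A R S Pinf : 'M[K]_n.+1)
    (alpha beta : K) :
  psdmx R -> psdmx S -> rank_condition A R S ->
  posdefmx Pinf -> riccati A R S Pinf = 0 ->
  0 < alpha -> 0 < beta ->
  (forall t : K, 0 <= t ->
    spnorm (expmx (t *: (A - Pinf *m S))) <= alpha * expR (- beta * t)) ->
  exists delta c : K -> K, (forall r : K, 0 <= r -> 0 < delta r) /\
  forall (q : nat) (B : 'M[K]_(n.+1, q.+1)) (d : measure_display)
    (Omega : measurableType d) (Pr : probability Omega K)
    (W : K -> Omega -> 'cV[K]_q.+1)
    (X : 'cV[K]_n.+1 -> K -> Omega -> 'cV[K]_n.+1),
  B *m B^T = R -> brownian Pr W -> linear_diffusion Pr A B W X ->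
  forall (x y : 'cV[K]_n.+1) (P Q : 'M[K]_n.+1)
    (eta0 mu0 : probability 'cV[K]_n.+1 K),
  psdmx P -> psdmx Q -> gaussian_law eta0 x P -> gaussian_law mu0 y Q ->
  let Phi := fk_flow Pr S X in
  let dl := delta (spnorm (P - Q)) in
  [/\ forall t : K, dl <= t ->
        (wasserstein 2 (Phi t eta0) (Phi t mu0) <=
          (c dl * expR (- beta * t) *
            (enorm (x - y) + Num.max (enorm x) 1 * spnorm (P - Q)))%:E)%E,
      \forall t \near +oo,
        (relative_entropy (Phi t eta0) (Phi t mu0) <=
          (c dl * (spnorm (P - Q) +
              (enorm x ^+ 2 * spnorm (P - Q) ^+ 2 + enorm (x - y) ^+ 2)) *
            expR (- (2 * beta * t)))%:E)%E
    & P = Q -> forall (k : nat) (t : K), (1 <= k)%N -> dl <= t ->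
        (wasserstein k (Phi t eta0) (Phi t mu0) <=
          (c dl * expR (- beta * t) * enorm (x - y))%:E)%E /\
        (relative_entropy (Phi t eta0) (Phi t mu0) <=
          (c dl * expR (- (2 * beta * t)) * enorm (x - y) ^+ 2)%:E)%E ].
Proof.
move=> Rp Sp rk Pp ric a0 b0 hdec.
have dec : decays (closed_loop A S Pinf) alpha beta.
  split=> // t t0; have [s0 h] := opb_spnorm (expmx (t *: closed_loop A S Pinf)).
  have le := hdec t t0; split; first exact: le_trans le.
  by move=> z; apply: le_trans (h z) _; apply: ler_wpM2r; [exact: enorm_ge0|exact: le].
have [U [V [k [lo [hi [k0 lo0 ode H]]]]]] := riccati_flow_ex Rp Sp rk Pp ric dec.
have hi0 : 0 <= hi.
  (* Any positive semi-definite matrix would do as initial covariance here; R is one at hand. *)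
  have [_ _ _ h _] := H 1 R (lexx _) Rp; exact: opb_ge0 h.
pose L := n.+1%:R * (hi * (lo^-1 * Num.sqrt lo^-1)).
have lo1 : 0 <= lo^-1 by rewrite invr_ge0 ltW.
have L0 : 0 <= L by rewrite /L !mulr_ge0 ?sqrtr_ge0.
pose r1 := n.+1%:R ^+ 2 * lo^-1 * k; pose r2 := 2 * lo^-1 * k ^+ 2.
have r10 : 0 <= r1 by rewrite /r1 !mulr_ge0 ?sqr_ge0.
have r20 : 0 <= r2 by rewrite /r2 !mulr_ge0 ?sqr_ge0.
(* The first term bounds the Wasserstein constants, with L the cost of transporting covariances;
   [r1] and [r2] are the covariance and mean constants of the entropy bound. *)
pose cc := k * (1 + L) + (r1 + r2).
have kL : k <= k * (1 + L) by rewrite mulrDr mulr1 lerDl; exact: mulr_ge0 k0 L0.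
have kcc : k <= cc by apply: (le_trans kL); rewrite lerDl; exact: addr_ge0 r10 r20.
have kLcc : k * (1 + L) <= cc by rewrite lerDl; exact: addr_ge0 r10 r20.
have r1cc : r1 <= cc by rewrite /cc addrCA lerDl; exact: addr_ge0 (le_trans k0 kL) r20.
have r2cc : r2 <= cc by rewrite /cc addrA lerDr; exact: addr_ge0 (le_trans k0 kL) r10.
exists (fun=> 1), (fun=> cc); split; first by move=> *; exact: ltr01.
move=> q B d Omega Pr W X BR bW dX x y P Q eta0 mu0 Pps Qps getaP gmuQ Phi dl.
have etaP := gaussian_law_cosdata Pps getaP; have muQ := gaussian_law_cosdata Qps gmuQ.
have flow t (z : 'cV[K]_n.+1) P' (nu : probability 'cV[K]_n.+1 K) : 1 <= t -> psdmx P' ->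
    cosdata nu z P' -> cosdata (Phi t nu) ((invmx (U t P'))^T *m z) (V t P' *m invmx (U t P')).
  move=> t1 P'ps hnu; have [dU dV U0 V0] := ode P'; have [Uu _ _ _ _] := H t P' t1 P'ps.
  have t0 : 0 < t by exact: lt_le_trans t1.
  exact: (fk_flow_cosdata Sp BR bW dX t0 P'ps hnu dU dV U0 V0 Uu).
have E0 t : 0 <= expR (- beta * t) by exact: expR_ge0.
have E2 t : expR (- (2 * beta * t)) = expR (- beta * t) ^+ 2.
  by rewrite expr2 -expRD; congr expR; ring.
have E2le t : 1 <= t -> 0 <= expR (- (2 * beta * t)) <= expR (- beta * t).
  move=> t1; rewrite expR_ge0 /= ler_expR -subr_ge0 (_ : _ - _ = beta * t); last by ring.
  by rewrite mulr_ge0 ?(ltW b0)// (le_trans ler01).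
have s0 := spnorm_ge0 (P - Q).
have ent t : 1 <= t -> (relative_entropy (Phi t eta0) (Phi t mu0) <=
          (cc * (spnorm (P - Q) +
              (enorm x ^+ 2 * spnorm (P - Q) ^+ 2 + enorm (x - y) ^+ 2)) *
            expR (- (2 * beta * t)))%:E)%E.
  move=> t1; have [_ sP lP oP hPQ] := H t P t1 Pps; have [_ sQ lQ _ _] := H t Q t1 Qps.
  have [hC hm] := hPQ Q Qps.
  apply: (entropy_bound lo0 sP sQ lP lQ hC (expR_ge0 _) _
    (flow _ _ _ _ t1 Pps etaP) (flow _ _ _ _ t1 Qps muQ) r1cc r2cc s0).
    have h1 := hm x y; have e0 := enorm_ge0 ((invmx (U t P))^T *m x - (invmx (U t Q))^T *m y).
    have h2 : 0 <= k * expR (- beta * t) * (enorm (x - y) + spnorm (P - Q) * enorm x).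
      exact: le_trans h1.
    have := ler_pM e0 e0 h1 h1; rewrite -!expr2 => /le_trans; apply.
    rewrite E2 !exprMn; apply: ler_wpM2l; first exact: mulr_ge0 (sqr_ge0 _) (sqr_ge0 _).
    (* The identity 2 (a^2 + b^2) - (a + b)^2 = (a - b)^2. *)
    rewrite -subr_ge0 (_ : _ - _ = (enorm (x - y) - spnorm (P - Q) * enorm x) ^+ 2) ?sqr_ge0//.
    by ring.
  exact: addr_ge0 (mulr_ge0 (sqr_ge0 _) (sqr_ge0 _)) (sqr_ge0 _).
split.
- move=> t t1; have [_ sP lP oP hPQ] := H t P t1 Pps; have [_ sQ lQ _ _] := H t Q t1 Qps.
  have [hC hm] := hPQ Q Qps.
  apply: le_trans (wasserstein_bound lo0 sP sQ lP lQ oP k0 (E2le t t1) s0 hC (hm x y)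
    (flow _ _ _ _ t1 Pps etaP) (flow _ _ _ _ t1 Qps muQ)) _.
  rewrite lee_fin -/L; set u := expR _; set mx := Num.max _ _.
  (* The maximum plays both parts: it dominates the norm of x, which multiplies |P - Q| in the
     means, and the 1 in the term L |P - Q| from the covariances. *)
  have m1 : 1 <= mx by rewrite le_max lexx orbT.
  have m2 : enorm x <= mx by rewrite le_max lexx.
  have m0 : 0 <= mx := le_trans ler01 m1.
  have u0 : 0 <= u by exact: expR_ge0.
  apply: (@le_trans _ _ (k * (1 + L) * u * (enorm (x - y) + mx * spnorm (P - Q)))).
    rewrite (_ : k * (1 + L) * u * _ = k * u * ((1 + L) * (enorm (x - y) + mx * spnorm (P - Q)))); last by ring.
    apply: ler_wpM2l; first exact: mulr_ge0.
    have d1 : 0 <= mx - 1 by rewrite subr_ge0.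
    have d2 : 0 <= mx - enorm x by rewrite subr_ge0.
    have t2 := mulr_ge0 d2 s0; have t3 := mulr_ge0 (mulr_ge0 L0 d1) s0.
    have t4 := mulr_ge0 L0 (enorm_ge0 (x - y)).
    rewrite -subr_ge0 (_ : _ - _ = (mx - enorm x) * spnorm (P - Q) +
      L * (mx - 1) * spnorm (P - Q) + L * enorm (x - y)); last by ring.
    exact: addr_ge0 (addr_ge0 t2 t3) t4.
  apply: ler_wpM2r; first exact: addr_ge0 (enorm_ge0 _) (mulr_ge0 m0 s0).
  by apply: ler_wpM2r.
(* The same threshold serves the entropy: its bound already holds for all t >= 1. *)
- exists 1; split; first exact: num_real.
  by move=> t /ltW; exact: ent.
move=> PQ j t j1 t1; split; last first.
  have := ent t t1; rewrite PQ subrr spnorm0 expr0n mulr0 !add0r => /le_trans; apply.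
  by rewrite lee_fin le_eqVlt; apply/orP; left; apply/eqP; ring.
have [_ sP lP oP hPQ] := H t P t1 Pps; have [hC hm] := hPQ P Pps.
rewrite -PQ in muQ.
apply: le_trans (wasserstein_same_cov j1 (flow _ _ _ _ t1 Pps etaP) (flow _ _ _ _ t1 Pps muQ)) _.
rewrite lee_fin (le_trans (hm x y))// subrr spnorm0 mul0r addr0.
by apply: ler_wpM2r; [exact: enorm_ge0|apply: ler_wpM2r; [exact: E0|exact: kcc]].
Qed.
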